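(* Let $n\in\{2,3\}$ and let $P\subset\mathbb{R}^n$ be a (bounded, convex) polyhedron containing the origin in its interior. Suppose that for every $k$ and every face $F\subset P$ of codimension $k$, the Euclidean distance from $0$ to the affine span of $F$ is at least $\sqrt{k}$. Then the $(n-1)$-dimensional volume of the boundary $\partial P$ (the surface area of $P$) is at least $n2^n$.
   Context: A polyhedron here is a bounded convex polyhedron, i.e. the convex hull of finitely many points (equivalently, a bounded intersection of finitely many closed half-spaces). Faces are nonempty. A face $F$ of $P$ has codimension $k$ if its affine span has dimension $n-k$; so $P$ itself is the face of codimension $0$, facets have codimension $1$, and vertices have codimension $n$. The $(n-1)$-dimensional volume of $\partial P$ is the sum of the $(n-1)$-dimensional Lebesgue measures of the facets of $P$ (perimeter for $n=2$, surface area for $n=3$). Distances are Euclidean. *)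

(* Defs.v *)
From HB Require Import structures.
From mathcomp Require Import all_boot all_order all_algebra.
From mathcomp Require Import all_classical all_reals all_analysis.

Set Implicit Arguments.
Unset Strict Implicit.
Unset Printing Implicit Defensive.

Import Order.TTheory GRing.Theory Num.Theory.
Import numFieldNormedType.Exports.

Local Open Scope classical_set_scope.
Local Open Scope ring_scope.

(* The norm that the library puts on ['rV[R]_n] is the sup norm. It induces the
   usual topology, but the Euclidean norm has to be defined. *)
Definition euclid_norm (R : realType) (n : nat) (x : 'rV[R]_n) : R :=
  Num.sqrt (\sum_(i < n) x 0 i ^+ 2).

Definition euclid_dist (R : realType) (n : nat) (p : 'rV[R]_n)
    (A : set 'rV[R]_n) : R :=
  inf [set euclid_norm (p - x) | x in A].

Definition convex_hull (R : realType) (n : nat) (S : set 'rV[R]_n) :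
    set 'rV[R]_n :=
  [set x | exists (m : nat) (w : 'I_m -> R) (v : 'I_m -> 'rV[R]_n),
     [/\ forall i, S (v i), forall i, 0 <= w i, \sum_i w i = 1
       & x = \sum_i w i *: v i]].

Definition affine_span (R : realType) (n : nat) (S : set 'rV[R]_n) :
    set 'rV[R]_n :=
  [set x | exists (m : nat) (w : 'I_m -> R) (v : 'I_m -> 'rV[R]_n),
     [/\ forall i, S (v i), \sum_i w i = 1 & x = \sum_i w i *: v i]].

Definition polyhedron (R : realType) (n : nat) (P : set 'rV[R]_n) : Prop :=
  exists2 V : set 'rV[R]_n, finite_set V & P = convex_hull V.

(* [c *m x^T] is the 1 x 1 matrix holding the inner product of c and x.
   Taking c = 0 and b = 0 shows that P is a face of itself when it is
   nonempty. *)
Definition face (R : realType) (n : nat) (P F : set 'rV[R]_n) : Prop :=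
  F !=set0 /\
  exists (c : 'rV[R]_n) (b : R),
    (forall x, P x -> (c *m x^T) 0 0 <= b) /\
    F = P `&` [set x | (c *m x^T) 0 0 = b].

Definition codimension (R : realType) (n k : nat) (F : set 'rV[R]_n) : Prop :=
  exists (p : 'rV[R]_n) (U : {vspace 'rV[R]_n}),
    (\dim U + k = n)%N /\ affine_span F = [set p + u | u in [set` U]].

Definition facet (R : realType) (n : nat) (P F : set 'rV[R]_n) : Prop :=
  face P F /\ codimension 1 F.

(* m-dimensional Lebesgue measure, one coordinate at a time: the recursive step
   is the formula that defines the product measure in the library, the
   measure of [S] being the integral of the measures of its sections. *)
Fixpoint lebesgue_rV (R : realType) (m : nat) : set 'rV[R]_m -> \bar R :=
  match m with
  | 0 => fun S => (\1_S 0)%:E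
  | m'.+1 => fun S =>
      (\int[@lebesgue_measure R]_x
         lebesgue_rV [set y : 'rV[R]_m' | S (row_mx x%:M y)])%E
  end.

(* [(p, A)] is a system of orthonormal coordinates on the affine span of [F]:
   the rows of [A] are orthonormal, so that y |-> p + y *m A is an isometry
   from R^m onto that affine span. *)
Definition orthonormal_frame (R : realType) (n m : nat) (F : set 'rV[R]_n)
    (f : 'rV[R]_n * 'M[R]_(m, n)) : Prop :=
  f.2 *m f.2^T = 1%:M /\
  affine_span F = [set f.1 + y *m f.2 | y in [set: 'rV[R]_m]].

(* m-dimensional Lebesgue measure of a set whose affine span has dimension m,
   computed in some orthonormal coordinates (their choice is irrelevant, by
   invariance of the Lebesgue measure under isometries). The default value
   [(0, 0)] is only used when the affine span does not have dimension m. *)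
Definition volume (R : realType) (n m : nat) (F : set 'rV[R]_n) : \bar R :=
  let f := xget (0, 0) (@orthonormal_frame R n m F) in
  lebesgue_rV [set y : 'rV[R]_m | F (f.1 + y *m f.2)].

(* A polyhedron has finitely many facets, so the [esum] is a finite sum. *)
Definition boundary_volume (R : realType) (n : nat) (P : set 'rV[R]_n) :
    \bar R :=
  \esum_(F in facet P) volume n.-1 F.

(* Main.v *)
Require Import Defs.
From HB Require Import structures.
From mathcomp Require Import all_boot all_order all_algebra.
From mathcomp Require Import all_classical all_reals all_analysis.
From mathcomp Require Import measurable_realfun.
From mathcomp Require Import ring lra.

(** The cones with apex the origin over the facets of [P] cover the space.
    Hence the facets are seen from the origin under angles whose sum is at
    least [2 * pi] in the plane, and under solid angles whose sum is at least
    [4 * pi] in space. It is enough to show that the measure of each facet is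
    at least [4 / pi] times its angle if [n = 2], and at least [6 / pi] times
    its solid angle if [n = 3]: the bounds [8] and [24] follow by summation.
    These ratios are those of the square and of the cube of side [2], for which
    all the distances in the hypothesis are attained.

    In the plane, let an edge be at distance [d] from the origin, with ends at
    the abscissas [t1 <= t2] on its line. Its angle is
    [atan (t2 / d) - atan (t1 / d)], and both ends are outside the open disc of
    radius [sqrt 2]. Outside the disc the inequality holds between derivatives.
    If the edge goes through the disc, it contains the whole chord, and the
    inequality for chords follows from a convexity in the half-length of the
    chord: this is [edge_plane].

    In space, let [h] be the distance from the origin to the plane of a facet
    and [O] the foot of the perpendicular. If [O] is not interior to the facet,
    the point of the facet nearest to [O] is on a proper face, so the facet
    stays outside the open ball of radius [sqrt 2], and there the density
    [angle_density h] of the solid angle is at most [1 / 2 <= pi / 6].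
    Otherwise the facet is cut into triangles with apex [O] over its edges
    ([polygon_bound]), and [edge_space] compares the solid angle of each
    triangle with its area. The scheme is that of the plane: the ends of the
    edge are outside the ball of radius [sqrt 3], outside this ball derivatives
    are compared, and a chord of the ball is treated as a whole by
    [tri_angle_le]. There the solid angle is a single arctangent, bounded in
    [atan_chord] by a convex function with value [pi / 12 = atan (2 - sqrt 3)]
    at the cube.

    The polytope is the hull of a list [W], and a facet is represented by the
    linear form [c] whose value on it is [1] ([is_facet]); [cone_cover] comes
    from the separation of a point from the hull. The hypothesis is used
    through [deep_orthonormal]: a face on which [k] orthonormal forms are
    constant is at distance at least [sqrt k]. The areas and volumes rest on
    the behaviour of Lebesgue measure under linear maps, obtained from shears
    and Tonelli's theorem ([scales_affine2], [scales_linear3]), and on an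
    integration formula for cones ([cone_subst]). *)

Import Order.TTheory GRing.Theory Num.Theory.
Import numFieldNormedType.Exports.
Local Open Scope classical_set_scope.
Local Open Scope ring_scope.
Set Implicit Arguments.
Unset Strict Implicit.
Unset Printing Implicit Defensive.

(** * Linear changes of variables *)

(** The form in which changes of variables are used below: [T] multiplies the
    integrals of nonnegative functions by [k], which for a linear map is the
    inverse of the absolute value of its determinant. *)
Definition scales (R : realType) d (X : measurableType d)
    (m : {measure set X -> \bar R}) (T : X -> X) (k : R) : Prop :=
  measurable_fun setT T /\
  forall f : X -> \bar R, measurable_fun setT f -> (forall x, 0 <= f x)%E ->
    (\int[m]_x f (T x) = k%:E * \int[m]_x f x)%E.

Lemma scales_comp (R : realType) d (X : measurableType d)
    (m : {measure set X -> \bar R}) (T T' : X -> X) (k k' : R) :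
  scales m T k -> scales m T' k' -> scales m (T \o T') (k' * k).
Proof.
move=> [mT sT] [mT' sT']; split; first exact: measurableT_comp.
move=> f mf f0 /=.
rewrite (sT' (f \o T)) => [|//=|x]; last exact: f0.
  by rewrite /comp sT// EFinM muleA.
exact: measurableT_comp.
Qed.

(** By Tonelli, a map that moves one coordinate only is controlled by the maps
    that it induces on the fibres. Shears are of this kind, and elimination
    writes every invertible linear map as a composite of such maps. *)
Lemma scales_fst (R : realType) d d' (X : measurableType d)
    (Y : measurableType d') (m1 : {sigma_finite_measure set X -> \bar R})
    (m2 : {sigma_finite_measure set Y -> \bar R}) (G : X * Y -> X) (k : R) :
  (0 <= k) -> measurable_fun setT G ->
  (forall y, scales m1 (fun x => G (x, y)) k) ->
  scales (m1 \x m2)%E (fun z => (G z, z.2)) k.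
Proof.
move=> k0 mG sG.
have mT : measurable_fun setT (fun z : X * Y => (G z, z.2)).
  by apply/measurable_fun_pair => //; exact: measurable_snd.
split=> // f mf f0.
have mfT := measurableT_comp mf mT.
rewrite (@fubini_tonelli2 _ _ _ _ R m1 m2 (fun z => f (G z, z.2)))//=.
rewrite (@fubini_tonelli2 _ _ _ _ R m1 m2 f)//.
rewrite -ge0_integralZl//.
- apply: eq_integral => y _; rewrite /fubini_G/=.
  have [_ /(_ (fun x => f (x, y)))] := sG y; apply => //.
  exact: (measurableT_comp mf (measurable_pair2 y)).
- exact: measurable_fun_fubini_tonelli_G.
- by move=> y _; apply: integral_ge0.
Qed.

Lemma scales_snd (R : realType) d d' (X : measurableType d)
    (Y : measurableType d') (m1 : {sigma_finite_measure set X -> \bar R})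
    (m2 : {sigma_finite_measure set Y -> \bar R}) (H : X * Y -> Y) (k : R) :
  (0 <= k) -> measurable_fun setT H ->
  (forall x, scales m2 (fun y => H (x, y)) k) ->
  scales (m1 \x m2)%E (fun z => (z.1, H z)) k.
Proof.
move=> k0 mG sG.
have mT : measurable_fun setT (fun z : X * Y => (z.1, H z)).
  by apply/measurable_fun_pair => //; exact: measurable_fst.
split=> // f mf f0.
have mfT := measurableT_comp mf mT.
rewrite (@fubini_tonelli1 _ _ _ _ R m1 m2 (fun z => f (z.1, H z)))//=.
rewrite (@fubini_tonelli1 _ _ _ _ R m1 m2 f)//.
rewrite -ge0_integralZl//.
- apply: eq_integral => x _; rewrite /fubini_F/=.
  have [_ /(_ (fun y => f (x, y)))] := sG x; apply => //.
  exact: (measurableT_comp mf (measurable_pair1 x)).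
- exact: measurable_fun_fubini_tonelli_F.
- by move=> y _; apply: integral_ge0.
Qed.

Notation lam1 R := (@lebesgue_measure R).
Notation plane R := (measurableTypeR R * measurableTypeR R)%type.
Notation space3 R := (measurableTypeR R * plane R)%type.

(** The product measure gets a name and instances of its own so that it can be
    a factor of [lam3]. *)
Definition lam2 (R : realType) : set (plane R) -> \bar R :=
  (lam1 R \x lam1 R)%E.
HB.instance Definition _ (R : realType) := Measure.on (@lam2 R).

Lemma lam2_sigma_finite (R : realType) : sigma_finite setT (@lam2 R).
Proof.
exists (fun n : nat => `[(- n%:R), n%:R] `*` `[(- n%:R), n%:R]).
  apply/esym; rewrite -subTset => -[x y] _.
  exists (Num.bound x + Num.bound y)%N => //.
  have B (r s : R) : `|r| <= (Num.bound r + Num.bound s)%N%:R.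
    have /ltW := archi_boundP (normr_ge0 r); rewrite /Num.bound normr_id => h.
    by rewrite natrD (le_trans h)// lerDl.
  by split; rewrite /= in_itv/= -ler_norml ?B// addnC B.
move=> n; split; first exact: measurableX.
set A := `[_, _]%classic.
have mA : measurable A by exact: measurable_itv.
have -> : lam2 (A `*` A) = (lam1 R A * lam1 R A)%E
  by apply: (@product_measure1E _ _ _ _ R (lam1 R) (lam1 R)).
rewrite /A !lebesgue_measure_itv/=.
by case: ifP; rewrite ?mule0 ?ltry// -EFinD -EFinM ltry.
Qed.
HB.instance Definition _ (R : realType) :=
  Measure_isSigmaFinite.Build _ _ _ (@lam2 R) (lam2_sigma_finite R).

Definition lam3 (R : realType) : set (space3 R) -> \bar R :=
  (lam1 R \x @lam2 R)%E.
HB.instance Definition _ (R : realType) := Measure.on (@lam3 R).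

(** Once multiplied by [`|a|], the left-hand side is a measure which agrees
    with Lebesgue measure on intervals. *)
Lemma lebesgue_affine (R : realType) (a b : R) (A : set R) : a != 0 ->
  measurable A ->
  lam1 R [set x | A (a * x + b)] = (`|a|^-1%:E * lam1 R A)%E.
Proof.
move=> a0 mA.
have mT : measurable_fun setT (fun x : measurableTypeR R => a * x + b : measurableTypeR R).
  apply: measurable_funD => //; apply: measurable_funM => //.
pose m' : {measure set (measurableTypeR R) -> \bar R} :=
  mscale (NngNum (normr_ge0 a))
    (measure_function_pushforward__canonical__measure_function_Measure (lam1 R) mT).
have : lam1 R A = m' A.
  apply: (lebesgue_measure_unique (mu := m')) => // _ [[x y]] _ <-.
  rewrite /m' /= /mscale/= /pushforward.
  have H p q : p < q -> (`|p - q| = q - p).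
    by move=> pq; rewrite ltr0_norm ?subr_lt0// opprB.
  have [a_gt0|a_lt0|a00] := ltgtP 0 a; last by rewrite -a00 eqxx in a0.
  - have -> : (fun z : R => a * z + b) @^-1` `]x, y]%classic = `](x - b) / a, (y - b) / a]%classic.
      apply/seteqP; split => z /=; rewrite !in_itv/= ltr_pdivrMr// ler_pdivlMr// ltrBlDr lerBrDr [z * a]mulrC; exact.
    rewrite !lebesgue_measure_itv/= !lte_fin ltr_pM2r ?invr_gt0// ltrD2r.
    case: ifP => // _; last by rewrite mule0.
    rewrite -!EFinD -EFinM gtr0_norm//; congr EFin; field; exact: lt0r_neq0.
  - have -> : (fun z : R => a * z + b) @^-1` `]x, y]%classic = `[(y - b) / a, (x - b) / a[%classic.
      apply/seteqP; split => z /=; rewrite !in_itv/= ler_ndivrMr// ltr_ndivlMr// ltrBlDr lerBrDr [z * a]mulrC andbC; exact.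
    rewrite !lebesgue_measure_itv/= !lte_fin ltr_nM2r ?invr_lt0// ltrD2r.
    case: ifP => // _; last by rewrite mule0.
    rewrite -!EFinD -EFinM ltr0_norm//; congr EFin; field; exact: ltr0_neq0.
move=> ->; rewrite /m' /= /mscale/= /pushforward muleA -EFinM mulVf ?mul1e//.
by rewrite normr_eq0.
Qed.

Lemma scales_affine1 (R : realType) (a b : R) : a != 0 ->
  scales (lam1 R) (fun x => a * x + b) `|a|^-1.
Proof.
move=> a0.
have mT : measurable_fun setT (fun x : measurableTypeR R => a * x + b : measurableTypeR R).
  by apply: measurable_funD => //; exact: measurable_funM.
split=> // f mf f0.
have := @ge0_integral_pushforward _ _ _ _ R _ mT (lam1 R) setT f.
rewrite preimage_setT /comp => <-//.
have k0 : 0 <= `|a|^-1 by rewrite invr_ge0.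
rewrite -(ge0_integral_mscale _ measurableT (NngNum k0))//.
by apply: eq_measure_integral => A mA _; exact: lebesgue_affine.
Qed.

Lemma measurable_affine_form2 (R : realType) (a b e : R) :
  measurable_fun setT
    (fun z : measurableTypeR R * measurableTypeR R =>
       a * z.1 + b * z.2 + e : measurableTypeR R).
Proof.
by apply: measurable_funD => //; apply: measurable_funD => //;
  apply: measurable_funM.
Qed.

(** Elimination with pivot [a]: first move the first coordinate, then the
    second one by a map with slope [d - b * c / a]. *)
Lemma scales_affine2_pivot (R : realType) (a b c d e f : R) : a != 0 ->
  a * d - b * c != 0 ->
  scales (@lam2 R)%E
    (fun z => (a * z.1 + b * z.2 + e, c * z.1 + d * z.2 + f))
    `|a * d - b * c|^-1.
Proof.
move=> a0 D0.
pose T1 (z : measurableTypeR R * measurableTypeR R) : measurableTypeR R * measurableTypeR R := (a * z.1 + b * z.2 + e, z.2).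
pose T2 (z : measurableTypeR R * measurableTypeR R) : measurableTypeR R * measurableTypeR R :=
  (z.1, (c / a) * z.1 + (d - b * c / a) * z.2 + (f - c / a * e)).
have d0 : d - b * c / a != 0.
  by apply: contra_neq D0 => /(congr1 (fun x => x * a)); rewrite mul0r mulrBl divfK// [d * a]mulrC.
have s1 : scales (@lam2 R) T1 `|a|^-1.
  refine (@scales_fst R _ _ _ _ (lam1 R) (lam1 R) (fun z => a * z.1 + b * z.2 + e) `|a|^-1 _ _ _).
  - by rewrite invr_ge0.
  - exact: measurable_affine_form2.
  - move=> y; have := scales_affine1 (b * y + e) a0.
    by under eq_fun do rewrite addrA.
have s2 : scales (@lam2 R) T2 `|d - b * c / a|^-1.
  refine (@scales_snd R _ _ _ _ (lam1 R) (lam1 R) (fun z => (c / a) * z.1 + (d - b * c / a) * z.2 + (f - c / a * e)) _ _ _ _).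
  - by rewrite invr_ge0.
  - exact: measurable_affine_form2.
  - move=> y; have := scales_affine1 (c / a * y + (f - c / a * e)) d0.
    by under eq_fun do rewrite addrCA addrA.
have := scales_comp s2 s1.
rewrite -invfM -normrM [X in X^-1](_ : _ = `|a * d - b * c|); last first.
  by congr (`|_|); field.
rewrite (_ : T2 \o T1 = fun z => (a * z.1 + b * z.2 + e, c * z.1 + d * z.2 + f))//.
by apply/funext => z; rewrite /T2 /T1 /=; congr pair; field.
Qed.

(** Without the pivot, shear first: composing with [(x, y) |-> (x, y - x)]
    changes neither the determinant nor Lebesgue measure. *)
Lemma scales_affine2 (R : realType) (a b c d e f : R) :
  a * d - b * c != 0 ->
  scales (@lam2 R)%E
    (fun z => (a * z.1 + b * z.2 + e, c * z.1 + d * z.2 + f))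
    `|a * d - b * c|^-1.
Proof.
move=> D0; have [a0|a0] := eqVneq a 0; last exact: scales_affine2_pivot.
have b0 : a + b != 0.
  by apply: contra_neq D0; rewrite a0 add0r => ->; rewrite !mul0r subrr.
have D0' : (a + b) * d - b * (c + d) != 0.
  by rewrite (_ : _ - _ = a * d - b * c)//; ring.
have one0 : (1 : R) * 1 - 0 * (- 1) != 0 by rewrite mulr1 mul0r subr0 oner_neq0.
have := scales_comp (scales_affine2_pivot e f b0 D0')
   (scales_affine2_pivot 0 0 (oner_neq0 _) one0).
rewrite mulr1 mul0r subr0 normr1 invr1 mul1r.
rewrite (_ : (a + b) * d - b * (c + d) = a * d - b * c); last by ring.
rewrite (_ : _ \o _ = fun z => (a * z.1 + b * z.2 + e, c * z.1 + d * z.2 + f))//.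
by apply/funext => z /=; congr pair; ring.
Qed.

Lemma measurable_affine_form3 (R : realType) (a b c e : R) :
  measurable_fun setT
    (fun z : measurableTypeR R * (measurableTypeR R * measurableTypeR R) =>
       a * z.1 + b * z.2.1 + c * z.2.2 + e : measurableTypeR R).
Proof.
apply: measurable_funD => //; apply: measurable_funD.
  apply: measurable_funD; apply: measurable_funM => //.
  by apply: measurableT_comp; [exact: measurable_fst|exact: measurable_snd].
apply: measurable_funM => //.
by apply: measurableT_comp; [exact: measurable_snd|exact: measurable_snd].
Qed.

Definition det3 (R : realType) (a1 a2 a3 b1 b2 b3 c1 c2 c3 : R) : R :=
  a1 * (b2 * c3 - b3 * c2) - a2 * (b1 * c3 - b3 * c1) + a3 * (b1 * c2 - b2 * c1).

(** Elimination with pivot [a1]: after the first coordinate has been moved,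
    the other two undergo a plane map whose matrix [p, q, r, s] is the Schur
    complement of the pivot. *)
Lemma scales_linear3_pivot (R : realType) (a1 a2 a3 b1 b2 b3 c1 c2 c3 : R) :
  a1 != 0 -> det3 a1 a2 a3 b1 b2 b3 c1 c2 c3 != 0 ->
  scales (@lam3 R)%E
    (fun z => (a1 * z.1 + a2 * z.2.1 + a3 * z.2.2,
       (b1 * z.1 + b2 * z.2.1 + b3 * z.2.2, c1 * z.1 + c2 * z.2.1 + c3 * z.2.2)))
    `|det3 a1 a2 a3 b1 b2 b3 c1 c2 c3|^-1.
Proof.
move=> a0 D0.
pose X := (measurableTypeR R * (measurableTypeR R * measurableTypeR R))%type.
pose T1 (z : X) : X := (a1 * z.1 + a2 * z.2.1 + a3 * z.2.2 + 0, z.2).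
pose p := b2 - a2 * b1 / a1; pose q := b3 - a3 * b1 / a1.
pose r := c2 - a2 * c1 / a1; pose s := c3 - a3 * c1 / a1.
pose T2 (z : X) : X :=
  (z.1, ((b1 / a1) * z.1 + p * z.2.1 + q * z.2.2 + 0,
         (c1 / a1) * z.1 + r * z.2.1 + s * z.2.2 + 0)).
have dE : a1 * (p * s - q * r) = det3 a1 a2 a3 b1 b2 b3 c1 c2 c3.
  by rewrite /p /q /r /s /det3; field.
have d0 : p * s - q * r != 0.
  by apply: contra_neq D0; rewrite -dE => ->; rewrite mulr0.
have s1 : scales (@lam3 R) T1 `|a1|^-1.
  refine (@scales_fst R _ _ _ _ (lam1 R) (@lam2 R) (fun z : X => a1 * z.1 + a2 * z.2.1 + a3 * z.2.2 + 0) _ _ _ _).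
  - by rewrite invr_ge0.
  - exact: measurable_affine_form3.
  - move=> y; have := scales_affine1 (a2 * y.1 + a3 * y.2 + 0) a0.
    by under eq_fun do rewrite !addrA.
have s2 : scales (@lam3 R) T2 `|p * s - q * r|^-1.
  refine (@scales_snd R _ _ _ _ (lam1 R) (@lam2 R) (fun z : X => ((b1 / a1) * z.1 + p * z.2.1 + q * z.2.2 + 0,
         (c1 / a1) * z.1 + r * z.2.1 + s * z.2.2 + 0)) _ _ _ _).
  - by rewrite invr_ge0.
  - by apply/measurable_fun_pair; exact: measurable_affine_form3.
  - move=> y; have := scales_affine2 (b1 / a1 * y) (c1 / a1 * y) d0.
    congr scales; apply/funext => z /=.
    by congr pair; ring.
have := scales_comp s2 s1.
rewrite -invfM -normrM dE.
congr scales; apply/funext => z; rewrite /T2 /T1 /p /q /r /s /=.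
by congr pair; [ring|congr pair; field].
Qed.

(** When the pivot vanishes, adding to the first column [a2] times the second
    and [a3] times the third replaces it by [a2 ^+ 2 + a3 ^+ 2], which is
    nonzero because the first row is; this composes the map with a shear and
    keeps the determinant. *)
Lemma scales_linear3 (R : realType) (a1 a2 a3 b1 b2 b3 c1 c2 c3 : R) :
  det3 a1 a2 a3 b1 b2 b3 c1 c2 c3 != 0 ->
  scales (@lam3 R)%E
    (fun z => (a1 * z.1 + a2 * z.2.1 + a3 * z.2.2,
       (b1 * z.1 + b2 * z.2.1 + b3 * z.2.2, c1 * z.1 + c2 * z.2.1 + c3 * z.2.2)))
    `|det3 a1 a2 a3 b1 b2 b3 c1 c2 c3|^-1.
Proof.
move=> D0; have [a0|a0] := eqVneq a1 0; last exact: scales_linear3_pivot.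
pose Y1 := a1 + a2 * a2 + a3 * a3; pose Y2 := b1 + b2 * a2 + b3 * a3.
pose Y3 := c1 + c2 * a2 + c3 * a3.
have Y0 : Y1 != 0.
  apply: contra_neq D0; rewrite /Y1 a0 add0r -!expr2 => /eqP.
  rewrite paddr_eq0 ?sqr_ge0// !sqrf_eq0 => /andP[/eqP-> /eqP->].
  by rewrite /det3; ring.
have dE : det3 Y1 a2 a3 Y2 b2 b3 Y3 c2 c3 = det3 a1 a2 a3 b1 b2 b3 c1 c2 c3.
  by rewrite /det3 /Y1 /Y2 /Y3; ring.
have D0' : det3 Y1 a2 a3 Y2 b2 b3 Y3 c2 c3 != 0 by rewrite dE.
have one : det3 1 0 0 (- a2) 1 0 (- a3) 0 1 = 1 :> R by rewrite /det3; ring.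
have one0 : det3 1 0 0 (- a2) 1 0 (- a3) 0 1 != 0 :> R by rewrite one oner_neq0.
have := scales_comp (scales_linear3_pivot Y0 D0')
   (scales_linear3_pivot (oner_neq0 _) one0).
rewrite one normr1 invr1 mul1r dE.
congr scales; apply/funext => z /=.
by rewrite /Y1 /Y2 /Y3; congr pair; [ring|congr pair; ring].
Qed.

(** * Integration over cones *)

(** The expression [x * (x ^+ 2) `^ (- 1)] is [x^-1] at every [x], including
    [0], and powers are measurable. *)
Lemma measurable_invr (R : realType) : measurable_fun setT (@GRing.inv R).
Proof.
rewrite (_ : GRing.inv = fun x : R => x * (x ^+ 2) `^ (- 1)).
  apply: measurable_funM => //; apply: (measurableT_comp (measurable_powR _)).
  exact: exprn_measurable.
apply/funext => x; rewrite powR_inv1 ?sqr_ge0//.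
by have [->|x0] := eqVneq x 0; [rewrite invr0 mul0r|field].
Qed.

(** The cone over a copy of [E] placed at height [h] is the union over [s > 0]
    of its sections at height [s], which are copies of [E] dilated by [s / h];
    the dilation multiplies [m] by [(s / h) ^+ n]. The dilation is a parameter
    so that one proof serves the plane and the space. *)
Lemma cone_subst (R : realType) d (Y : measurableType d)
    (m : {sigma_finite_measure set Y -> \bar R}) (dil : R -> Y -> Y) (n : nat)
    (h : R) (E : set Y) (g : measurableTypeR R * Y -> \bar R) :
  0 < h ->
  measurable_fun setT (fun z : measurableTypeR R * Y => dil z.1 z.2) ->
  (forall a b y, dil a (dil b y) = dil (a * b) y) -> (forall y, dil 1 y = y) ->
  (forall a, 0 < a -> scales m (dil a) (a ^- n)) ->
  measurable E -> measurable_fun setT g -> (forall z, 0 <= g z)%E ->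
  (\int[lam1 R \x m]_(z in [set z | (0 < z.1)%R /\ E (dil (h / z.1)%R z.2)]) g z =
   \int[m]_(y in E) \int[lam1 R]_(s in `]0%R, +oo[)
      (((s / h) ^+ n)%:E * g (s, dil (s / h)%R y)))%E.
Proof.
move=> h0 mdil dilM dil1 sdil mE mg g0.
set D := [set z | _].
have mfst : measurable_fun setT (fun z : measurableTypeR R * Y => z.1) by exact: measurable_fst.
have mdil' (k : measurableTypeR R -> measurableTypeR R) : measurable_fun setT k ->
    measurable_fun setT (fun z : measurableTypeR R * Y => dil (k z.1) z.2).
  move=> mk.
  apply: (measurableT_comp mdil (g := fun z : measurableTypeR R * Y => (k z.1, z.2))).
  apply/measurable_fun_pair; last exact: measurable_snd.
  exact: (measurableT_comp mk mfst).
have mdivh : measurable_fun setT (fun s : measurableTypeR R => s / h : measurableTypeR R).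
  exact: measurable_funM.
have mhdiv : measurable_fun setT (fun s : measurableTypeR R => h / s : measurableTypeR R).
  by apply: measurable_funM => //; exact: measurable_invr.
have mpos : measurable [set z : measurableTypeR R * Y | 0 < z.1].
  rewrite (_ : [set _ | _] = setT `&` fst @^-1` `]0, +oo[%classic).
    exact: mfst.
  by apply/seteqP; split => z /=; rewrite in_itv/= andbT; [split|case].
have mD : measurable D.
  rewrite (_ : D = [set z | 0 < z.1] `&` (setT `&` (fun z => dil (h / z.1) z.2) @^-1` E)).
    by apply: measurableI => //; exact: (mdil' _ mhdiv).
  by apply/seteqP; split => z /=; rewrite /D/=; tauto.
pose G (z : measurableTypeR R * Y) : \bar R := (((fun z => ((z.1 / h) ^+ n)%:E * g (z.1, dil (z.1 / h)%R z.2)) \_ ([set z : measurableTypeR R * Y | (0 < z.1)%R] `&` snd @^-1` E)) z)%E.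
have mpE : measurable ([set z : measurableTypeR R * Y | 0 < z.1] `&` snd @^-1` E).
  apply: measurableI => //; rewrite -[X in measurable X]setTI; exact: measurable_snd.
have mG : measurable_fun setT G.
  apply/(measurable_restrictT _ mpE); apply: measurable_funTS.
  apply: emeasurable_funM.
    apply/measurable_EFinP; apply: measurable_funX.
    exact: (measurableT_comp mdivh mfst).
  apply: (measurableT_comp mg); apply/measurable_fun_pair => //.
  exact: (mdil' _ mdivh).
have G0 z : (0 <= G z)%E.
  rewrite /G patchE; case: ifPn => // /set_mem[/= z0 _].
  by rewrite mule_ge0// lee_fin exprn_ge0// divr_ge0// ltW.
rewrite [LHS]integral_mkcond.
have mgD : measurable_fun setT (g \_ D).
  by apply/(measurable_restrictT _ mD); exact: measurable_funTS.
have gD0 z : (0 <= (g \_ D) z)%E by rewrite erestrict_ge0.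
rewrite (fubini_tonelli1 (m2 := m))//.
transitivity (\int[lam1 R]_s \int[m]_y G (s, y))%E.
  apply: eq_integral => s _; rewrite /fubini_F.
  have [s0|s0] := ltP 0 s; last first.
    rewrite !integral0_eq// => y _; rewrite /G patchE; case: ifPn => // /set_mem[/=];
      by rewrite ltNge s0.
  have sh0 : 0 < s / h by rewrite divr_gt0.
  have [_ /(_ (fun y => (g \_ D) (s, y)))] := sdil _ sh0.
  move=> /(_ (measurableT_comp mgD (measurable_pair1 s)))/(_ (fun y => gD0 _)) H.
  transitivity (((s / h) ^+ n)%:E * \int[m]_y (g \_ D) (s, dil (s / h)%R y))%E.
    rewrite H muleA -EFinM divff ?mul1e// expf_neq0// gt_eqF//.
  rewrite -ge0_integralZl//.
  - apply: eq_integral => y _; rewrite /G !patchE.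
    have -> : ((s, dil (s / h) y) \in D) = ((s, y) \in [set z : measurableTypeR R * Y | 0 < z.1] `&` snd @^-1` E).
      have K : dil (h / s) (dil (s / h) y) = y.
        rewrite dilM (_ : h / s * (s / h) = 1) ?dil1//; field.
        by rewrite !gt_eqF.
      by apply/idP/idP => /set_mem[/= _ Ey]; apply/mem_set; split => //=; move: Ey;
        rewrite K.
    by case: ifP => // _; rewrite mule0.
  - apply: (measurableT_comp mgD); apply/measurable_fun_pair => //.
    exact: (measurableT_comp mdil (measurable_pair1 _)).
  - by rewrite lee_fin exprn_ge0// ltW.
rewrite (fubini_tonelli G)// [RHS]integral_mkcond.
apply: eq_integral => y _; rewrite patchE.
case: ifPn => [/set_mem Ey|yE]; last first.
  rewrite integral0_eq// => s _; rewrite /G patchE; case: ifPn => // /set_mem[_ /= Ey].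
  by rewrite mem_set in yE.
rewrite [RHS]integral_mkcond; apply: eq_integral => s _.
rewrite /G !patchE; congr (if _ then _ else _).
apply/idP/idP => /set_mem /= H; apply/mem_set; rewrite /= ?in_itv/= ?andbT.
  by case: H.
by move: H; rewrite in_itv/= andbT.
Qed.

Lemma cone_plane (R : realType) (h : R) (E : set R) (g : plane R -> \bar R) :
  0 < h -> measurable E -> measurable_fun setT g -> (forall z, 0 <= g z)%E ->
  (\int[@lam2 R]_(z in [set z | (0 < z.1)%R /\ E (h / z.1 * z.2)%R]) g z =
   \int[lam1 R]_(t in E) \int[lam1 R]_(s in `]0%R, +oo[)
      ((s / h)%:E * g (s, s / h * t)%R))%E.
Proof.
move=> h0 mE mg g0.
apply: (@cone_subst R _ _ (lam1 R) (fun a y => a * y) 1%N) => //.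
- by apply: measurable_funM.
- by move=> a b y; rewrite mulrA.
- by move=> y; rewrite mul1r.
- move=> a a0; have := scales_affine1 0 (lt0r_neq0 a0).
  by rewrite gtr0_norm//; under eq_fun do rewrite addr0.
Qed.

Lemma cone_space (R : realType) (h : R) (E : set (plane R))
    (g : space3 R -> \bar R) :
  0 < h -> measurable E -> measurable_fun setT g -> (forall z, 0 <= g z)%E ->
  (\int[@lam3 R]_(z in [set z | (0 < z.1)%R /\
       E (h / z.1 * z.2.1, h / z.1 * z.2.2)%R]) g z =
   \int[@lam2 R]_(y in E) \int[lam1 R]_(s in `]0%R, +oo[)
      (((s / h) ^+ 2)%:E * g (s, (s / h * y.1, s / h * y.2))%R))%E.
Proof.
move=> h0 mE mg g0.
apply: (@cone_subst R _ _ (@lam2 R) (fun a y => (a * y.1, a * y.2)) 2%N) => //.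
- apply/measurable_fun_pair; apply: measurable_funM => //.
    by apply: measurableT_comp; [exact: measurable_fst|exact: measurable_snd].
  by apply: measurableT_comp; [exact: measurable_snd|exact: measurable_snd].
- by move=> a b y; rewrite !mulrA.
- by move=> y; rewrite !mul1r; case: y.
- move=> a a0.
  have D0 : a * a - 0 * 0 != 0 by rewrite mul0r subr0 mulf_neq0// gt_eqF.
  have := scales_affine2 0 0 D0.
  rewrite mul0r subr0 -expr2 ger0_norm ?sqr_ge0//.
  congr scales; apply/funext => z /=.
  by rewrite !mul0r !addr0 add0r.
Qed.

(** * Derivatives, chords and the value pi / 12 of the arctangent *)

Section derivation_rules.
Variable R : realType.
Implicit Types (f g : R -> R) (x a b : R).

Lemma is_derive_div f g x a b : g x != 0 ->
  is_derive x 1 f a -> is_derive x 1 g b ->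
  is_derive x 1 (fun t => f t / g t) ((a * g x - f x * b) / g x ^+ 2).
Proof.
move=> g0 df dg; have dV := is_deriveV g0 dg.
have D := is_deriveM df dV; apply: (is_derive_eq D).
rewrite /GRing.scale/=; field; exact: g0.
Qed.

Lemma is_derive_sqrt f x a : 0 < f x -> is_derive x 1 f a ->
  is_derive x 1 (fun t => Num.sqrt (f t)) (a / (2 * Num.sqrt (f x))).
Proof.
move=> f0 df; have := is_derive1_comp (is_derive1_sqrt f0) df.
by rewrite [_ * a]mulrC.
Qed.

Lemma is_derive_atan f x a : is_derive x 1 f a ->
  is_derive x 1 (fun t => atan (f t)) (a / (1 + f x ^+ 2)).
Proof.
move=> df; have := is_derive1_comp (is_derive1_atan (f x)) df.
by rewrite [_ * a]mulrC.
Qed.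

Lemma is_derive_affine x a b : is_derive x 1 (fun t => a + b * t) b.
Proof.
have D := is_deriveD (is_derive_cst a x 1)
   (is_deriveM (is_derive_cst b x 1) (is_derive_id x 1)).
apply: (is_derive_eq D).
by rewrite /GRing.scale/=; ring.
Qed.

Lemma is_derive_quad x a b : is_derive x 1 (fun t => a + b * t ^+ 2) (2 * b * x).
Proof.
have D := is_deriveD (is_derive_cst a x 1)
   (is_deriveM (is_derive_cst b x 1) (is_deriveX 2 (is_derive_id x 1))).
apply: (is_derive_eq D).
by rewrite /GRing.scale/=; ring.
Qed.

Lemma is_derive_continuous f x a : is_derive x 1 f a -> {for x, continuous f}.
Proof.
by move=> [df _]; exact/differentiable_continuous/derivable1_diffP.
Qed.

Lemma mean_value f (df : R -> R) a b : a <= b ->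
  (forall x, a <= x <= b -> is_derive x 1 f (df x)) ->
  exists2 c, a <= c <= b & f b - f a = df c * (b - a).
Proof.
move=> ab dF.
have dI x : x \in `]a, b[%R -> is_derive x 1 f (df x).
  by rewrite in_itv/= => /andP[ax xb]; apply: dF; rewrite !ltW.
have cf : {within `[a, b], continuous f}.
  apply: continuous_in_subspaceT => x /set_mem/=; rewrite in_itv/= => xab.
  exact: is_derive_continuous (dF x xab).
have [c cab E] := MVT_segment ab dI cf.
by exists c => //; move: cab; rewrite in_itv.
Qed.

End derivation_rules.

Section bounds.
Variable R : realType.
Implicit Types (K k f df : R -> R).

(** An edge is a segment [[t1, t2]] of a line, [0] being the foot of the
    perpendicular, and [K] is a normalised angle. Both ends are outside the
    window [[- e, e]], so that the edge either avoids the interior of the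
    window, where the slope may exceed [1], or contains the window and is
    charged for it as a whole. *)
Lemma increment_le_outside_window K k (e t1 t2 : R) : t1 <= t2 -> 0 <= e ->
  (forall t : R, is_derive t 1 K (k t)) -> (forall t, e <= `|t| -> k t <= 1) ->
  K e - K (- e) <= 2 * e -> e <= `|t1| -> e <= `|t2| ->
  K t2 - K t1 <= t2 - t1.
Proof.
move=> t12 e0 dK k1 Ke et1 et2.
have far a b : a <= b -> (forall c, a <= c <= b -> e <= `|c|) ->
    K b - K a <= b - a.
  move=> ab H; have [c /H/k1 kc ->] := mean_value ab (fun x _ => dK x).
  by rewrite -[leRHS]mul1r ler_wpM2r// subr_ge0.
have [t2e|t2e] := leP t2 (- e).
  apply: far => // c /andP[_ ct2]; rewrite ler0_norm; last by lra.
  lra.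
have et2' : e <= t2.
  by move: et2; rewrite ler_normr => /orP[//|]; rewrite lerNr leNgt t2e.
have [t1e|t1e] := leP e t1.
  by apply: far => // c /andP[ct1 _]; rewrite ger0_norm; lra.
have et1' : t1 <= - e.
  by move: et1; rewrite ler_normr => /orP[|]; [rewrite leNgt t1e|rewrite lerNr].
have H1 : K (- e) - K t1 <= - e - t1.
  by apply: far => // c /andP[_ ce]; rewrite ler0_norm; lra.
have H2 : K t2 - K e <= t2 - e.
  by apply: far => // c /andP[ce _]; rewrite ger0_norm; lra.
lra.
Qed.

(** Convexity: the slopes given by the mean value theorem on the two sides of
    [u] are ordered. *)
Lemma below_chord f df (u : R) : f 0 = 0 ->
  (forall x : R, 0 <= x <= 1 -> is_derive x 1 f (df x)) ->
  (forall x y : R, 0 <= x -> x <= y -> y <= 1 -> df x <= df y) ->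
  0 <= u <= 1 -> f u <= u * f 1.
Proof.
move=> f0 dF mono /andP[u0 u1].
have [|c1 /andP[c10 c1u] E1] := @mean_value R f df 0 u u0.
  by move=> x /andP[? xu]; apply: dF; apply/andP; split => //; exact: le_trans u1.
have [|c2 /andP[c2u c21] E2] := @mean_value R f df u 1 u1.
  by move=> x /andP[ux ?]; apply: dF; apply/andP; split => //; exact: le_trans ux.
have h := mono c1 c2 c10 (le_trans c1u c2u) c21.
rewrite f0 !subr0 in E1.
have : df c1 * (u * (1 - u)) <= df c2 * (u * (1 - u)).
  by rewrite ler_wpM2r// mulr_ge0// subr_ge0.
move: E1 E2 => E1 E2; rewrite !mulrA.
rewrite (mulrC (df c2)) -(mulrA u) -E2 -E1; nra.
Qed.

Lemma atan_ge0 (a : R) : 0 <= a -> 0 <= atan a.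
Proof. by move=> a0; rewrite -(@atan0 R); exact: le_atan. Qed.

(** The addition formula of the tangent. The condition [a * b < 1] makes the
    cosine of the sum positive, which keeps the sum of the two angles below
    [pi / 2]. *)
Lemma atan_add (a b : R) : 0 <= a -> 0 <= b -> a * b < 1 ->
  atan a + atan b = atan ((a + b) / (1 - a * b)).
Proof.
move=> a0 b0 ab.
have ca := cos_atan a; have cb := cos_atan b.
have pos (x : R) : 0 < (Num.sqrt (1 + x ^+ 2))^-1.
  by rewrite invr_gt0 sqrtr_gt0 ltr_wpDr ?sqr_ge0.
have ca0 : 0 < cos (atan a) by rewrite ca.
have cb0 : 0 < cos (atan b) by rewrite cb.
have ta : sin (atan a) = a * cos (atan a).
  have := atanK a; rewrite /tan => /(congr1 (fun x => x * cos (atan a))).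
  by rewrite divfK// gt_eqF.
have tb : sin (atan b) = b * cos (atan b).
  have := atanK b; rewrite /tan => /(congr1 (fun x => x * cos (atan b))).
  by rewrite divfK// gt_eqF.
have cE : cos (atan a + atan b) = cos (atan a) * cos (atan b) * (1 - a * b).
  by rewrite cosD ta tb; ring.
have sE : sin (atan a + atan b) = cos (atan a) * cos (atan b) * (a + b).
  by rewrite sinD ta tb; ring.
have D0 : 0 < 1 - a * b by rewrite subr_gt0.
have c0 : 0 < cos (atan a + atan b) by rewrite cE !mulr_gt0.
have [A0 B0] := (atan_ge0 a0, atan_ge0 b0).
have [A1 B1] := (atan_ltpi2 a, atan_ltpi2 b).
have lt2 : atan a + atan b < pi / 2.
  rewrite ltNge; apply/negP => h.
  have : 0 <= sin (atan a + atan b - pi / 2).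
    by apply: sin_ge0_pi; apply/andP; split; lra.
  rewrite sinB cos_pihalf sin_pihalf mulr0 mulr1 sub0r oppr_ge0.
  by rewrite leNgt c0.
rewrite -[LHS]tanK; last by rewrite in_itv/=; apply/andP; split; lra.
congr atan; rewrite /tan sE cE; field.
by rewrite !gt_eqF.
Qed.

Local Notation k0 := (2 - Num.sqrt 3 : R).

Lemma sqrt3_bounds : [/\ 0 <= Num.sqrt 3 :> R, Num.sqrt 3 ^+ 2 = 3 :> R,
  17 / 10 < Num.sqrt 3 :> R & Num.sqrt 3 < 18 / 10 :> R].
Proof.
have s0 : 0 <= Num.sqrt 3 :> R by rewrite sqrtr_ge0.
have s2 : Num.sqrt 3 ^+ 2 = 3 :> R by rewrite sqr_sqrtr.
by split => //; nra.
Qed.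

(** Tripling the angle whose tangent is [2 - Num.sqrt 3] gives the angle with
    tangent [1], that is [pi / 4]: [m] is the tangent of the double, and [m +
    k0 = 1 - m * k0]. *)
Lemma atan_pi12 : atan k0 = pi / 12.
Proof.
have [s0 s2 sl su] := sqrt3_bounds.
have k0_ge0 : 0 <= k0 by lra.
have kk : k0 * k0 < 1 by nra.
have E2 := atan_add k0_ge0 k0_ge0 kk.
have D1 : 0 < 1 - k0 * k0 by nra.
set m := (k0 + k0) / (1 - k0 * k0) in E2.
have mE : m * (1 - k0 * k0) = k0 + k0 by rewrite /m divfK// gt_eqF.
have m0 : 0 <= m by rewrite /m divr_ge0// ?ltW//; lra.
have mk : m * k0 < 1.
  rewrite -(ltr_pM2r D1) mul1r mulrAC mE; nra.
have := atan_add m0 k0_ge0 mk.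
have D2 : 0 < 1 - m * k0 by rewrite subr_gt0.
have -> : m + k0 = 1 - m * k0.
  apply: (mulIf (lt0r_neq0 D1)).
  have -> : (m + k0) * (1 - k0 * k0) = m * (1 - k0 * k0) + k0 * (1 - k0 * k0) by ring.
  have -> : (1 - m * k0) * (1 - k0 * k0) = 1 - k0 * k0 - k0 * (m * (1 - k0 * k0)) by ring.
  rewrite mE; nra.
rewrite divff ?gt_eqF//.
rewrite atan1 -E2; lra.
Qed.

(** On the interval from [0] to [k0 = 2 - Num.sqrt 3] the slope of the
    arctangent is at least [1 / (1 + k0 ^+ 2) = 1 / (4 * k0)], hence [pi / 12]
    is at least [1 / 4]. *)
Lemma pi_ge3 : 3 <= pi :> R.
Proof.
have [s0 s2 sl su] := sqrt3_bounds.
have k0_ge0 : 0 <= k0 by lra.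
have [c /andP[c0 ck]] := mean_value k0_ge0 (fun x _ => is_derive1_atan x).
rewrite atan0 !subr0 atan_pi12 => E.
have H : (1 + k0 ^+ 2)^-1 <= (1 + c ^+ 2)^-1.
  rewrite lef_pV2 ?posrE ?ltr_wpDr ?sqr_ge0// lerD2l; nra.
have : (1 + k0 ^+ 2)^-1 * k0 <= pi / 12 by rewrite E ler_wpM2r.
have -> : 1 + k0 ^+ 2 = 4 * k0 by nra.
rewrite invfM -mulrA mulVf; lra.
Qed.

End bounds.

(** * Angles subtended by an edge *)

Section edges.
Variable R : realType.
Implicit Types h d e t : R.

Lemma is_derive_atan_div d t : 0 < d ->
  is_derive t 1 (fun s => atan (s / d)) (d / (d ^+ 2 + t ^+ 2)).
Proof.
move=> d0.
have D := is_derive_atan (is_derive_div (lt0r_neq0 d0) (is_derive_id t 1) (is_derive_cst d t 1)).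
apply: (is_derive_eq D); rewrite /cst /=; field.
by rewrite !gt_eqF// ltr_pwDl ?exprn_gt0 ?sqr_ge0.
Qed.

(** No sign is required of [a]: the half-width [Num.sqrt a] of a window is [0]
    when [a <= 0], that is, when the line stays outside the ball that cuts out
    the window. *)
Lemma le_sqrt_norm (a t : R) : Num.sqrt a <= `|t| -> a <= t ^+ 2.
Proof.
move=> h; rewrite -(real_normK (num_real t)).
have [a0|a0] := leP a 0; first by rewrite (le_trans a0)// exprn_ge0.
by rewrite -[leLHS]sqr_sqrtr ?(ltW a0)// lerXn2r// ?nnegrE// sqrtr_ge0.
Qed.

Lemma sqrt_le_norm (a t : R) : a <= t ^+ 2 -> Num.sqrt a <= `|t|.
Proof. by move=> h; rewrite -sqrtr_sqr ler_wsqrtr. Qed.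

(** An edge is seen from the origin under an angle of at most [pi / 4] times
    its length. Outside the disc of radius [Num.sqrt 2] the inequality holds
    between derivatives. The chord cut out by this disc, of half-length [e <=
    1], is seen under twice the angle [atan (e / Num.sqrt (2 - e ^+ 2))], a
    convex function of [e] whose value at [e = 1] is [pi / 4], as for the
    square. *)
Lemma edge_plane d t1 t2 : 1 <= d -> t1 <= t2 ->
  2 <= d ^+ 2 + t1 ^+ 2 -> 2 <= d ^+ 2 + t2 ^+ 2 ->
  atan (t2 / d) - atan (t1 / d) <= pi / 4 * (t2 - t1).
Proof.
move=> d1 t12 h1 h2; have d0 : 0 < d by lra.
have p3 := pi_ge3 R; have p0 : 0 < 4 / pi :> R by apply: divr_gt0; lra.
set e := Num.sqrt (2 - d ^+ 2).
suff : 4 / pi * atan (t2 / d) - 4 / pi * atan (t1 / d) <= t2 - t1.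
  rewrite -mulrBr -ler_pdivlMl// invf_div; exact.
pose k t := 4 / pi * (d / (d ^+ 2 + t ^+ 2)).
apply: (@increment_le_outside_window R (fun t => 4 / pi * atan (t / d)) k e).
- exact: t12.
- exact: sqrtr_ge0.
- move=> t; have D := is_deriveM (is_derive_cst (4 / pi) t 1) (is_derive_atan_div t d0).
  by apply: (is_derive_eq D); rewrite /GRing.scale/= /k /cst mulr0 addr0.
- move=> t /le_sqrt_norm te; rewrite /k.
  have q2 : 2 <= d ^+ 2 + t ^+ 2 by lra.
  have q0 : 0 < d ^+ 2 + t ^+ 2 by lra.
  have -> : 4 / pi * (d / (d ^+ 2 + t ^+ 2)) = 4 * d / (pi * (d ^+ 2 + t ^+ 2)).
    by field; rewrite !gt_eqF//; lra.
  rewrite ler_pdivrMr ?mulr_gt0 ?mul1r//; last lra.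
  set q := d ^+ 2 + t ^+ 2 in q2 q0 *.
  have dq : d ^+ 2 <= q by rewrite lerDl sqr_ge0.
  have : 4 * d <= 3 * q by nra.
  by move/le_trans; apply; rewrite ler_wpM2r// ltW.
- suff H : atan (e / d) <= pi / 4 * e.
    rewrite mulNr atanN mulrN opprK.
    have : 4 / pi * atan (e / d) <= e by rewrite -ler_pdivlMl// invf_div.
    lra.
  have [d2|d2] := leP 2 (d ^+ 2).
    by rewrite /e ler0_sqrtr ?subr_le0// mul0r atan0 mulr0.
  have e2 : e ^+ 2 = 2 - d ^+ 2 by rewrite sqr_sqrtr// subr_ge0 ltW.
  have e0 : 0 <= e by exact: sqrtr_ge0.
  have e1 : e <= 1 by nra.
  have dE : d = Num.sqrt (2 - e ^+ 2).
    by rewrite e2 opprB addrCA subrr addr0 sqrtr_sqr gtr0_norm.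
  rewrite [leRHS]mulrC.
  have := @below_chord R (fun x => atan (x / Num.sqrt (2 - x ^+ 2)))
    (fun x => (Num.sqrt (2 - x ^+ 2))^-1) e.
  rewrite -dE expr1n (_ : 2 - 1 = 1 :> R) ?sqrtr1 ?divr1 ?atan1; last lra.
  apply.
  + by rewrite mul0r atan0.
  + move=> x /andP[x0 x1].
    have P : 0 < 2 + - 1 * x ^+ 2 by nra.
    have Q := is_derive_quad x 2 (- 1).
    have S0 : Num.sqrt (2 + - 1 * x ^+ 2) != 0 by rewrite gt_eqF// sqrtr_gt0.
    have D := is_derive_atan (@is_derive_div R id (fun t => Num.sqrt (2 + - 1 * t ^+ 2)) x _ _
      S0 (is_derive_id x 1) (@is_derive_sqrt R (fun t => 2 + - 1 * t ^+ 2) x _ P Q)).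
    rewrite (_ : (fun x => _) = fun t => atan (id t / Num.sqrt (2 + - 1 * t ^+ 2))); last first.
      by apply/funext => t; rewrite mulN1r.
    apply: (is_derive_eq D).
    rewrite !mulN1r in S0 P *; set s := Num.sqrt _ in S0 *.
    have nz : s ^+ 2 + x ^+ 2 != 0 by rewrite sqr_sqrtr ?ltW// subrK.
    by rewrite /=; field; rewrite S0 nz.
  + move=> x y x0 xy y1.
    rewrite lef_pV2 ?posrE ?sqrtr_gt0; [|nra|nra].
    by rewrite ler_wsqrtr//; nra.
  + by rewrite e0 e1.
- by apply: sqrt_le_norm; lra.
- by apply: sqrt_le_norm; lra.
Qed.

(** Signed solid angle of the right triangle with legs [d] and [t], seen from
    height [h] above the vertex where the leg [d] meets the hypotenuse: the
    plane angle at this vertex minus a correction. *)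
Definition tri_angle h d t : R :=
  atan (t / d) - atan (h * t / (d * Num.sqrt (h ^+ 2 + d ^+ 2 + t ^+ 2))).

(** The derivative of [tri_angle h d] at [t]. In polar coordinates at the same
    vertex, a thin sector of angle [a] and of outer end at distance [r] from
    the eye has solid angle [a * (1 - h / r)]. *)
Definition tri_density h d t : R :=
  d * (1 - h / Num.sqrt (h ^+ 2 + d ^+ 2 + t ^+ 2)) / (d ^+ 2 + t ^+ 2).

Lemma is_derive_tri_angle h d t : 0 < h -> 0 < d ->
  is_derive t 1 (tri_angle h d) (tri_density h d t).
Proof.
move=> h0 d0.
pose r (s : R) := Num.sqrt (h ^+ 2 + d ^+ 2 + 1 * s ^+ 2).
have P : 0 < h ^+ 2 + d ^+ 2 + 1 * t ^+ 2.
  by rewrite mul1r ltr_pwDl ?sqr_ge0// addr_gt0// exprn_gt0.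
have r0 : 0 < r t by rewrite sqrtr_gt0.
have dr : is_derive t 1 r (2 * 1 * t / (2 * r t)).
  exact: (@is_derive_sqrt R (fun s => h ^+ 2 + d ^+ 2 + 1 * s ^+ 2) t _ P (is_derive_quad t (h ^+ 2 + d ^+ 2) 1)).
have dn : is_derive t 1 (fun s => 0 + h * s) h by exact: is_derive_affine.
have ddr : is_derive t 1 (fun s => d * r s) (d * (2 * 1 * t / (2 * r t))).
  have D := is_deriveM (is_derive_cst d t 1) dr.
  by apply: (is_derive_eq D); rewrite /GRing.scale/= /cst mulr0 addr0.
have dr0 : d * r t != 0 by rewrite mulf_neq0 ?gt_eqF.
have D2 := is_derive_atan (@is_derive_div R (fun s => 0 + h * s) (fun s => d * r s) t _ _ dr0 dn ddr).
have D := is_deriveB (is_derive_atan_div t d0) D2.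
rewrite (_ : tri_angle h d = (fun s => atan (s / d)) - (fun s => atan ((0 + h * s) / (d * r s)))); last first.
  by apply/funext => s; rewrite /tri_angle !fctE /r mul1r add0r.
apply: (is_derive_eq D); rewrite /tri_density.
have -> : Num.sqrt (h ^+ 2 + d ^+ 2 + t ^+ 2) = r t by rewrite /r mul1r.
have r2 : r t ^+ 2 = h ^+ 2 + d ^+ 2 + t ^+ 2 by rewrite sqr_sqrtr ?ltW// mul1r.
have q0 : 0 < d ^+ 2 + t ^+ 2 by rewrite ltr_pwDl ?sqr_ge0// exprn_gt0.
have nz1 : d ^+ 2 + t ^+ 2 != 0 by rewrite gt_eqF.
have nz2 : h ^+ 2 + d ^+ 2 != 0 by rewrite gt_eqF// addr_gt0// exprn_gt0.
set x := r t in r0 dr0 r2 *.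
have x0 : x != 0 by rewrite gt_eqF.
have dn0 : d != 0 by rewrite gt_eqF.
have E1 : d ^+ 2 * x ^+ 2 + h ^+ 2 * t ^+ 2 = (h ^+ 2 + d ^+ 2) * (d ^+ 2 + t ^+ 2).
  by rewrite r2; ring.
have nz3 : d ^+ 2 * x ^+ 2 + h ^+ 2 * t ^+ 2 != 0 by rewrite E1 mulf_neq0.
have -> : (h * (d * x) - (0 + h * t) * (d * (2 * 1 * t / (2 * x)))) / (d * x) ^+ 2 /
   (1 + ((0 + h * t) / (d * x)) ^+ 2) =
   h * d * (x ^+ 2 - t ^+ 2) / (x * (d ^+ 2 * x ^+ 2 + h ^+ 2 * t ^+ 2)).
  by field; rewrite !exprMn dn0 x0 nz3.
rewrite E1 (_ : x ^+ 2 - t ^+ 2 = h ^+ 2 + d ^+ 2); last by rewrite r2; ring.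
by field; rewrite nz1 nz2 x0.
Qed.

(** Write [c = 2 + Num.sqrt 3] and [k = 2 - Num.sqrt 3]. The slope at [u] has
    the denominator [(c + k - k * u) ^+ 2 + u ^+ 2], a quadratic polynomial
    which is smallest at [u = 1] because [c * k = 1]. So the function is
    convex on the unit interval, and its value at [1] is [atan (1 / c) = atan
    k = pi / 12]. *)
Lemma atan_chord (u : R) : 0 <= u -> u <= 1 ->
  atan (u / (2 + Num.sqrt 3 + (2 - Num.sqrt 3) * (1 - u))) <= pi / 12 * u.
Proof.
move=> u0 u1; have [s0 s2 sl su] := sqrt3_bounds R.
set s := Num.sqrt 3 in s0 s2 sl su *.
pose c := 2 + s; pose k := 2 - s.
have ck : c * k = 1 by rewrite /c /k; nra.
have k_gt0 : 0 < k by rewrite /k; lra.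
have Dv (v : R) : 0 <= v <= 1 -> c <= c + k * (1 - v).
  by move=> /andP[_ v1]; rewrite lerDl; apply: mulr_ge0; lra.
have c0 : 0 < c by rewrite /c; lra.
have := @below_chord R (fun v => atan (v / (c + k + - k * v)))
    (fun v => (c + k) / ((c + k + - k * v) ^+ 2 + v ^+ 2)) u.
have cE (v : R) : c + k + - k * v = c + k * (1 - v) by ring.
rewrite mulr1 (_ : c + k + - k = c) ?addrK//.
have -> : 1 / c = 2 - s.
  by apply: (mulIf (lt0r_neq0 c0)); rewrite divfK ?gt_eqF// mulrC.
rewrite atan_pi12 => H; rewrite -cE [leRHS]mulrC; apply: H.
- by rewrite mul0r atan0.
- move=> v v01; have nz : c + k + - k * v != 0.
    by rewrite cE gt_eqF// (lt_le_trans c0)// Dv.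
  have E := is_derive_atan (@is_derive_div R id (fun v => c + k + - k * v) v _ _ nz
     (is_derive_id v 1) (is_derive_affine v (c + k) (- k))).
  apply: (is_derive_eq E) => /=.
  have nz2 : (c + k + - k * v) ^+ 2 + v ^+ 2 != 0.
    by rewrite gt_eqF// ltr_pwDl ?sqr_ge0// exprn_even_gt0.
  move: nz nz2; rewrite mulNr => nz nz2; field; rewrite nz.
  by rewrite nz2.
- move=> x y x0 xy y1.
  have pos (v : R) : 0 <= v <= 1 -> 0 < (c + k + - k * v) ^+ 2 + v ^+ 2.
    by move=> v01; rewrite ltr_pwDl ?sqr_ge0// exprn_gt0// cE (lt_le_trans c0)// Dv.
  rewrite ler_wpM2l//; first lra.
  rewrite lef_pV2 ?posrE ?pos//; try (by apply/andP; split; lra).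
  rewrite -subr_ge0.
  have -> : (c + k + - k * x) ^+ 2 + x ^+ 2 - ((c + k + - k * y) ^+ 2 + y ^+ 2) =
    (y - x) * (2 * (c * k) + 2 * k ^+ 2 - (1 + k ^+ 2) * (x + y)) by ring.
  rewrite ck (_ : _ - _ * (x + y) = (1 + k ^+ 2) * (2 - x - y)); last by ring.
  by apply: mulr_ge0; [lra|apply: mulr_ge0; nra].
- by rewrite u0 u1.
Qed.

(** The two arctangents combine into [atan (u / D)] with [u = e * d] and [D =
    3 + Num.sqrt 3 * h - e ^+ 2]. On the sphere of radius [Num.sqrt 3] this
    [D] is at least the affine function of [u] in [atan_chord], with equality
    for the cube, where [h = d = e = 1]. *)
Lemma tri_angle_le h d e : 1 <= h -> 0 < d -> 0 <= e -> e <= 1 ->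
  h ^+ 2 + d ^+ 2 + e ^+ 2 = 3 ->
  tri_angle h d e <= pi / 12 * (e * d).
Proof.
move=> h1 d0 e0 e1 hde; have h0 : 0 < h by lra.
have [s0 s2 sl su] := sqrt3_bounds R.
rewrite /tri_angle hde; set s := Num.sqrt 3 in s0 s2 sl su *.
set u := e * d; have u0 : 0 <= u by rewrite mulr_ge0// ltW.
have h2 : 1 <= h ^+ 2 by rewrite exprn_ege1.
have u1 : u <= 1 by have := sqr_ge0 (e - d); rewrite sqrrB /u; lra.
have hs : h <= s by nra.
set D := 3 + s * h - e ^+ 2.
have D0 : 0 < D by rewrite /D; nra.
have ds0 : 0 < d * s by apply: mulr_gt0 => //; lra.
have -> : atan (e / d) - atan (h * e / (d * s)) = atan (u / D).
  apply/eqP; rewrite subr_eq; apply/eqP.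
  have a0 : 0 <= u / D by rewrite divr_ge0// ltW.
  have b0 : 0 <= h * e / (d * s) by rewrite divr_ge0 ?mulr_ge0// ltW.
  have nz : d != 0 /\ s != 0 /\ D != 0 by rewrite !gt_eqF//; lra.
  have [n1 [n2 n3]] := nz.
  have K : 1 - u / D * (h * e / (d * s)) = (D * s - h * e ^+ 2) / (D * s).
    by rewrite /u; field; rewrite n1 n2 n3.
  have K0 : 0 < D * s - h * e ^+ 2 by rewrite /D; nra.
  have Ds0 : 0 < D * s by apply: mulr_gt0 => //; lra.
  have ab : u / D * (h * e / (d * s)) < 1.
    by rewrite -subr_gt0 K divr_gt0.
  rewrite (atan_add a0 b0 ab) K; congr atan.
  have nK : D * s - h * e ^+ 2 != 0 by rewrite gt_eqF.
  have d2 : d ^+ 2 = 3 - h ^+ 2 - e ^+ 2 by lra.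
  have key : u * d * s + h * e * D = e * (D * s - h * e ^+ 2).
    have -> : u * d * s = e * d ^+ 2 * s by rewrite /u; ring.
    rewrite d2 /D.
    have -> : e * ((3 + s * h - e ^+ 2) * s - h * e ^+ 2) =
      e * (3 * s + s ^+ 2 * h - e ^+ 2 * s - h * e ^+ 2) by ring.
    have -> : e * (3 - h ^+ 2 - e ^+ 2) * s + h * e * (3 + s * h - e ^+ 2) =
       e * (3 * s + 3 * h - e ^+ 2 * s - h * e ^+ 2) by ring.
    by rewrite s2.
  have -> : u / D + h * e / (d * s) = (u * d * s + h * e * D) / (D * (d * s)).
    by field; rewrite n1 n2 n3.
  by rewrite key; field; rewrite n1 n2 n3 nK.
pose c := 2 + s; pose k := 2 - s.
have ck : c * k = 1 by rewrite /c /k; nra.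
have k_gt0 : 0 < k by rewrite /k; lra.
have Dv (v : R) : 0 <= v <= 1 -> c <= c + k * (1 - v).
  by move=> /andP[_ v1]; rewrite lerDl; apply: mulr_ge0; lra.
have c0 : 0 < c by rewrite /c; lra.
have Dge : c + k * (1 - u) <= D.
  rewrite /c /k /D; have [ed|ed] := leP e d.
    have : e ^+ 2 <= u by rewrite /u; nra.
    nra.
  have : d ^+ 2 <= u by rewrite /u; nra.
  have : s * (h - 1) >= (2 - e ^+ 2 - d ^+ 2) / 2.
    have : h ^+ 2 - 1 <= 2 * (s * (h - 1)) by nra.
    lra.
  nra.
have step : atan (u / D) <= atan (u / (c + k * (1 - u))).
  apply: le_atan; rewrite ler_wpM2l// lef_pV2 ?posrE//.
  by apply: lt_le_trans c0 (Dv u _); rewrite u0 u1.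
apply: (le_trans step).
exact: atan_chord.
Qed.

(** Analogue of [edge_plane] for the solid angle of the triangle between an
    edge and the foot of the perpendicular on the plane of the facet, [pi /
    12] being its ratio to [d * (t2 - t1)] for the cube. Outside the ball of
    radius [Num.sqrt 3] the slope is [d / (r * (r + h))] with [r * (r + h) >=
    4], and [pi >= 3]; inside it, [tri_angle_le] bounds the whole chord. *)
Lemma edge_space h d t1 t2 : 1 <= h -> 0 < d -> 2 <= h ^+ 2 + d ^+ 2 ->
  t1 <= t2 -> 3 <= h ^+ 2 + d ^+ 2 + t1 ^+ 2 ->
  3 <= h ^+ 2 + d ^+ 2 + t2 ^+ 2 ->
  tri_angle h d t2 - tri_angle h d t1 <= pi / 12 * (d * (t2 - t1)).
Proof.
move=> h1 d0 hd t12 H1 H2; have h0 : 0 < h by lra.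
have p3 := pi_ge3 R.
have pd : 0 < pi / 12 * d by rewrite mulr_gt0//; lra.
set e := Num.sqrt (3 - h ^+ 2 - d ^+ 2).
pose a := (pi / 12 * d)^-1; have a0 : 0 < a by rewrite invr_gt0.
suff : a * tri_angle h d t2 - a * tri_angle h d t1 <= t2 - t1.
  by rewrite -mulrBr ler_pdivrMl// mulrA.
have H := @increment_le_outside_window R (fun t => a * tri_angle h d t)
  (fun t => a * tri_density h d t) e t1 t2 t12.
rewrite /= in H; apply: H.
- exact: sqrtr_ge0.
- move=> t; have D := is_deriveM (is_derive_cst a t 1) (is_derive_tri_angle t h0 d0).
  by apply: (is_derive_eq D); rewrite /GRing.scale/= /cst mulr0 addr0.
- move=> t /le_sqrt_norm te; rewrite /a ler_pdivrMl// mulr1.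
  rewrite /tri_density.
  have Q : 3 <= h ^+ 2 + d ^+ 2 + t ^+ 2 by lra.
  set r := Num.sqrt _.
  have r2 : r ^+ 2 = h ^+ 2 + d ^+ 2 + t ^+ 2 by rewrite sqr_sqrtr//; lra.
  have r0 : 0 <= r by exact: sqrtr_ge0.
  have r17 : 17 / 10 <= r by nra.
  have q0 : 0 < d ^+ 2 + t ^+ 2 by rewrite ltr_pwDl ?sqr_ge0// exprn_gt0.
  have -> : d * (1 - h / r) / (d ^+ 2 + t ^+ 2) = d / (r * (r + h)).
    have -> : d ^+ 2 + t ^+ 2 = (r - h) * (r + h) by rewrite -subr_sqr r2; ring.
    have rh : h < r by nra.
    field; rewrite !gt_eqF//; lra.
  rewrite ler_pdivrMr ?mulr_gt0//; [|lra|lra].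
  have rr : 4 <= r * (r + h) by nra.
  have H : 1 <= pi / 12 * (r * (r + h)) by nra.
  by rewrite mulrAC -[leLHS]mul1r ler_wpM2r// ltW.
- suff H : tri_angle h d e <= pi / 12 * (e * d).
    have EN : tri_angle h d (- e) = - tri_angle h d e.
      by rewrite /tri_angle sqrrN !(mulNr, mulrN) !atanN opprB opprK addrC.
    rewrite EN mulrN opprK.
    have : a * tri_angle h d e <= e by rewrite ler_pdivrMl// mulrAC -mulrA.
    lra.
  have [d2|d2] := leP 3 (h ^+ 2 + d ^+ 2).
    have -> : e = 0 by rewrite /e ler0_sqrtr//; lra.
    by rewrite /tri_angle !(mulr0, mul0r) atan0 subr0.
  have e2 : e ^+ 2 = 3 - h ^+ 2 - d ^+ 2 by rewrite sqr_sqrtr//; lra.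
  have e0 : 0 <= e by exact: sqrtr_ge0.
  by apply: tri_angle_le => //; [nra|lra].
- by apply: sqrt_le_norm; lra.
- by apply: sqrt_le_norm; lra.
Qed.

End edges.

(** * Integration along rays *)

Section radial.
Variable R : realType.
Implicit Types (f F : R -> R) (a b h d t x s q : R).

Lemma ftc f F a b : a <= b -> (forall x : R, is_derive x 1 F (f x)) ->
  continuous f ->
  (\int[lam1 R]_(x in `[a, b]) (f x)%:E = (F b - F a)%:E)%E.
Proof.
rewrite le_eqVlt => /orP[/eqP<-|ab] dF cf.
  by rewrite set_itv1 integral_set1 subrr.
rewrite (@continuous_FTC2 _ f F)//.
- exact: continuous_subspaceT.
- split.
  + by move=> x _; have [] := dF x.
  + by apply: cvg_at_right_filter; exact: is_derive_continuous (dF a).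
  + by apply: cvg_at_left_filter; exact: is_derive_continuous (dF b).
- by move=> x _; rewrite derive1E; have [] := dF x.
Qed.

(** The integrand is considered along a ray from the origin, and [b] is where
    the ray leaves the body. *)
Lemma integral_cut (f : R -> \bar R) (g : R -> R) b : 0 <= b ->
  continuous g ->
  (forall s, 0 < s -> s <= b -> f s = (g s)%:E) ->
  (forall s, 0 < s -> b < s -> f s = 0%E) ->
  (\int[lam1 R]_(s in `]0%R, +oo[) f s = \int[lam1 R]_(s in `[0%R, b]) (g s)%:E)%E.
Proof.
move=> b0 cg fg f0.
rewrite -integral_itv_obnd_cbnd; last first.
  apply/measurable_EFinP; apply: measurable_funTS.
  exact: continuous_measurable_fun.
rewrite integral_mkcond [RHS]integral_mkcond; apply: eq_integral => s _.
rewrite !patchE !mem_setE !in_itv/= andbT.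
have [s0|] := ltP 0 s => //=.
by have [sb|bs] := leP s b; [exact: fg|exact: f0].
Qed.

Lemma is_derive_scaled h x : is_derive x 1 (fun s => s / h) h^-1.
Proof.
have D := is_deriveM (is_derive_id x 1) (is_derive_cst h^-1 x 1).
by apply: (is_derive_eq D); rewrite /GRing.scale/= mulr0 add0r mulr1.
Qed.

Lemma continuous_scaled_power h (n : nat) : continuous (fun s : R => (s / h) ^+ n).
Proof.
move=> x; have := is_derive_continuous (is_deriveX n (is_derive_scaled h x)).
by rewrite (_ : _ ^+ n = fun s : R => (s / h) ^+ n)//; apply/funext => s; rewrite !fctE.
Qed.

Lemma is_derive_power h (n : nat) (x : R) : h != 0 ->
  is_derive x 1 (fun s => s * (s / h) ^+ n / n.+1%:R) ((x / h) ^+ n).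
Proof.
move=> h0.
have dl := is_derive_scaled h x.
have D := is_deriveM (is_deriveM (is_derive_id x 1) (is_deriveX n dl))
   (is_derive_cst (n.+1%:R^-1 : R) x 1).
rewrite (_ : (fun s => s * (s / h) ^+ n / n.+1%:R) =
  id * (fun s => s / h) ^+ n * cst n.+1%:R^-1); last first.
  by apply/funext => s; rewrite !fctE.
apply: (is_derive_eq D); rewrite /GRing.scale/= mulr0 add0r /cst.
have n0 : n.+1%:R != 0 :> R by rewrite pnatr_eq0.
rewrite mulr1 !fctE; case: n {D} n0 => [|n] n0.
  by rewrite !expr0 !mul0r mulr0 add0r mulr1 invr1.
by rewrite /= exprS -[n.+2%:R]natr1; field; rewrite h0 nat1r natr1.
Qed.

Lemma integral_power h b (n : nat) : 0 < h -> 0 <= b ->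
  (\int[lam1 R]_(s in `[0%R, b]) ((s / h) ^+ n)%:E =
   (b * (b / h) ^+ n / n.+1%:R)%:E)%E.
Proof.
move=> h0 b0; rewrite (ftc b0 (fun x => is_derive_power n x (lt0r_neq0 h0))).
  by rewrite !mul0r subr0.
exact: continuous_scaled_power.
Qed.

(** The ray meets the plane at height [h] at squared distance [q] from the
    foot; [s] is the height of a point of the ray. *)
Lemma le_unit_ball h s q : 0 < h -> 0 < s -> 0 <= q ->
  (s ^+ 2 + (s / h) ^+ 2 * q <= 1) = (s <= h / Num.sqrt (h ^+ 2 + q)).
Proof.
move=> h0 s0 q0; have Q : 0 < h ^+ 2 + q by rewrite ltr_wpDr ?exprn_gt0.
have r0 : 0 < Num.sqrt (h ^+ 2 + q) by rewrite sqrtr_gt0.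
have r2 := sqr_sqrtr (ltW Q); set r := Num.sqrt _ in r0 r2 *.
have -> : s ^+ 2 + (s / h) ^+ 2 * q = (s * r / h) ^+ 2.
  by rewrite !exprMn r2; field; rewrite gt_eqF.
have nn : 0 <= s * r / h by rewrite ltW// divr_gt0// mulr_gt0.
by rewrite (expr_le1 _ nn)// ler_pdivrMr// mul1r ler_pdivlMr.
Qed.

(** Density with respect to area of the solid angle under which a plane at
    distance [h] is seen; [q] is the squared distance to the foot of the
    perpendicular. *)
Definition angle_density h (q : R) : R := h / Num.sqrt (h ^+ 2 + q) ^+ 3.

Lemma integral_unit_ball (n : nat) h q (f : R -> \bar R) : 0 < h -> 0 <= q ->
  (forall s, 0 < s -> f s = if s ^+ 2 + (s / h) ^+ 2 * q <= 1
                             then ((s / h) ^+ n)%:E else 0%E) ->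
  (\int[lam1 R]_(s in `]0%R, +oo[) f s =
   (h / Num.sqrt (h ^+ 2 + q) ^+ n.+1 / n.+1%:R)%:E)%E.
Proof.
move=> h0 q0 fE; have Q : 0 < h ^+ 2 + q by rewrite ltr_wpDr ?exprn_gt0.
have r0 : 0 < Num.sqrt (h ^+ 2 + q) by rewrite sqrtr_gt0.
have b0 : 0 <= h / Num.sqrt (h ^+ 2 + q) by rewrite divr_ge0// ltW.
rewrite (@integral_cut _ (fun s => (s / h) ^+ n) _ b0).
- rewrite integral_power//; congr EFin.
  set r := Num.sqrt _ in r0 *.
  have -> : h / r / h = r^-1 by field; rewrite !gt_eqF.
  by rewrite exprVn exprS invfM mulrA.
- exact: continuous_scaled_power.
- by move=> s s0 sb; rewrite fE// le_unit_ball// sb.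
- by move=> s s0 sb; rewrite fE// le_unit_ball// leNgt sb.
Qed.

(** The density is integrated along a ray of the plane from the foot of the
    perpendicular to a line at distance [d] from it; [s / d] is the Jacobian
    of the cone over that line. *)
Lemma integral_tri_density h d t : 0 < h -> 0 < d ->
  (\int[lam1 R]_(s in `[0%R, d])
     (s / d * angle_density h (s ^+ 2 + (s / d * t) ^+ 2))%:E =
   (tri_density h d t)%:E)%E.
Proof.
move=> h0 d0; set q := d ^+ 2 + t ^+ 2.
have q0 : 0 < q by rewrite ltr_pwDl ?sqr_ge0// exprn_gt0.
pose r s := Num.sqrt (h ^+ 2 + q / d ^+ 2 * s ^+ 2).
have P s : 0 < h ^+ 2 + q / d ^+ 2 * s ^+ 2.
  rewrite ltr_pwDl ?exprn_gt0// mulr_ge0 ?sqr_ge0// divr_ge0 ?sqr_ge0// ltW//.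
have r0 s : 0 < r s by rewrite sqrtr_gt0.
have dr s : is_derive s 1 r (2 * (q / d ^+ 2) * s / (2 * r s)).
  exact: (@is_derive_sqrt R (fun s => h ^+ 2 + q / d ^+ 2 * s ^+ 2) s _ (P s)
    (is_derive_quad s (h ^+ 2) (q / d ^+ 2))).
have rE s : Num.sqrt (h ^+ 2 + (s ^+ 2 + (s / d * t) ^+ 2)) = r s.
  by rewrite /r; congr Num.sqrt; rewrite /q; field; rewrite gt_eqF.
under eq_integral do rewrite /angle_density rE.
have dG s : is_derive s 1 (fun s => - (d * h / q) / r s) (s / d * (h / r s ^+ 3)).
  have D := @is_derive_div R _ _ s _ _ (lt0r_neq0 (r0 s))
    (is_derive_cst (- (d * h / q)) s 1) (dr s).
  apply: (is_derive_eq D); rewrite /cst; field.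
  by rewrite !gt_eqF.
rewrite (ftc (ltW d0) dG).
  congr EFin; rewrite /tri_density.
  have -> : r d = Num.sqrt (h ^+ 2 + d ^+ 2 + t ^+ 2).
    by rewrite -rE divff ?gt_eqF// mul1r addrA.
  have -> : r 0 = h by rewrite -rE mul0r mul0r expr0n addr0 addr0 sqrtr_sqr gtr0_norm.
  rewrite -/q; have r1 : 0 < Num.sqrt (h ^+ 2 + d ^+ 2 + t ^+ 2).
    by rewrite sqrtr_gt0 -addrA ltr_pwDl ?exprn_gt0// ltW.
  by field; rewrite !gt_eqF.
move=> x.
have -> : (fun s => s / d * (h / r s ^+ 3)) = (fun s => (h / d * s) / (r s ^+ 3)).
  by apply/funext => s; rewrite mulrACA [s * h]mulrC -mulrACA mulrA.
have D1 := is_derive_affine x 0 (h / d).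
have D2 := is_deriveX 3 (dr x).
have nz : (r ^+ 3) x != 0 by rewrite fctE expf_neq0// gt_eqF.
have := is_derive_continuous (is_derive_div nz D1 D2).
by under [X in {for x, continuous X}]eq_fun do rewrite add0r fctE.
Qed.

End radial.

(** * Sectors of the disc and triangles *)

Section sectors.
Variable R : realType.
Local Notation mu := (lam1 R).
Implicit Types (h d t : R).

Lemma measurable_le_set (disp : measure_display) (T : measurableType disp) (f g : T -> R) :
  measurable_fun setT f -> measurable_fun setT g ->
  measurable [set x | f x <= g x].
Proof.
move=> mf mg; rewrite -[X in measurable X]setTI.
by have := measurable_fun_ler mf mg; move=> /(_ measurableT [set true]); apply.
Qed.

Lemma measurable_lt_set (disp : measure_display) (T : measurableType disp) (f g : T -> R) :
  measurable_fun setT f -> measurable_fun setT g ->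
  measurable [set x | f x < g x].
Proof.
move=> mf mg; rewrite -[X in measurable X]setTI.
by have := measurable_fun_ltr mf mg; move=> /(_ measurableT [set true]); apply.
Qed.

(** The open cone over a copy of [E] in the line where the first coordinate is
    [h]. *)
Definition cone2 (h : R) (E : set R) : set (plane R) :=
  [set z | 0 < z.1 /\ E (h / z.1 * z.2)].
Definition cone3 (h : R) (E : set (plane R)) : set (space3 R) :=
  [set z | 0 < z.1 /\ E (h / z.1 * z.2.1, h / z.1 * z.2.2)].
Definition strip (d : R) : set (plane R) := [set z | z.1 <= d].
Definition disc : set (plane R) := [set z | z.1 ^+ 2 + z.2 ^+ 2 <= 1].
Definition ball3 : set (space3 R) :=
  [set z | z.1 ^+ 2 + (z.2.1 ^+ 2 + z.2.2 ^+ 2) <= 1].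

Lemma measurable_sqnorm2 :
  measurable_fun setT (fun z : plane R => z.1 ^+ 2 + z.2 ^+ 2 : measurableTypeR R).
Proof. by apply: measurable_funD; apply: measurable_funX. Qed.

Lemma measurable_sqnorm3 :
  measurable_fun setT (fun z : space3 R => z.1 ^+ 2 + (z.2.1 ^+ 2 + z.2.2 ^+ 2) : measurableTypeR R).
Proof.
apply: measurable_funD; first exact: measurable_funX.
exact: (measurableT_comp measurable_sqnorm2 measurable_snd).
Qed.

Lemma measurable_disc : measurable disc.
Proof. exact: (@measurable_le_set _ _ _ (fun=> 1) measurable_sqnorm2 (measurable_cst _)). Qed.

Lemma measurable_ball3 : measurable ball3.
Proof. exact: (@measurable_le_set _ _ _ (fun=> 1) measurable_sqnorm3 (measurable_cst _)). Qed.

Lemma measurable_half (disp : measure_display) (Y : measurableType disp) :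
  measurable [set z : measurableTypeR R * Y | 0 < z.1].
Proof. exact: (@measurable_lt_set _ _ (fun=> 0) _ (measurable_cst _) measurable_fst). Qed.

Lemma measurable_slope h :
  measurable_fun setT (fun z : plane R => h / z.1 * z.2 : measurableTypeR R).
Proof.
apply: measurable_funM => //; apply: measurable_funM => //.
exact: (measurableT_comp (@measurable_invr R) measurable_fst).
Qed.

Lemma measurable_cone2 h (E : set R) : measurable E ->
  measurable (cone2 h E).
Proof.
move=> mE; apply: measurableI; first exact: measurable_half.
by rewrite -[X in measurable X]setTI; exact: measurable_slope.
Qed.

Lemma measurable_cone3 h (E : set (plane R)) : measurable E ->
  measurable (cone3 h E).
Proof.
move=> mE; apply: measurableI; first exact: measurable_half.
rewrite -[X in measurable X]setTI.
apply: (measurable_fun_pair _ _ measurableT) => //;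
  apply: measurable_funM; try (apply: measurable_funM => //;
    exact: (measurableT_comp (@measurable_invr R) measurable_fst)).
  exact: (measurableT_comp measurable_fst measurable_snd).
exact: (measurableT_comp measurable_snd measurable_snd).
Qed.

Lemma sector_disc d (E : set R) : 0 < d -> measurable E ->
  (@lam2 R (disc `&` cone2 d E) =
   \int[mu]_(t in E) (d / (d ^+ 2 + t ^+ 2) / 2)%:E)%E.
Proof.
move=> d0 mE.
rewrite -(@integral_indic _ _ R (@lam2 R) _ (measurable_cone2 d mE) _ measurable_disc).
rewrite /cone2 cone_plane//; last first.
  by apply/measurable_EFinP; apply: measurable_indic; exact: measurable_disc.
apply: eq_integral => t _.
rewrite (@integral_unit_ball R 1 d (t ^+ 2)) ?sqr_ge0//.
  by rewrite sqr_sqrtr// addr_ge0 ?sqr_ge0.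
move=> s s0; rewrite indicE expr1 -EFinM; rewrite -exprMn.
have -> : ((s, s / d * t) \in disc) = (s ^+ 2 + (s / d * t) ^+ 2 <= 1).
  by apply/idP/idP => [/set_mem//|h]; exact/mem_set.
by case: ifP => _; rewrite ?mulr1 ?mulr0.
Qed.

Lemma sector_disc_itv d t1 t2 : 0 < d -> t1 <= t2 ->
  (@lam2 R (disc `&` cone2 d `[t1, t2]) =
   ((atan (t2 / d) - atan (t1 / d)) / 2)%:E)%E.
Proof.
move=> d0 t12; rewrite sector_disc//.
have dA (x : R) : is_derive x 1 (fun t => atan (t / d) / 2) (d / (d ^+ 2 + x ^+ 2) / 2).
  have D := is_deriveM (is_derive_atan_div x d0) (is_derive_cst (2^-1 : R) x 1).
  by apply: (is_derive_eq D); rewrite /GRing.scale/= mulr0 add0r mulrC.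
rewrite (ftc t12 dA); first by rewrite mulrBl.
move=> x; have q0 : d ^+ 2 + 1 * x ^+ 2 != 0.
  by rewrite gt_eqF// mul1r ltr_pwDl ?sqr_ge0 ?exprn_gt0.
have := is_derive_continuous (@is_derive_div R _ (fun x => d ^+ 2 + 1 * x ^+ 2) x _ _ q0
  (is_derive_cst (d / 2) x 1) (is_derive_quad x (d ^+ 2) 1)).
rewrite (_ : (fun t => _) = fun t => d / (d ^+ 2 + t ^+ 2) / 2)//.
by apply/funext => t; rewrite /cst mul1r mulrAC.
Qed.

(** The base is open here and closed in [triangle_angle]: open triangles are
    packed into a polygon, closed ones cover it. *)
Lemma triangle_area d t1 t2 : 0 < d -> t1 <= t2 ->
  (@lam2 R (strip d `&` cone2 d `]t1, t2[) =
   (d * (t2 - t1) / 2)%:E)%E.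
Proof.
move=> d0 t12.
have mT : measurable (strip d).
  exact: (@measurable_le_set _ _ _ (fun=> d) measurable_fst (measurable_cst _)).
have mI : measurable (`]t1, t2[%classic : set R) by exact: measurable_itv.
rewrite -(@integral_indic _ _ R (@lam2 R) _ (measurable_cone2 d mI) _ mT).
rewrite /cone2 cone_plane//; last first.
  by apply/measurable_EFinP; exact: measurable_indic.
transitivity (\int[mu]_(t in `]t1, t2[) (cst (d / 2)%:E) t)%E.
  apply: eq_integral => t _.
  rewrite (@integral_cut R _ (fun s => (s / d) ^+ 1) d (ltW d0)).
  - by rewrite integral_power ?(ltW d0)// divff ?gt_eqF// expr1n mulr1.
  - exact: continuous_scaled_power.
  - by move=> s s0 sd; rewrite indicE mem_set// mule1 expr1.
  - move=> s s0 sd; rewrite indicE memNset ?mule0//=.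
    by apply/negP; rewrite -ltNge.
rewrite integral_cst//= lebesgue_measure_itv/= lte_fin.
case: ltP => [_|t21]; first by rewrite -EFinB -EFinM; congr EFin; rewrite mulrAC.
by rewrite mule0; have -> : t1 = t2 by [apply/eqP; rewrite eq_le t12]; rewrite subrr mulr0 mul0r.
Qed.

Lemma measurable_angle_density h : 0 < h ->
  measurable_fun setT (fun q : R => angle_density h q).
Proof.
move=> h0; apply: measurable_funM => //.
apply: (measurableT_comp (@measurable_invr R)); apply: measurable_funX.
apply: (measurableT_comp (f := @Num.sqrt R)).
  by apply: continuous_measurable_fun; exact: sqrt_continuous.
exact: measurable_funD.
Qed.

Lemma angle_density_ge0 h (q : R) : 0 < h -> 0 <= angle_density h q.
Proof. by move=> h0; rewrite divr_ge0 ?exprn_ge0 ?sqrtr_ge0// ltW. Qed.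

Lemma continuous_sqrtXV (f : R -> R) (n : nat) (x : R) :
  {for x, continuous f} -> 0 < f x ->
  {for x, continuous (fun s => (Num.sqrt (f s) ^+ n)^-1)}.
Proof.
move=> cf f0; apply: cvgV; first by rewrite expf_neq0// gt_eqF// sqrtr_gt0.
apply: (continuous_comp (f := fun s => Num.sqrt (f s)) (g := fun y => y ^+ n)).
  by apply: (continuous_comp (f := f) (g := @Num.sqrt R)) => //; exact: sqrt_continuous.
exact: exprn_continuous.
Qed.

Lemma triangle_angle h d t1 t2 : 0 < h -> 0 < d -> t1 <= t2 ->
  (\int[@lam2 R]_(z in strip d `&`
       cone2 d `[t1, t2])
     (angle_density h (z.1 ^+ 2 + z.2 ^+ 2))%:E =
   (tri_angle h d t2 - tri_angle h d t1)%:E)%E.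
Proof.
move=> h0 d0 t12.
have mT : measurable (strip d).
  exact: (@measurable_le_set _ _ _ (fun=> d) measurable_fst (measurable_cst _)).
have mI : measurable (`[t1, t2]%classic : set R) by exact: measurable_itv.
have ma : measurable_fun setT (fun z : plane R => (angle_density h (z.1 ^+ 2 + z.2 ^+ 2))%:E).
  apply/measurable_EFinP.
  exact: (measurableT_comp (measurable_angle_density h0) measurable_sqnorm2).
rewrite setIC integral_mkcondr /cone2 cone_plane//; last 2 first.
- by apply/(measurable_restrictT _ mT); exact: measurable_funTS.
- by move=> z; rewrite patchE; case: ifP; rewrite // lee_fin angle_density_ge0.
rewrite -(ftc t12 (fun t => is_derive_tri_angle t h0 d0)).
  apply: eq_integral => t _; rewrite -integral_tri_density//.
  apply: (@integral_cut R _ (fun s => s / d * angle_density h (s ^+ 2 + (s / d * t) ^+ 2)) d (ltW d0)).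
  - move=> x; apply: cvgM; first exact: mulrr_continuous.
    apply: cvgM; first exact: cvg_cst.
    apply: (@continuous_sqrtXV (fun s => h ^+ 2 + (s ^+ 2 + (s / d * t) ^+ 2)) 3).
      apply: cvgD; first exact: cvg_cst.
      apply: cvgD; first exact: exprn_continuous.
      apply: (@continuous_comp _ _ _ (fun s : R => s / d * t) (fun y : R => y ^+ 2)); last exact: exprn_continuous.
      by apply: cvgM; [exact: mulrr_continuous|exact: cvg_cst].
    by rewrite ltr_pwDl ?exprn_gt0// addr_ge0 ?sqr_ge0.
  - by move=> s s0 sd; rewrite patchE mem_set//.
  - move=> s s0 sd; rewrite patchE memNset ?mule0//=.
    by apply/negP; rewrite -ltNge.
move=> x; have q0 : 0 < d ^+ 2 + x ^+ 2 by rewrite ltr_pwDl ?sqr_ge0 ?exprn_gt0.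
apply: cvgM; last first.
  apply: cvgV; first by rewrite gt_eqF.
  by apply: cvgD; [exact: cvg_cst|exact: exprn_continuous].
apply: cvgM; first exact: cvg_cst.
apply: cvgB; first exact: cvg_cst.
apply: cvgM; first exact: cvg_cst.
apply: (@continuous_sqrtXV (fun s => h ^+ 2 + d ^+ 2 + s ^+ 2) 1).
  by apply: cvgD; [exact: cvg_cst|exact: exprn_continuous].
by rewrite -addrA ltr_pwDl ?exprn_gt0// ltW.
Qed.

End sectors.

(** * Cones in the ball, disc and ball *)

Section volumes.
Variable R : realType.
Local Notation mu := (lam1 R).
Implicit Types (h d t : R).

(** The volume cut out of the unit ball is a third of the solid angle, by
    integration along each ray. *)
Lemma cone_ball h (S : set (plane R)) : 0 < h -> measurable S ->
  (@lam3 R (ball3 (R := R) `&` cone3 h S) =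
   \int[@lam2 R]_(y in S) (angle_density h (y.1 ^+ 2 + y.2 ^+ 2) / 3)%:E)%E.
Proof.
move=> h0 mS.
rewrite -(@integral_indic _ _ R (@lam3 R) _ (measurable_cone3 h mS) _ (@measurable_ball3 R)).
rewrite /cone3 cone_space//; last first.
  by apply/measurable_EFinP; apply: measurable_indic; exact: measurable_ball3.
apply: eq_integral => y _.
have q0 : 0 <= y.1 ^+ 2 + y.2 ^+ 2 by rewrite addr_ge0 ?sqr_ge0.
rewrite (@integral_unit_ball R 2 h _ _ h0 q0)//.
move=> s s0; rewrite indicE mulrDr -!exprMn -EFinM.
have -> : ((s, (s / h * y.1, s / h * y.2)) \in ball3 (R := R)) =
    (s ^+ 2 + ((s / h * y.1) ^+ 2 + (s / h * y.2) ^+ 2) <= 1).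
  by apply/idP/idP => [/set_mem//|H]; exact/mem_set.
by case: ifP => _; rewrite ?mulr1 ?mulr0.
Qed.

Lemma scales_measure (disp : measure_display) (X : measurableType disp)
    (m : {measure set X -> \bar R}) (T : X -> X) (k : R) (A : set X) :
  scales m T k -> measurable A -> m (T @^-1` A) = (k%:E * m A)%E.
Proof.
move=> [mT sT] mA.
have mTA : measurable (T @^-1` A) by rewrite -[X in measurable X]setTI; exact: mT.
rewrite -[in LHS](setIT (T @^-1` A)) -(@integral_indic _ _ R m setT measurableT _ mTA).
rewrite -[in RHS](setIT A) -(@integral_indic _ _ R m setT measurableT _ mA).
rewrite -(sT (fun x => (\1_A x)%:E))//.
by apply/measurable_EFinP; exact: measurable_indic.
Qed.

(** The half disc is the cone over a whole line at distance [1], and [1 / (1 +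
    t ^+ 2)] has integral [pi] over the line. *)
Lemma half_disc_area :
  (@lam2 R (disc (R := R) `&` [set z | (0 < z.1)%R]) = (pi / 2)%:E)%E.
Proof.
have -> : [set z : plane R | 0 < z.1] = cone2 1 setT.
  by apply/seteqP; split => z //= [].
rewrite (sector_disc ltr01 measurableT).
transitivity (\int[mu]_t ((1 + t ^+ 2)^-1 / 2)%:E)%E.
  by apply: eq_integral => t _; rewrite expr1n mul1r.
rewrite (@ge0_symfun_integralT R (fun t => (1 + t ^+ 2)^-1 / 2))//.
- have H := integral0y_oneDsqr R.
  under eq_integral do rewrite EFinM muleC.
  rewrite ge0_integralZl//=.
  + rewrite [X in (_ * (_ * X))%E](_ : _ = (pi / 2)%:E).
      by rewrite -!EFinM; congr EFin; field.
    rewrite -[RHS]H; congr integral; apply/seteqP; split => x /=; rewrite in_itv/= andbT//.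
  + exact: (@measurable_le_set _ _ _ (fun=> 0) id (measurable_cst _) (@measurable_id _ _ _)).
  + apply/measurable_EFinP; apply: measurable_funTS.
    exact: (continuous_measurable_fun (@continuous_oneDsqrV R)).
  + by move=> x _; rewrite lee_fin invr_ge0 addr_ge0 ?sqr_ge0.
- by move=> x; rewrite divr_ge0 ?invr_ge0 ?addr_ge0 ?sqr_ge0.
- move=> x; apply: cvgM; last exact: cvg_cst.
  exact: (@continuous_oneDsqrV R).
- by move=> x; rewrite /= sqrrN.
Qed.

(** The right half of the disc and its mirror image are disjoint. *)
Lemma disc_area_ge : (pi%:E <= @lam2 R (disc (R := R)))%E.
Proof.
pose Dr := disc (R := R) `&` [set z | 0 < z.1].
pose T (z : plane R) : plane R := (- 1 * z.1 + 0 * z.2 + 0, 0 * z.1 + 1 * z.2 + 0).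
have D0 : - 1 * 1 - 0 * 0 != 0 :> R by rewrite mul0r subr0 mulr1 oppr_eq0 oner_neq0.
have sT := scales_affine2 0 0 D0; rewrite -/T in sT.
have mDr : measurable Dr.
  apply: measurableI; [exact: measurable_disc|exact: measurable_half].
have mTDr : measurable (T @^-1` Dr).
  by case: sT => mT _; rewrite -[X in measurable X]setTI; exact: mT.
have E := scales_measure sT mDr.
rewrite mul0r subr0 mulr1 normrN1 invr1 mul1e in E.
have disj : Dr `&` (T @^-1` Dr) = set0.
  rewrite -subset0 => z [[_ /= z0] [_ /=]]; rewrite mul0r !addr0 mulN1r oppr_gt0.
  by move=> z0'; have := lt_trans z0 z0'; rewrite ltxx.
have sub : Dr `|` (T @^-1` Dr) `<=` disc (R := R).
  move=> z [[]//|[]]; rewrite /disc/T/=.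
  by rewrite !mul0r !addr0 mulN1r add0r mul1r sqrrN.
apply: (@le_trans _ _ (@lam2 R (Dr `|` (T @^-1` Dr)))); last first.
  apply: le_measure => //; rewrite inE; last exact: measurable_disc.
  exact: measurableU.
have -> : @lam2 R (Dr `|` (T @^-1` Dr)) = (@lam2 R Dr + @lam2 R Dr)%E.
  by have := measureU (@lam2 R) mDr mTDr disj => ->; congr (_ + _)%E; exact: E.
have -> : @lam2 R Dr = (pi / 2)%:E by exact: half_disc_area.
by rewrite -EFinD lee_fin; lra.
Qed.

(** The section of the ball at height [x] is the image of the unit disc under
    a dilation by [Num.sqrt (1 - x ^+ 2)]. *)
Lemma ball_volume_ge : ((4 * pi / 3)%:E <= @lam3 R (ball3 (R := R)))%E.
Proof.
have -> : @lam3 R (ball3 (R := R)) = (\int[mu]_x @lam2 R (xsection (ball3 (R := R)) x))%E by [].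
have H (x : R) : x \in `]-1, 1[ ->
    ((pi * (1 - x ^+ 2))%:E <= @lam2 R (xsection (ball3 (R := R)) x))%E.
  rewrite in_itv/= => /andP[x1 x2].
  have p0 : 0 < 1 - x ^+ 2 by nra.
  set r := Num.sqrt (1 - x ^+ 2).
  have r0 : 0 < r by rewrite sqrtr_gt0.
  have r2 : r ^+ 2 = 1 - x ^+ 2 by rewrite sqr_sqrtr// ltW.
  pose T (z : plane R) : plane R := (r^-1 * z.1 + 0 * z.2 + 0, 0 * z.1 + r^-1 * z.2 + 0).
  have D0 : r^-1 * r^-1 - 0 * 0 != 0 :> R.
    by rewrite mul0r subr0 mulf_neq0// invr_eq0 gt_eqF.
  have sT := scales_affine2 0 0 D0; rewrite -/T in sT.
  have E := scales_measure sT (@measurable_disc R).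
  have -> : xsection (ball3 (R := R)) x = T @^-1` (disc (R := R)).
    apply/seteqP; split => z; rewrite /xsection /disc /ball3 /T /= inE/=;
      rewrite !mul0r !addr0 add0r !exprMn -mulrDr exprVn r2 mulrC ler_pdivrMr//; lra.
  rewrite E mul0r subr0 -invfM -expr2 ger0_norm ?invr_ge0 ?sqr_ge0// invrK r2.
  rewrite [pi * _]mulrC EFinM.
  by apply: lee_wpmul2l; [rewrite lee_fin ltW|exact: disc_area_ge].
have mI : measurable (`]-1, 1[%classic : set R) by exact: measurable_itv.
apply: (@le_trans _ _ (\int[mu]_(x in `](-1)%R, 1%R[) @lam2 R (xsection (ball3 (R := R)) x))%E); last first.
  apply: ge0_subset_integral => //; last exact: measurable_fun_xsection (@measurable_ball3 R).
apply: (@le_trans _ _ (\int[mu]_(x in `](-1)%R, 1%R[) (pi * (1 - x ^+ 2))%:E)%E); last first.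
  apply: ge0_le_integral => //.
  - move=> x; rewrite /= in_itv/= => /andP[x1 x2]; rewrite lee_fin mulr_ge0 ?pi_ge0//.
    nra.
  - apply/measurable_EFinP; apply: measurable_funTS; apply: measurable_funM => //.
    by apply: measurable_funB => //; exact: exprn_measurable.
  - by apply: measurable_funTS; exact: measurable_fun_xsection (@measurable_ball3 R).
have dF (x : R) : is_derive x 1 (fun x => pi * (x - x ^+ 3 / 3)) (pi * (1 - x ^+ 2)).
  have D := is_deriveM (is_derive_cst (pi : R) x 1) (is_deriveB (is_derive_id x 1)
    (is_deriveM (is_deriveX 3 (is_derive_id x 1)) (is_derive_cst (3^-1 : R) x 1))).
  apply: (is_derive_eq D); rewrite /GRing.scale/= !fctE; lra.
have N : (-1 : R) <= 1 by lra.
have cf : continuous (fun x : R => pi * (1 - x ^+ 2)).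
  move=> x; apply: cvgM; first exact: cvg_cst.
  by apply: cvgB; [exact: cvg_cst|exact: exprn_continuous].
rewrite integral_itv_bndo_bndc; last first.
  apply/measurable_EFinP; apply: measurable_funTS; exact: continuous_measurable_fun.
rewrite integral_itv_obnd_cbnd; last first.
  apply/measurable_EFinP; apply: measurable_funTS; exact: continuous_measurable_fun.
by rewrite (ftc N dF cf) lee_fin; lra.
Qed.

End volumes.

(** * Convex hulls of lists of points *)

Section hulls.
Variable R : realType.

Definition dot (n : nat) (c x : 'rV[R]_n) : R := (c *m x^T) 0 0.

Lemma dotE n (c x : 'rV[R]_n) : dot c x = \sum_i c 0 i * x 0 i.
Proof. by rewrite /dot mxE; apply: eq_bigr => i _; rewrite mxE. Qed.
Lemma dotC n (c x : 'rV[R]_n) : dot c x = dot x c.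
Proof. by rewrite !dotE; apply: eq_bigr => i _; rewrite mulrC. Qed.
Lemma dotDr n (c x y : 'rV[R]_n) : dot c (x + y) = dot c x + dot c y.
Proof. by rewrite /dot linearD mulmxDr mxE. Qed.
Lemma dotZr n (c x : 'rV[R]_n) a : dot c (a *: x) = a * dot c x.
Proof. by rewrite /dot linearZ -scalemxAr mxE. Qed.
Lemma dotNr n (c x : 'rV[R]_n) : dot c (- x) = - dot c x.
Proof. by rewrite -scaleN1r dotZr mulN1r. Qed.
Lemma dotBr n (c x y : 'rV[R]_n) : dot c (x - y) = dot c x - dot c y.
Proof. by rewrite dotDr dotNr. Qed.
Lemma dotDl n (c d x : 'rV[R]_n) : dot (c + d) x = dot c x + dot d x.
Proof. by rewrite !(dotC _ x) dotDr. Qed.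
Lemma dotZl n (c x : 'rV[R]_n) a : dot (a *: c) x = a * dot c x.
Proof. by rewrite !(dotC _ x) dotZr. Qed.
Lemma dotNl n (c x : 'rV[R]_n) : dot (- c) x = - dot c x.
Proof. by rewrite !(dotC _ x) dotNr. Qed.
Lemma dotBl n (c d x : 'rV[R]_n) : dot (c - d) x = dot c x - dot d x.
Proof. by rewrite dotDl dotNl. Qed.
Lemma dot0r n (c : 'rV[R]_n) : dot c 0 = 0.
Proof. by rewrite /dot trmx0 mulmx0 mxE. Qed.
Lemma dot0l n (c : 'rV[R]_n) : dot 0 c = 0.
Proof. by rewrite dotC dot0r. Qed.
Lemma dot_sumr n (c : 'rV[R]_n) (I : Type) (r : seq I) (F : I -> 'rV[R]_n) :
  dot c (\sum_(i <- r) F i) = \sum_(i <- r) dot c (F i).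
Proof.
by elim/big_rec2: _ => [|i y x _ <-]; rewrite ?dot0r// dotDr.
Qed.
Lemma dot_mull m n (a : 'rV[R]_m) (M : 'M[R]_(m, n)) x :
  dot (a *m M) x = dot a (x *m M^T).
Proof. by rewrite /dot trmx_mul trmxK mulmxA. Qed.
Lemma dot_ge0 n (x : 'rV[R]_n) : 0 <= dot x x.
Proof. by rewrite dotE sumr_ge0// => i _; rewrite -expr2 sqr_ge0. Qed.
Lemma dot_eq0 n (x : 'rV[R]_n) : (dot x x == 0) = (x == 0).
Proof.
apply/eqP/eqP => [|->]; last exact: dot0r.
rewrite dotE => /eqP; rewrite psumr_eq0 => [/allP h|i _]; last by rewrite -expr2 sqr_ge0.
apply/rowP => i; have := h i (mem_index_enum i).
by rewrite mulf_eq0 orbb mxE => /eqP.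
Qed.
Lemma dot_subZ n (u v : 'rV[R]_n) t :
  dot (u - t *: v) (u - t *: v) = dot u u - 2 * t * dot u v + t ^+ 2 * dot v v.
Proof. rewrite !(dotBl, dotBr, dotZl, dotZr) (dotC v u); ring. Qed.
Lemma dot_gt0 n (x : 'rV[R]_n) : x != 0 -> 0 < dot x x.
Proof. by move=> x0; rewrite lt_neqAle eq_sym dot_eq0 x0 dot_ge0. Qed.

Lemma euclid_normE n (x : 'rV[R]_n) : euclid_norm x = Num.sqrt (dot x x).
Proof. by rewrite /euclid_norm dotE; congr Num.sqrt; apply: eq_bigr => i _; rewrite expr2. Qed.

(** A list allows minima over the generators and barycentric coordinates
    indexed by positions. *)
Definition hull n (W : seq 'rV[R]_n) : set 'rV[R]_n := convex_hull [set` W].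

Lemma hull_le n (W : seq 'rV[R]_n) c b : {in W, forall w, dot c w <= b} ->
  forall x, hull W x -> dot c x <= b.
Proof.
move=> cW x [m [w [v [Sv w0 w1 ->]]]]; rewrite dot_sumr.
rewrite -[leRHS]mul1r -w1 mulr_suml; apply: ler_sum => i _.
by rewrite dotZr ler_wpM2l//; apply: cW; exact: Sv.
Qed.

Lemma mem_hull n (W : seq 'rV[R]_n) w : w \in W -> hull W w.
Proof.
move=> wW; exists 1%N, (fun=> 1), (fun=> w); split => //.
- by rewrite big_ord1.
- by rewrite big_ord1 scale1r.
Qed.

Definition simplex k : set 'rV[R]_k :=
  [set a | (forall i, 0 <= a 0 i) /\ \sum_i a 0 i = 1].

Definition row_list n (W : seq 'rV[R]_n) : 'M[R]_(size W, n) :=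
  \matrix_(i, j) W`_i 0 j.

Lemma row_row_list n (W : seq 'rV[R]_n) i : row i (row_list W) = W`_i.
Proof. by apply/rowP => j; rewrite !mxE. Qed.

(** Adding up the weights of equal generators gives weights on the positions
    in [W], which makes the hull the image of a compact simplex. *)
Lemma hullP n (W : seq 'rV[R]_n) x :
  hull W x <-> exists2 a, simplex a & x = a *m row_list W.
Proof.
split=> [[m [w [v [Sv w0 w1 ->]]]]|[a [a0 a1] ->]]; last first.
  exists (size W), (fun i => a 0 i), (fun i => W`_i); split => //.
  - by move=> i; rewrite /= mem_nth.
  - by rewrite mulmx_sum_row; apply: eq_bigr => i _; rewrite row_row_list.
have iW i : (index (v i) W < size W)%N by rewrite index_mem; exact: Sv.
pose j i := Ordinal (iW i).
exists (\row_k \sum_(i | j i == k) w i).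
  split=> [k|]; first by rewrite mxE sumr_ge0.
  rewrite -w1 [RHS](partition_big j xpredT)//=.
  by apply: eq_bigr => k _; rewrite mxE.
rewrite mulmx_sum_row (partition_big j xpredT)//=.
apply: eq_bigr => k _; rewrite mxE scaler_suml; apply: eq_bigr => i /eqP <-.
by rewrite row_row_list /= nth_index//; exact: Sv.
Qed.

Lemma hull_segment n (W : seq 'rV[R]_n) x y t : hull W x -> hull W y ->
  0 <= t <= 1 -> hull W (x + t *: (y - x)).
Proof.
move=> /hullP[a [a0 a1] ->] /hullP[b [b0 b1] ->] /andP[t0 t1]; apply/hullP.
exists (a + t *: (b - a)).
  have t1' : 0 <= 1 - t by rewrite subr_ge0.
  split=> [i|].
    rewrite !mxE (_ : _ + _ = (1 - t) * a 0 i + t * b 0 i); last by ring.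
    by rewrite addr_ge0 ?mulr_ge0.
  under eq_bigr do rewrite !mxE.
  by rewrite big_split/= -mulr_sumr sumrB a1 b1 subrr mulr0 addr0.
by rewrite mulmxDl -scalemxAl mulmxBl.
Qed.

Lemma compact_simplex k : compact (simplex (k := k)).
Proof.
pose B : set 'rV[R]_k := [set v : 'rV[R]_k | forall i, `[0 : R, 1]%classic (v ord0 i)].
have cB : compact B.
  by apply: (rV_compact (A := fun=> `[0 : R, 1]%classic)) => i; exact: segment_compact.
pose S (a : 'rV[R]_k) : R := \sum_i a 0 i.
have cS : continuous S.
  move=> a; have Fa : Filter (nbhs a) by exact: nbhs_filter.
  apply: (cvg_big _ Fa) => [|i _]; last exact: coord_continuous.
  exact: add_continuous.
have -> : simplex (k := k) = B `&` S @^-1` [set 1].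
  apply/seteqP; split=> a /=.
    move=> [a0 a1]; split => // i; rewrite /= in_itv/= a0/= -a1 (bigD1 i)//= lerDl.
    by rewrite sumr_ge0.
  by move=> [aB a1]; split => // i; have := aB i; rewrite /= in_itv/= => /andP[].
apply: (@subclosed_compact _ _ B) => //.
  apply: closedI; last by apply: closed_comp => //; exact: closed_eq.
  by apply: compact_closed => //; exact: norm_hausdorff.
Qed.

(** A nearest point [y] exists by compactness. If the angle at [y] between [x]
    and a generator [w] were acute, a small step from [y] towards [w] would
    come closer to [x]. *)
Lemma nearest_point n (W : seq 'rV[R]_n) x : (exists w, w \in W) ->
  exists2 y, hull W y & {in W, forall w, dot (x - y) (w - y) <= 0}.
Proof.
move=> [w0 w0W].
pose f (a : 'rV[R]_(size W)) : R := dot (x - a *m row_list W) (x - a *m row_list W).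
have cf : continuous f.
  move=> a; rewrite /f.
  rewrite (_ : (fun _ => _) = (fun b : 'rV[R]_(size W) => \sum_j
     (x 0 j - \sum_i b 0 i * row_list W i j) * (x 0 j - \sum_i b 0 i * row_list W i j))); last first.
    by apply/funext => b; rewrite dotE; apply: eq_bigr => j _; rewrite !mxE.
  have Fa : Filter (nbhs a) by exact: nbhs_filter.
  apply: (cvg_big _ Fa) => [|j _]; first exact: add_continuous.
  have H : (x 0 j - \sum_i b 0 i * row_list W i j) @[b --> a] -->
      x 0 j - \sum_i a 0 i * row_list W i j.
    apply: cvgB; first exact: cvg_cst.
    apply: (cvg_big _ Fa) => [|i _]; first exact: add_continuous.
    by apply: cvgM; [exact: coord_continuous|exact: cvg_cst].
  exact: cvgM.
have S0 : simplex (k := size W) !=set0.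
  by have /hullP[a aS _] := mem_hull w0W; exists a.
have [a /set_mem aS amin] := compact_EVT_min S0 (@compact_simplex (size W)) (continuous_subspaceT cf).
have yH : hull W (a *m row_list W) by apply/hullP; exists a.
exists (a *m row_list W) => // w wW; set y := a *m row_list W in yH *.
rewrite leNgt; apply/negP => h.
set p := dot (x - y) (w - y) in h.
set q := dot (w - y) (w - y); have q0 : 0 <= q by exact: dot_ge0.
(* The step [t] makes the quadratic term [t ^+ 2 * q] smaller than the gain. *)
pose t := Num.min 1 (p / (q + 1)).
have q1 : 0 < q + 1 by rewrite ltr_wpDl.
have t0 : 0 < t by rewrite lt_min ltr01 divr_gt0.
have t1 : t <= 1 by rewrite ge_min lexx.
have tq : t * (q + 1) <= p by rewrite -ler_pdivlMr// ge_min lexx orbT.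
have [|b bS bE] := (hullP W (y + t *: (w - y))).1.
  by apply: hull_segment => //; [exact: mem_hull|rewrite t1 ltW].
have := amin b (mem_set bS); rewrite /f -bE -/y.
have -> : x - (y + t *: (w - y)) = (x - y) - t *: (w - y) by rewrite opprD addrA.
rewrite dot_subZ -/p -/q => H.
have : t * (t * (q + 1)) <= t * p by rewrite ler_wpM2l// ltW.
have := mulr_gt0 t0 t0; have := mulr_gt0 t0 h; nra.
Qed.

End hulls.

(** * Facets and the cones over them *)

Section facets.
Variable R : realType.

Lemma separation n (W : seq 'rV[R]_n) x : (exists w, w \in W) -> ~ hull W x ->
  exists c, {in W, forall w, dot c w < dot c x}.
Proof.
move=> W0 xW; have [y yW yP] := nearest_point x W0.
exists (x - y) => w wW.
have xy : x - y != 0.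
  by apply/negP => /eqP/subr0_eq xyE; apply: xW; rewrite xyE.
have := yP w wW; have := dot_gt0 xy.
rewrite {2}/dot -/(dot _ _) !dotBr => H1 H2.
by rewrite -subr_gt0; lra.
Qed.

(** In positive dimension, this says that the origin is interior to the hull
    of [W]. *)
Definition pos_span n (W : seq 'rV[R]_n) : Prop :=
  forall d, d != 0 -> exists2 w, w \in W & 0 < dot d w.

(** A facet of a polytope around the origin is encoded by the linear form [c]
    whose value on its hyperplane is [1]. The second clause says that the
    generators on this hyperplane span the space; equivalently, [c] is a
    vertex of the polar polytope. *)
Definition is_facet n (W : seq 'rV[R]_n) (c : 'rV[R]_n) : Prop :=
  {in W, forall w, dot c w <= 1} /\
  forall d, {in W, forall w, dot c w = 1 -> dot d w = 0} -> d = 0.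

Lemma seq_argmin (T : eqType) (s : seq T) (f : T -> R) : s != [::] ->
  exists2 x, x \in s & {in s, forall y, f x <= f y}.
Proof.
elim: s => // a s IH _; have [->|/IH[x xs xm]] := eqVneq s [::].
  by exists a; rewrite ?mem_head// => y; rewrite inE => /eqP ->.
have [ax|xa] := leP (f a) (f x).
  exists a; first exact: mem_head.
  by move=> y; rewrite inE => /predU1P[->//|/xm]; exact: le_trans.
exists x; first by rewrite inE xs orbT.
by move=> y; rewrite inE => /predU1P[->|/xm//]; exact: ltW.
Qed.

Lemma count_lt (T : eqType) (s : seq T) (a b : pred T) x :
  {in s, forall y, a y -> b y} -> x \in s -> b x -> ~~ a x ->
  (count a s < count b s)%N.
Proof.
elim: s => // y s IH ab; rewrite inE => /predU1P[<-|xs] bx ax /=.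
  rewrite bx (negbTE ax) add0n add1n ltnS.
  rewrite (eq_in_count (a2 := predI a b)) => [|z zs /=].
    by apply: sub_count => z /andP[].
  by case az: (a z) => //=; rewrite ab// inE zs orbT.
rewrite -addnS leq_add//.
  by have := ab y (mem_head _ _); case: (a y) => // ->.
by apply: IH => // z zs; apply: ab; rewrite inE zs orbT.
Qed.

(** The form [c] is pushed within the polar polytope until the generators on
    which it is [1] span the space. Each push keeps those generators and adds
    one, so the number of the others decreases; its direction does not
    decrease the value at [x]. *)
Lemma push_to_facet n (W : seq 'rV[R]_n) x c : pos_span W ->
  {in W, forall w, dot c w <= 1} -> 1 < dot c x ->
  exists2 c', is_facet W c' & 1 < dot c' x.
Proof.
move=> pW.
have [k] := ubnP (count (fun w => dot c w != 1) W).
elim: k c => // k IH c; rewrite ltnS => ck cW cx.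
have [|] := pselect (forall d, {in W, forall w, dot c w = 1 -> dot d w = 0} -> d = 0).
  by exists c.
move=> /existsNP[d0 /not_implyP[d0W /eqP d00]].
have [d [dW d_neq0 dx]] : exists d, [/\ {in W, forall w, dot c w = 1 -> dot d w = 0},
    d != 0 & 0 <= dot d x].
  have [dx|dx] := leP 0 (dot d0 x); first by exists d0.
  exists (- d0); split; rewrite ?oppr_eq0//; last by rewrite dotNl oppr_ge0 ltW.
  by move=> w wW cw; rewrite dotNl d0W// oppr0.
have [w0 w0W dw0] := pW d d_neq0.
pose s := [seq w <- W | 0 < dot d w].
have [|w /[!mem_filter]/andP[dw wW] wmin] := @seq_argmin _ s (fun w => (1 - dot c w) / dot d w).
  have : w0 \in s by rewrite mem_filter dw0 w0W.
  by case: (s).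
(* The largest step for which [c + t *: d] stays in the polar polytope. *)
set t := (1 - dot c w) / dot d w in wmin.
have t0 : 0 <= t by rewrite divr_ge0 ?subr_ge0 ?cW// ltW.
apply: (IH (c + t *: d)).
- apply: leq_trans ck; apply: (count_lt _ wW).
  + move=> y yW; apply: contra => /eqP cy.
    by rewrite dotDl dotZl cy (dW _ yW cy) mulr0 addr0.
  + by apply/eqP => cw; move: dw; rewrite (dW _ wW cw) ltxx.
  + rewrite negbK dotDl dotZl /t divfK ?(lt0r_neq0 dw)//.
    by rewrite addrC subrK.
- move=> y yW; rewrite dotDl dotZl -lerBrDl.
  have [dy|dy] := ltP 0 (dot d y).
    by rewrite -ler_pdivlMr// wmin// mem_filter dy yW.
  by apply: (@le_trans _ _ 0); [rewrite mulr_ge0_le0|rewrite subr_ge0 cW].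
- by rewrite dotDl dotZl ltr_wpDr// mulr_ge0.
Qed.

Lemma pos_span_nonempty n (W : seq 'rV[R]_n.+1) : pos_span W -> exists w, w \in W.
Proof.
move=> pW; have [|w wW _] := pW (const_mx 1); last by exists w.
apply/negP => /eqP/rowP/(_ 0); rewrite !mxE => /eqP; by rewrite oner_eq0.
Qed.

Lemma outside_hull n (W : seq 'rV[R]_n.+1) x : pos_span W -> ~ hull W x ->
  exists2 c, is_facet W c & 1 < dot c x.
Proof.
move=> pW xW; have W0 := pos_span_nonempty pW.
have [c cW] := separation W0 xW.
have [|w wW wmax] := @seq_argmin _ W (fun w => - dot c w).
  by case: W0 => w; case: (W).
have c0 : c != 0 by apply/eqP => c0; have := cW w wW; rewrite c0 !dot0l ltxx.
have [w1 w1W cw1] := pW c c0.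
have cw : 0 < dot c w by have := wmax w1 w1W; rewrite lerN2; exact: lt_le_trans.
apply: (@push_to_facet _ _ _ ((dot c w)^-1 *: c)) => //.
- by move=> y yW; rewrite dotZl ler_pdivrMl// mulr1; have := wmax y yW; rewrite lerN2.
- by rewrite dotZl ltr_pdivlMl// mulr1 cW.
Qed.

Lemma hull_facetsP n (W : seq 'rV[R]_n.+1) x : pos_span W ->
  hull W x <-> forall c, is_facet W c -> dot c x <= 1.
Proof.
move=> pW; split=> [xW c [cW _]|H]; first exact: (hull_le cW).
apply: contrapT => /(outside_hull pW)[c /H cx]; by rewrite ltNge cx.
Qed.

(** There are finitely many facets because a facet is determined by the
    positions in [W] of the generators that it contains. *)
Lemma facets_seq n (W : seq 'rV[R]_n) :
  exists2 Cs : seq 'rV[R]_n, uniq Cs & forall c, c \in Cs <-> is_facet W c.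
Proof.
pose mask (c : 'rV[R]_n) := [ffun i : 'I_(size W) => dot c W`_i == 1].
have maskP c c' : is_facet W c -> mask c = mask c' -> is_facet W c' -> c = c'.
  move=> [_ cW] cc' _; apply/subr0_eq/cW => w wW cw.
  have iW : (index w W < size W)%N by rewrite index_mem.
  have := congr1 (fun m : {ffun _ -> bool} => m (Ordinal iW)) cc'.
  rewrite !ffunE /= nth_index// cw eqxx => /esym/eqP c'w.
  by rewrite dotBl cw c'w subrr.
pose F m := xget 0 [set c | is_facet W c /\ mask c = m].
have fin : finite_set [set c | is_facet W c].
  apply: (@sub_finite_set _ _ (F @` setT)); last exact/finite_image/finite_finset.
  move=> c /= cF; exists (mask c) => //; rewrite /F.
  case: xgetP => [c' _ [c'F c'm]|/(_ c)[]//].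
  exact: maskP.
have [s sE] := (finite_seqP _).1 fin.
exists (undup s); first exact: undup_uniq.
by move=> c; rewrite mem_undup; split => [cs|cF]; [|]; have := congr1 (fun A => A c) sE;
  move=> /= E; [rewrite E|rewrite -E].
Qed.

(** The maximum of [dot c x] over the facets is the gauge of the hull at [x].
    It is positive since a large multiple of [x] is outside the hull, hence
    beyond some facet. *)
Lemma max_facet n (W : seq 'rV[R]_n.+1) x : pos_span W -> x != 0 ->
  exists c, [/\ is_facet W c, 0 < dot c x & forall c', is_facet W c' -> dot c' x <= dot c x].
Proof.
move=> pW x0; have W0 := pos_span_nonempty pW.
have [Cs _ CsP] := facets_seq W.
have [c1 c1F c1x] : exists2 c, is_facet W c & 0 < dot c x.
  have [|w wW wmax] := @seq_argmin _ W (fun w => - dot x w).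
    by case: W0 => w; case: (W).
  have [w1 w1W xw1] := pW x x0.
  have xw : 0 < dot x w by have := wmax w1 w1W; rewrite lerN2; exact: lt_le_trans.
  have xx := dot_gt0 x0.
  (* [dot x (s *: x)] exceeds the maximum of [dot x] on [W] by [1]. *)
  pose s := (dot x w + 1) / dot x x; have s0 : 0 < s by rewrite divr_gt0// ltr_wpDr ?ltr01 ?ltW.
  have out : ~ hull W (s *: x).
    have xW : {in W, forall y, dot x y <= dot x w}.
      by move=> y yW; have := wmax y yW; rewrite lerN2.
    move=> /(hull_le xW); rewrite dotZr /s divfK ?gt_eqF//; lra.
  have [c cF] := outside_hull pW out; rewrite dotZr => cx; exists c => //.
  by rewrite -(pmulr_rgt0 _ s0) (lt_trans ltr01).
have [|c /CsP cF cmax] := @seq_argmin _ Cs (fun c => - dot c x).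
  by move/CsP: c1F; case: (Cs).
exists c; split => //.
  by have := cmax c1 ((CsP c1).2 c1F); rewrite lerN2; exact: lt_le_trans.
by move=> c' /CsP c'C; have := cmax c' c'C; rewrite lerN2.
Qed.

(** A facet where [dot c x] is largest is one through which the ray of [x]
    leaves the hull. *)
Lemma cone_cover n (W : seq 'rV[R]_n.+1) x : pos_span W -> x != 0 ->
  exists c, [/\ is_facet W c, 0 < dot c x & hull W ((dot c x)^-1 *: x)].
Proof.
move=> pW x0; have [c [cF cx cmax]] := max_facet pW x0.
exists c; split => //; apply/(hull_facetsP _ pW) => c' /cmax c'x.
by rewrite dotZr ler_pdivrMl// mulr1.
Qed.

End facets.

(** * Exposed faces and affine spans *)

Section faces.
Variable R : realType.

(** Generators with [dot c w < b] leave some room, and there are finitely many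
    of them. *)
Lemma small_tilt n (W : seq 'rV[R]_n) c b d e :
  {in W, forall w, dot c w <= b} ->
  {in W, forall w, dot c w = b -> dot d w <= e} ->
  exists2 t, 0 < t & {in W, forall w, dot (c + t *: d) w <= b + t * e}.
Proof.
elim: W => [|w W IH] cW dW; first by exists 1.
have cW' : {in W, forall w, dot c w <= b} by move=> v vW; rewrite cW// inE vW orbT.
have dW' : {in W, forall w, dot c w = b -> dot d w <= e}.
  by move=> v vW; apply: dW; rewrite inE vW orbT.
have [t t0 tW] := IH cW' dW'.
have cw := cW w (mem_head _ _); have dw := dW w (mem_head _ _).
have [s s0 sw] : exists2 s, 0 < s & forall r, 0 <= r -> r <= s ->
    dot c w + r * dot d w <= b + r * e.
  have [de|de] := leP (dot d w) e.
    by exists 1 => // r r0 _; rewrite lerD// ler_wpM2l.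
  have cb : dot c w < b.
    by rewrite lt_neqAle cw andbT; apply: contraTneq de => /dw; rewrite -leNgt.
  have de0 : 0 < dot d w - e by rewrite subr_gt0.
  exists ((b - dot c w) / (dot d w - e)); first by rewrite divr_gt0// subr_gt0.
  move=> r r0; rewrite ler_pdivlMr// mulrBr; lra.
have m0 : 0 < Num.min t s by rewrite lt_min t0 s0.
exists (Num.min t s) => // v; rewrite inE => /predU1P[->|vW].
  rewrite dotDl dotZl; apply: sw; first exact: ltW.
  by rewrite ge_min lexx orbT.
have := tW v vW; rewrite !dotDl !dotZl => tv.
have cv : dot c v <= b by apply: cW; rewrite inE vW orbT.
have [E|E] := leP t s => //.
have st : s / t <= 1 by rewrite ler_pdivrMr// mul1r ltW.
have st0 : 0 <= s / t by rewrite divr_ge0// ltW.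
have -> : s = (s / t) * t by rewrite divfK// gt_eqF.
nra.
Qed.

Lemma face_of_support n (V : seq 'rV[R]_n) c b : {in V, forall v, dot c v <= b} ->
  (hull V `&` [set x | dot c x = b]) !=set0 ->
  face (hull V) (hull V `&` [set x | dot c x = b]).
Proof.
by move=> cV F0; split => //; exists c, b; split => // x; exact: hull_le.
Qed.

(** The supporting form of the smaller face is that of the larger one,
    slightly tilted. *)
Lemma face_of_face n (V : seq 'rV[R]_n) F d e : face (hull V) F ->
  (forall x, F x -> dot d x <= e) -> (F `&` [set x | dot d x = e]) !=set0 ->
  face (hull V) (F `&` [set x | dot d x = e]).
Proof.
move=> [_ [c [b [cP ->]]]] dF F0.
have cV : {in V, forall w, dot c w <= b} by move=> v /mem_hull; exact: cP.
have dV : {in V, forall w, dot c w = b -> dot d w <= e}.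
  by move=> v vV cv; apply: dF; split => //; exact: mem_hull.
have [t t0 tV] := small_tilt cV dV.
(* A step strictly below [t]: equality in the tilted inequality then forces
   equality in the inequality for [c]. *)
have t2 : 0 < t / 2 by rewrite divr_gt0.
split=> //; exists (c + (t / 2) *: d), (b + t / 2 * e).
have le x : hull V x -> dot c x + t * dot d x <= b + t * e.
  by move=> /(hull_le tV); rewrite dotDl dotZl.
split=> [x xV|].
  have := le x xV; have := cP x xV; rewrite -/(dot c x) -/(dot _ x) dotDl dotZl; lra.
apply/seteqP; split=> x /=; rewrite -/(dot c x) -/(dot _ x).
  by move=> [[xV cx] dx]; split => //; rewrite dotDl dotZl cx dx.
move=> [xV]; rewrite dotDl dotZl => E.
have H1 := le x xV; have H2 := cP x xV; rewrite -/(dot c x) in H2.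
have cx : dot c x = b by lra.
split; first by split.
have : t * (dot d x - e) = 0 by lra.
by move=> /eqP; rewrite mulf_eq0 (gt_eqF t0)/= subr_eq0 => /eqP.
Qed.

Lemma sub_affine_span n (S : set 'rV[R]_n) : S `<=` affine_span S.
Proof.
move=> x Sx; exists 1%N, (fun=> 1), (fun=> x); split => //.
  by rewrite big_ord1.
by rewrite big_ord1 scale1r.
Qed.

Lemma affine_span_line n (S : set 'rV[R]_n) x y t : S x -> S y ->
  affine_span S (x + t *: (y - x)).
Proof.
move=> Sx Sy; exists 2%N, (fun i => if i == 0 then 1 - t else t),
  (fun i => if i == 0 then x else y); split.
- by move=> i; case: ifP.
- by rewrite !big_ord_recl big_ord0/= addr0 subrK.
- rewrite !big_ord_recl big_ord0/= addr0 scalerBl scale1r scalerBr.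
  by rewrite -addrA [- _ + _]addrC.
Qed.

Lemma affine_span_eq m n (S : set 'rV[R]_n) (Q : 'M[R]_(n, m)) r :
  (forall x, S x -> x *m Q = r) -> forall x, affine_span S x -> x *m Q = r.
Proof.
move=> H x [k [w [v [Sv w1 ->]]]]; rewrite mulmx_suml.
rewrite (eq_bigr (fun i => w i *: r)) => [|i _]; last by rewrite -scalemxAl H.
by rewrite -scaler_suml w1 scale1r.
Qed.

Lemma dim_rV n : \dim {:'rV[R]_n} = n.
Proof. by rewrite dimvf dim_matrix; exact: mul1n. Qed.

(** The direction is the span of a family of differences [x - p], [x] in [S],
    whose rank is the largest possible. *)
Lemma affine_span_vspace n (S : set 'rV[R]_n) : S !=set0 ->
  exists p (U : {vspace 'rV[R]_n}), affine_span S = [set p + u | u in [set` U]].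
Proof.
move=> [p Sp].
pose D (d : nat) := exists2 s : seq 'rV[R]_n, {in s, forall v, S (p + v)} & \dim (span s) = d.
have Dex : exists d, `[< D d >].
  by exists 0%N; apply/asboolP; exists [::] => //; rewrite span_nil dimv0.
have Dub d : `[< D d >] -> (d <= n)%N.
  by move=> /asboolP[s _ <-]; rewrite (leq_trans (dimvS (subvf _)))// dim_rV.
have [d /asboolP[s sS sd] dmax] := ex_maxnP Dex Dub.
have SU x : S x -> x - p \in (span s).
  move=> Sx; apply: contrapT => /negP xs.
  have : (\dim (span ((x - p)%R :: s)) <= d)%N.
    apply: dmax; apply/asboolP; exists (x - p :: s) => // v.
    by rewrite inE => /predU1P[->|/sS//]; rewrite addrC subrK.
  rewrite leqNgt => /negP; apply; rewrite -sd.
  have sub : ((span s) <= (span ((x - p)%R :: s)))%VS by rewrite span_cons addvSr.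
  rewrite ltn_neqAle dimvS// andbT; apply: contra xs => E.
  have /eqP -> : (span s) == (span ((x - p)%R :: s)) by rewrite eqEdim sub/= (eqP E).
  by rewrite memv_span// mem_head.
exists p, (span s); apply/seteqP; split => x.
  move=> [m [w [v [Sv w1 ->]]]]; exists (\sum_i w i *: v i - p); last by rewrite addrC subrK.
  rewrite /= -[p in X in X \in _]scale1r -w1 scaler_suml -sumrB.
  by apply: memv_suml => i _; rewrite -scalerBr memvZ// SU.
move=> [u /= us <-].
have := coord_span (X := in_tuple s) us => ->.
set a := fun i => coord (in_tuple s) i u.
exists (size s).+1, (fun i => oapp a (1 - \sum_j a j) (unlift ord0 i)),
  (fun i => oapp (fun j : 'I_(size s) => p + s`_j) p (unlift ord0 i)); split.
- move=> i; case: unliftP => [j _|_] //=.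
  by apply: sS; exact: mem_nth.
- rewrite big_ord_recl unlift_none -[RHS](subrK (\sum_j a j)); congr (_ + _).
  by apply: eq_bigr => j _; rewrite liftK.
- rewrite [RHS]big_ord_recl unlift_none.
  rewrite [X in _ = _ + X](eq_bigr (fun j => a j *: p + a j *: s`_j)) => [|j _]; last first.
    by rewrite liftK/= scalerDr.
  rewrite big_split/= -scaler_suml addrA -scalerDl subrK scale1r.
  by congr (_ + _); apply: eq_bigr => i _; rewrite (tnth_nth 0).
Qed.

End faces.

(** * Codimension and orthonormal frames *)

Section frames.
Variable R : realType.

Definition deep n (P : set 'rV[R]_n) : Prop :=
  forall (k : nat) (F : set 'rV[R]_n), face P F -> codimension k F ->
    Num.sqrt (k%:R : R) <= euclid_dist 0 (affine_span F).

Lemma deep_codim n (P F : set 'rV[R]_n) k q : deep P -> face P F ->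
  codimension k F -> affine_span F q -> k%:R <= dot q q.
Proof.
move=> dP fF cF qF; have := dP k F fF cF.
have le : euclid_dist 0 (affine_span F) <= Num.sqrt (dot q q).
  apply: ge_inf; last first.
    by exists q => //; rewrite euclid_normE sub0r dotNl dotNr opprK.
  by exists 0 => _ [x _ <-]; rewrite euclid_normE sqrtr_ge0.
by move=> /le_trans/(_ le); rewrite ler_sqrt// dot_ge0.
Qed.

(** A face on which [k] orthonormal linear forms are constant has codimension
    at least [k]. Most faces below are known through such forms only, and an
    inequality on their codimension is enough. *)
Lemma deep_orthonormal n (P F : set 'rV[R]_n) k (Q : 'M[R]_(k, n)) r q :
  deep P -> face P F -> Q *m Q^T = 1%:M -> (forall x, F x -> x *m Q^T = r) ->
  affine_span F q -> k%:R <= dot q q.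
Proof.
move=> dP fF QQ Qr qF; have [F0 _] := fF.
have [p [U UE]] := affine_span_vspace F0.
have UQ u : u \in U -> u *m Q^T = 0.
  move=> uU; have inU v : v \in U -> (p + v) *m Q^T = r.
    by move=> vU; apply: (affine_span_eq Qr); rewrite UE; exists v.
  have := inU u uU; rewrite -(inU 0 (mem0v _)) addr0 mulmxDl => /eqP.
  by rewrite -subr_eq0 addrAC subrr add0r => /eqP.
pose f : 'Hom('rV[R]_k, 'rV[R]_n) := linfun (mulmxr Q).
have fE a : f a = a *m Q by rewrite lfunE.
have kerf : (lker f == 0)%VS.
  apply/lker0P => a b; rewrite !fE => /(congr1 (fun z => z *m Q^T)).
  by rewrite -!mulmxA QQ !mulmx1.
have dimf : \dim (limg f) = k by rewrite limg_dim_eq ?dim_rV// (eqP kerf) capv0.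
have UI : (U :&: limg f = 0)%VS.
  apply/eqP; rewrite -subv0; apply/subvP => v; rewrite memv_cap memv0.
  move=> /andP[vU /memv_imgP[a _ E]]; rewrite E fE.
  have := UQ v vU; rewrite E fE -mulmxA QQ mulmx1 => ->.
  by rewrite mul0mx.
have le : (\dim U + k <= n)%N.
  rewrite -{1}dimf -dimv_disjoint_sum// -[leqRHS](dim_rV R); exact: dimvS (subvf _).
have Un : (\dim U <= n)%N by rewrite (leq_trans _ le)// leq_addr.
have cF : codimension (n - \dim U)%N F by exists p, U; rewrite subnKC.
apply: le_trans (deep_codim dP fF cF qF).
by rewrite ler_nat -(leq_add2l (\dim U)) subnKC.
Qed.

(** No nonzero vector is orthogonal to all the generators on the facet, so the
    matrix that they form has full row space. *)
Lemma facet_span n (W : seq 'rV[R]_n) c x : is_facet W c ->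
  exists a : 'rV[R]_(size [seq w <- W | dot c w == 1]),
    x = a *m row_list [seq w <- W | dot c w == 1].
Proof.
move=> [_ cW]; set T := [seq _ <- _ | _]; set M := row_list T.
suff /row_fullP[B BM] : row_full M by exists (x *m B); rewrite -mulmxA BM mulmx1.
have fr : row_free M^T.
  rewrite -kermx_eq0; apply/eqP/row_matrixP => i; rewrite row0.
  apply: cW => w wW cw; have wT : w \in T by rewrite mem_filter cw eqxx.
  have iT : (index w T < size T)%N by rewrite index_mem.
  have /rowP/(_ (Ordinal iT)) : row i (kermx M^T) *m M^T = 0.
    by rewrite -row_mul mulmx_ker row0.
  rewrite mxE [RHS]mxE => E; rewrite dotE -[RHS]E; apply: eq_bigr => j _.
  by rewrite !mxE/= nth_index.
by move: fr; rewrite /row_free /row_full mxrank_tr.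
Qed.

Definition facet_set n (W : seq 'rV[R]_n) c : set 'rV[R]_n :=
  hull W `&` [set x | dot c x = 1].

Lemma facet_affine_span n (W : seq 'rV[R]_n) c : is_facet W c ->
  affine_span (facet_set W c) = [set x | dot c x = 1].
Proof.
move=> cF; apply/seteqP; split=> x.
  move=> [m [w [v [Sv w1 ->]]]]; rewrite /= dot_sumr -w1.
  by apply: eq_bigr => i _; rewrite dotZr; have [_ ->] := Sv i; rewrite mulr1.
move=> /= cx; have [a xE] := facet_span x cF; move: a xE.
set T := [seq _ <- _ | _] => a xE.
have TP i : (i < size T)%N -> T`_i \in W /\ dot c T`_i = 1.
  by move=> iT; have := mem_nth 0 iT; rewrite mem_filter => /andP[/eqP ->].
exists (size T), (fun i => a 0 i), (fun i => T`_i); split.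
- by move=> i; have [iW ci] := TP i (ltn_ord i); split => //; exact: mem_hull.
- rewrite -cx xE mulmx_sum_row dot_sumr; apply: eq_bigr => i _.
  by rewrite dotZr row_row_list (TP i (ltn_ord i)).2 mulr1.
- by rewrite {1}xE mulmx_sum_row; apply: eq_bigr => i _; rewrite row_row_list.
Qed.

Lemma facet_neq0 n (W : seq 'rV[R]_n.+1) c : is_facet W c ->
  exists2 w, w \in W & dot c w = 1.
Proof.
move=> [_ cW]; apply: contrapT => H.
have : (const_mx 1 : 'rV[R]_n.+1) = 0.
  by apply: cW => w wW cw; exfalso; apply: H; exists w.
by move=> /rowP/(_ 0); rewrite !mxE => /eqP; rewrite oner_eq0.
Qed.

Lemma facet_vec_neq0 n (W : seq 'rV[R]_n.+1) c : is_facet W c -> c != 0.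
Proof.
move=> /facet_neq0[w _ cw]; apply/eqP => c0; move: cw.
by rewrite c0 dot0l => /eqP; rewrite eq_sym oner_eq0.
Qed.

Lemma facet_face n (W : seq 'rV[R]_n.+1) c : is_facet W c ->
  face (hull W) (facet_set W c).
Proof.
move=> cF; have [w wW cw] := facet_neq0 cF.
apply: face_of_support; first by case: cF.
by exists w; split => //; exact: mem_hull.
Qed.

(** A reflection exchanges [u] and the first basis vector; the other rows of
    its matrix complete [u] to an orthonormal basis. *)
Lemma orthonormal_completion m (u : 'rV[R]_m.+1) : dot u u = 1 ->
  exists A : 'M[R]_(m, m.+1), A *m A^T = 1%:M /\ u *m A^T = 0.
Proof.
move=> uu; pose e : 'rV[R]_m.+1 := delta_mx 0 0.
have ee : dot e e = 1.
  by rewrite dotE (bigD1 0)//= !mxE eqxx mulr1 big1 ?addr0// => i i0; rewrite mxE eqxx (negbTE i0) mulr0.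
suff [H [HH eH]] : exists H : 'M[R]_m.+1, H *m H^T = 1%:M /\ e *m H = u.
  have HHE i j : \sum_k H i k * H j k = (i == j)%:R.
    have := congr1 (fun M : 'M[R]_m.+1 => M i j) HH; rewrite !mxE => <-.
    by apply: eq_bigr => k _; rewrite mxE.
  exists (rowsub (lift ord0) H); split.
    apply/matrixP => i j; rewrite !mxE -(inj_eq (@lift_inj _ ord0)) -HHE.
    by apply: eq_bigr => k _; rewrite !mxE.
  apply/rowP => j; rewrite !mxE -eH -rowE.
  transitivity (\sum_k H ord0 k * H (lift ord0 j) k); last by rewrite HHE.
  by apply: eq_bigr => k _; rewrite !mxE.
have [ue|ue] := eqVneq u e.
  by exists 1%:M; rewrite trmx1 mulmx1 mulmx1.
(* The reflection in the hyperplane orthogonal to [u - e]. *)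
pose v := u - e; have v0 : v != 0 by rewrite subr_eq0.
have vv := dot_gt0 v0.
pose k := 2 / dot v v.
have E1 : v *m v^T = (dot v v)%:M by apply/matrixP => i j; rewrite !ord1 [RHS]mxE eqxx.
exists (1%:M - k *: (v^T *m v)).
have tr : (1%:M - k *: (v^T *m v))^T = 1%:M - k *: (v^T *m v).
  by rewrite linearB linearZ/= trmx1 trmx_mul trmxK.
split.
  rewrite tr; set N := v^T *m v.
  have NN : N *m N = dot v v *: N.
    by rewrite /N mulmxA -[X in X *m _]mulmxA E1 mul_mx_scalar scalemxAl.
  have kk : k * k * dot v v = k + k by rewrite /k; field; rewrite gt_eqF.
  rewrite mulmxBr mulmx1 mulmxBl mul1mx -scalemxAl -scalemxAr NN !scalerA kk.
  by rewrite scalerDl opprB addrK subrK.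
rewrite mulmxBr mulmx1 -scalemxAr mulmxA.
have -> : e *m v^T = (dot e v)%:M by apply/matrixP => i j; rewrite !ord1 [RHS]mxE eqxx.
rewrite mul_scalar_mx scalerA.
have -> : k * dot e v = - 1.
  have E : dot v v = - 2 * dot e v.
    rewrite /v !(dotBl, dotBr) uu ee (dotC u e); ring.
  by rewrite /k E; field; move: vv; rewrite E; case: eqP => // ->; rewrite mulr0 ltxx.
by rewrite scaleN1r opprK /v addrC subrK.
Qed.

Section orthonormal.
Variables (m : nat) (u : 'rV[R]_m.+1) (A : 'M[R]_(m, m.+1)).
Hypotheses (uu : dot u u = 1) (AA : A *m A^T = 1%:M) (uA : u *m A^T = 0).

Lemma orthonormal_decomp x : x = dot u x *: u + x *m A^T *m A.
Proof.
pose O : 'M[R]_(1 + m) := col_mx u A.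
have u1 : u *m u^T = 1%:M by apply/matrixP => i j; rewrite !ord1 [RHS]mxE eqxx.
have OO : O *m O^T = 1%:M.
  rewrite tr_col_mx mul_col_row u1 AA uA.
  rewrite (_ : A *m u^T = 0) ?scalar_mx_block//.
  by apply: trmx_inj; rewrite trmx_mul trmxK uA trmx0.
have := mulmx1C OO; rewrite tr_col_mx mul_row_col => I.
rewrite -{1}(mulmx1 x) -I mulmxDr !mulmxA; congr (_ + _).
have -> : x *m u^T = (dot u x)%:M.
  by rewrite dotC; apply/matrixP => i j; rewrite !ord1 [RHS]mxE eqxx.
by rewrite mul_scalar_mx.
Qed.

Lemma dot_frame_ortho (y : 'rV[R]_m) : dot u (y *m A) = 0.
Proof. by rewrite dotC dot_mull uA dot0r. Qed.

Lemma dot_frame (y z : 'rV[R]_m) : dot (y *m A) (z *m A) = dot y z.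
Proof. by rewrite dot_mull -mulmxA AA mulmx1. Qed.

Lemma frame_coord (y : 'rV[R]_m) t : (t *: u + y *m A) *m A^T = y.
Proof. by rewrite mulmxDl -scalemxAl uA scaler0 add0r -mulmxA AA mulmx1. Qed.

Lemma orthonormal_norm x : dot x x = dot u x ^+ 2 + dot (x *m A^T) (x *m A^T).
Proof.
rewrite {1 2}(orthonormal_decomp x) !(dotDl, dotDr, dotZl, dotZr) uu dot_frame.
by rewrite (dotC _ u) dot_frame_ortho; ring.
Qed.

End orthonormal.

End frames.

(** * Vertices of facets and coordinates *)

Section edges_of_polygon.
Variable R : realType.

Lemma hull_affine m n (W : seq 'rV[R]_m) (p : 'rV[R]_n) (B : 'M[R]_(m, n)) y :
  hull W y -> hull [seq p + w *m B | w <- W] (p + y *m B).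
Proof.
move=> [k [w [v [Wv w0 w1 ->]]]]; exists k, w, (fun i => p + v i *m B); split => //.
  by move=> i; rewrite /=; apply: map_f; exact: Wv.
rewrite mulmx_suml; under [in RHS]eq_bigr do rewrite scalerDr scalemxAl.
by rewrite big_split/= -scaler_suml w1 scale1r.
Qed.

Definition tight n (W : seq 'rV[R]_n) c := [seq w <- W | dot c w == 1].

(** A convex combination on which [c] reaches its maximum [1] gives positive
    weight to generators with value [1] only; the others are replaced by [w0].
    *)
Lemma facet_hull n (W : seq 'rV[R]_n.+1) c : is_facet W c ->
  facet_set W c = hull (tight W c).
Proof.
move=> cF; have [cW _] := cF; have [w0 w0W cw0] := facet_neq0 cF.
apply/seteqP; split=> x; last first.
  move=> [m [w [v [Tv wp w1 xE]]]].
  have vP i : v i \in W /\ dot c (v i) = 1.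
    by have := Tv i; rewrite /= mem_filter => /andP[/eqP].
  split; first by exists m, w, v; split => // i; have [] := vP i.
  rewrite /= xE dot_sumr -w1; apply: eq_bigr => i _.
  by rewrite dotZr (vP i).2 mulr1.
move=> [[m [w [v [Wv wp w1 xE]]]] /= cx].
have vT i : w i != 0 -> dot c (v i) = 1.
  move=> wi; have : \sum_i w i * (1 - dot c (v i)) = 0.
    under eq_bigr do rewrite mulrBr mulr1.
    rewrite sumrB w1 -cx xE dot_sumr -sumrB big1// => j _; by rewrite dotZr subrr.
  move=> /eqP; rewrite psumr_eq0 => [/allP H|j _]; last first.
    by rewrite mulr_ge0// subr_ge0 cW//; exact: Wv.
  have := H i (mem_index_enum i); rewrite /= mulf_eq0 (negbTE wi)/= subr_eq0.
  by move=> /eqP.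
exists m, w, (fun i => if w i == 0 then w0 else v i); split => //.
  move=> i; rewrite /= mem_filter; case: ifPn => [_|wi]; first by rewrite cw0 eqxx.
  by rewrite vT// eqxx; exact: Wv.
rewrite xE; apply: eq_bigr => i _; case: ifPn => // /eqP ->.
by rewrite !scale0r.
Qed.

(** A vertex of the facet [c], exposed in it by a unit vector [s] of its
    direction. For a polygon it is an end of an edge. *)
Definition edge_vertex n (W : seq 'rV[R]_n) c w : Prop :=
  [/\ w \in W, dot c w = 1 & exists s, [/\ dot s s = 1, dot c s = 0 &
     {in W, forall v, dot c v = 1 -> dot s v <= dot s w}]].

(** The extreme values of [s] differ, since otherwise a multiple of [c] would
    agree with [s] on generators that span the space. *)
Lemma edge_ends n (W : seq 'rV[R]_n.+1) c s : is_facet W c ->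
  dot s s = 1 -> dot c s = 0 ->
  exists w1 w2, [/\ edge_vertex W c w1, edge_vertex W c w2,
    dot s w1 < dot s w2 &
    forall x, facet_set W c x -> dot s w1 <= dot s x <= dot s w2].
Proof.
move=> cF ss cs; have [w0 w0W cw0] := facet_neq0 cF; have [_ cW] := cF.
have T0 : tight W c != [::].
  have : w0 \in tight W c by rewrite mem_filter cw0 eqxx.
  by case: (tight W c).
have [w1 /[!mem_filter]/andP[/eqP c1 w1W] min1] := seq_argmin (dot s) T0.
have [w2 /[!mem_filter]/andP[/eqP c2 w2W] min2] := seq_argmin (fun w => - dot s w) T0.
have le1 : {in W, forall v, dot c v = 1 -> dot s w1 <= dot s v}.
  by move=> v vW cv; apply: min1; rewrite mem_filter cv eqxx.
have le2 : {in W, forall v, dot c v = 1 -> dot s v <= dot s w2}.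
  by move=> v vW cv; rewrite -lerN2; apply: min2; rewrite mem_filter cv eqxx.
exists w1, w2; split.
- split => //; exists (- s); rewrite dotNl !dotNr opprK cs oppr0; split => //.
  by move=> v vW cv; rewrite !dotNl lerN2 le1.
- by split => //; exists s.
- rewrite lt_neqAle le2// andbT; apply/negP => /eqP E.
  have : s - dot s w1 *: c = 0.
    apply: cW => w wW cw; rewrite dotBl dotZl cw mulr1; apply/eqP.
    by rewrite subr_eq0 eq_le le1// andbT E le2.
  move=> /subr0_eq sE; move: ss; rewrite {1}sE dotZl cs mulr0 => /eqP.
  by rewrite eq_sym oner_eq0.
- move=> x; rewrite (facet_hull cF) => xT; apply/andP; split.
    rewrite -lerN2 -!dotNl; apply: (hull_le _ xT) => w /[!mem_filter]/andP[/eqP cw wW].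
    by rewrite !dotNl lerN2 le1.
  by apply: (hull_le _ xT) => w /[!mem_filter]/andP[/eqP cw wW]; exact: le2.
Qed.

(** Measures live on products and the geometry on row vectors; [pt2] and [pt3]
    identify the two. *)
Definition pt2 (z : plane R) : 'rV[R]_2 := \row_i (if i == 0 then z.1 else z.2).

Definition pt3 (z : space3 R) : 'rV[R]_3 :=
  \row_i (if i == 0 then z.1 else if i == 1 then z.2.1 else z.2.2).

Lemma dot2E (x y : 'rV[R]_2) : dot x y = x 0 0 * y 0 0 + x 0 1 * y 0 1.
Proof.
rewrite dotE !big_ord_recl big_ord0 addr0.
by rewrite (_ : lift ord0 ord0 = 1)//; apply: val_inj.
Qed.

Lemma dot3E (x y : 'rV[R]_3) :
  dot x y = x 0 0 * y 0 0 + x 0 1 * y 0 1 + x 0 2%:R * y 0 2%:R.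
Proof.
rewrite dotE !big_ord_recl big_ord0 addr0 addrA.
rewrite (_ : lift ord0 ord0 = 1); last exact: val_inj.
by rewrite (_ : lift ord0 (lift _ _) = 2%:R)//; apply: val_inj.
Qed.

Lemma dot_pt2 (c : 'rV[R]_2) z : dot c (pt2 z) = c 0 0 * z.1 + c 0 1 * z.2.
Proof. by rewrite dot2E !mxE. Qed.

Lemma dot_pt3 (c : 'rV[R]_3) z :
  dot c (pt3 z) = c 0 0 * z.1 + c 0 1 * z.2.1 + c 0 2%:R * z.2.2.
Proof. by rewrite dot3E !mxE. Qed.

Lemma pt2_eq0 z : (pt2 z == 0) = (z == 0).
Proof.
apply/eqP/eqP => [/rowP H|->]; last by apply/rowP => i; rewrite !mxE; case: ifP.
have := H 0; have := H 1; rewrite !mxE/= => z2 z1.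
by rewrite [z]surjective_pairing z1 z2.
Qed.

Lemma pt3_eq0 z : (pt3 z == 0) = (z == 0).
Proof.
apply/eqP/eqP => [/rowP H|->]; last first.
  by apply/rowP => i; rewrite !mxE; case: ifP => //; case: ifP.
have := H 0; have := H 1; have := H 2%:R; rewrite !mxE/= => z3 z2 z1.
by rewrite [z]surjective_pairing [z.2]surjective_pairing z1 z2 z3.
Qed.

(** Distance from the origin to the hyperplane where [c] takes the value [1];
    thus [height c *: c] is its unit normal. *)
Definition height n (c : 'rV[R]_n) : R := (Num.sqrt (dot c c))^-1.

Lemma height_gt0 n (c : 'rV[R]_n) : c != 0 -> 0 < height c.
Proof. by move=> c0; rewrite invr_gt0 sqrtr_gt0 dot_gt0. Qed.

Lemma height_sqr n (c : 'rV[R]_n) : height c ^+ 2 = (dot c c)^-1.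
Proof. by rewrite exprVn sqr_sqrtr// dot_ge0. Qed.

Lemma unit_normal n (c : 'rV[R]_n) : c != 0 ->
  dot (height c *: c) (height c *: c) = 1.
Proof.
move=> c0; rewrite dotZl dotZr mulrA -expr2 height_sqr mulVf//.
by rewrite gt_eqF// dot_gt0.
Qed.

End edges_of_polygon.

(** * Sectors of a polygon *)

Section polygons.
Variable R : realType.

Lemma plane_decomp (u s x : 'rV[R]_2) : dot u u = 1 -> dot s s = 1 ->
  dot u s = 0 -> x = dot u x *: u + dot s x *: s.
Proof.
move=> uu ss us.
have ss' : (s : 'M[R]_(1, 2)) *m s^T = 1%:M.
  by apply/matrixP => i j; rewrite !ord1 [RHS]mxE eqxx.
have us' : u *m (s : 'M[R]_(1, 2))^T = 0.
  by apply/matrixP => i j; rewrite !ord1 [RHS]mxE.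
rewrite {1}(orthonormal_decomp uu ss' us' x); congr (_ + _).
have -> : x *m s^T = (dot s x)%:M.
  by rewrite dotC; apply/matrixP => i j; rewrite !ord1 [RHS]mxE eqxx.
by rewrite mul_scalar_mx.
Qed.

Lemma plane_norm (u s x : 'rV[R]_2) : dot u u = 1 -> dot s s = 1 ->
  dot u s = 0 -> dot x x = dot u x ^+ 2 + dot s x ^+ 2.
Proof.
move=> uu ss us; rewrite {1 2}(plane_decomp x uu ss us).
by rewrite !(dotDl, dotDr, dotZl, dotZr) uu ss (dotC s u) us; ring.
Qed.

Definition coord2 (u s : 'rV[R]_2) (z : plane R) : plane R :=
  (dot u (pt2 z), dot s (pt2 z)).

Lemma coord2_norm (u s : 'rV[R]_2) z : dot u u = 1 -> dot s s = 1 ->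
  dot u s = 0 ->
  (coord2 u s z).1 ^+ 2 + (coord2 u s z).2 ^+ 2 = z.1 ^+ 2 + z.2 ^+ 2.
Proof.
move=> uu ss us; rewrite /= -(plane_norm _ uu ss us) dot2E !mxE/= -!expr2//.
Qed.

(** The square of the determinant of an orthonormal basis is its Gram
    determinant, that is [1]. *)
Lemma scales_coord2 (u s : 'rV[R]_2) : dot u u = 1 -> dot s s = 1 ->
  dot u s = 0 -> scales (@lam2 R) (coord2 u s) 1.
Proof.
rewrite !dot2E => uu ss us; pose D := u 0 0 * s 0 1 - u 0 1 * s 0 0.
have DD : D ^+ 2 = 1.
  transitivity ((u 0 0 * u 0 0 + u 0 1 * u 0 1) * (s 0 0 * s 0 0 + s 0 1 * s 0 1)
    - (u 0 0 * s 0 0 + u 0 1 * s 0 1) ^+ 2); first by rewrite /D; ring.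
  by rewrite uu ss us; ring.
have D0 : D != 0 by apply: contra_eq_neq DD => ->; rewrite expr0n eq_sym oner_neq0.
have nD : `|D| = 1.
  by apply: (@pexpIrn _ 2); rewrite ?nnegrE// real_normK ?num_real// expr1n.
have := scales_affine2 0 0 D0; rewrite -/D nD invr1.
by congr scales; apply/funext => z; rewrite /coord2 !dot_pt2 !addr0.
Qed.

Definition section2 (W : seq 'rV[R]_2) : set (plane R) :=
  [set z | hull W (pt2 z)].

Section sector.
Variables (W : seq 'rV[R]_2) (c s : 'rV[R]_2).
Hypotheses (pW : pos_span W) (cF : is_facet W c).
Hypotheses (ss : dot s s = 1) (cs : dot c s = 0).
Let d := height c.
Let u := d *: c.

Let c0 : c != 0. Proof. exact: facet_vec_neq0 cF. Qed.
Let d0 : 0 < d. Proof. exact: height_gt0. Qed.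
Let uu : dot u u = 1. Proof. exact: unit_normal. Qed.
Let us : dot u s = 0. Proof. by rewrite /u dotZl cs mulr0. Qed.

Lemma cone2_coord E z : cone2 d E (coord2 u s z) <->
  0 < dot c (pt2 z) /\ E (dot s ((dot c (pt2 z))^-1 *: pt2 z)).
Proof.
rewrite /cone2 /= dotZr /u dotZl pmulr_rgt0//.
have E1 : 0 < dot c (pt2 z) ->
    d / (d * dot c (pt2 z)) * dot s (pt2 z) = (dot c (pt2 z))^-1 * dot s (pt2 z).
  by move=> cz; field; rewrite !gt_eqF.
by split=> -[cz]; rewrite E1.
Qed.

Lemma edge_point x : dot c x = 1 -> x = d *: u + dot s x *: s.
Proof.
by move=> cx; rewrite {1}(plane_decomp x uu ss us) /u dotZl cx mulr1.
Qed.

Lemma edge_point_norm x : dot c x = 1 -> dot x x = d ^+ 2 + dot s x ^+ 2.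
Proof. by move=> cx; rewrite (plane_norm x uu ss us) /u dotZl cx mulr1. Qed.

Section ends.
Variables (w1 w2 : 'rV[R]_2).
Hypotheses (v1 : edge_vertex W c w1) (v2 : edge_vertex W c w2)
  (w12 : dot s w1 < dot s w2)
  (wE : forall x, facet_set W c x -> dot s w1 <= dot s x <= dot s w2).
Local Notation t1 := (dot s w1).
Local Notation t2 := (dot s w2).

Lemma edge_dir : w2 - w1 = (t2 - t1) *: s.
Proof.
have [_ c1 _] := v1; have [_ c2 _] := v2.
by rewrite {1}(edge_point c2) {1}(edge_point c1) opprD addrACA subrr add0r -scalerBl.
Qed.

Lemma edge_barycenter x : dot c x = 1 ->
  x = w1 + ((dot s x - t1) / (t2 - t1)) *: (w2 - w1).
Proof.
move=> cx; have [_ c1 _] := v1; have [_ c2 _] := v2.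
rewrite edge_dir scalerA divfK ?subr_eq0 ?gt_eqF// {1}(edge_point cx) {1}(edge_point c1).
by rewrite -addrA -scalerDl addrCA subrr addr0.
Qed.

Lemma mem_edge x : dot c x = 1 -> hull W x <-> t1 <= dot s x <= t2.
Proof.
move=> cx; split=> [xW|/andP[x1 x2]]; first exact: wE.
have [w1W _ _] := v1; have [w2W _ _] := v2.
rewrite (edge_barycenter cx); apply: hull_segment; [exact: mem_hull|exact: mem_hull|].
have t12 : 0 < t2 - t1 by rewrite subr_gt0.
apply/andP; split; last by rewrite ler_pdivrMr// mul1r lerD2r.
by apply: divr_ge0; [rewrite subr_ge0|exact: ltW].
Qed.

(** A form which is at most [1] at both ends of an edge and equal to [1] at an
    inner point is [1] at both ends; two such forms agree on a basis of the
    plane. *)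
Lemma other_facet_lt x c' : dot c x = 1 -> t1 < dot s x < t2 ->
  is_facet W c' -> c' != c -> dot c' x < 1.
Proof.
move=> cx /andP[x1 x2] c'F c'c; have [c'W _] := c'F.
have [w1W c1 _] := v1; have [w2W c2 _] := v2.
have h1 := c'W _ w1W; have h2 := c'W _ w2W.
have t12 : 0 < t2 - t1 by rewrite subr_gt0.
set l := (dot s x - t1) / (t2 - t1).
have l0 : 0 < l by rewrite divr_gt0// subr_gt0.
have l1 : l < 1 by rewrite ltr_pdivrMr// mul1r ltrD2r.
have E : dot c' x = (1 - l) * dot c' w1 + l * dot c' w2.
  by rewrite (edge_barycenter cx) dotDr dotZr dotBr -/l; ring.
rewrite lt_neqAle; apply/andP; split; last by rewrite E; nra.
apply: contra_neq c'c => c'x.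
have E1 : dot c' w1 = 1 by apply/eqP; rewrite eq_le h1 /=; nra.
have E2 : dot c' w2 = 1 by apply/eqP; rewrite eq_le h2 /=; nra.
have ks : dot (c' - c) s = 0.
  have : (t2 - t1) * dot (c' - c) s = 0.
    have -> : (t2 - t1) * dot (c' - c) s = dot (c' - c) w2 - dot (c' - c) w1.
      by rewrite -[RHS]dotBr edge_dir dotZr.
    by rewrite !dotBl; lra.
  by move=> /eqP; rewrite mulf_eq0 (gt_eqF t12)/= => /eqP.
have ku : dot (c' - c) u = 0.
  have : d * dot (c' - c) u = 0.
    have := congr1 (dot (c' - c)) (edge_point c1).
    by rewrite dotBl E1 c1 subrr dotDr !dotZr ks mulr0 addr0 => <-.
  by move=> /eqP; rewrite mulf_eq0 (gt_eqF d0)/= => /eqP.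
apply/subr0_eq; rewrite (plane_decomp (c' - c) uu ss us).
by rewrite (dotC u) (dotC s) ku ks !scale0r addr0.
Qed.

(** Near an open edge the gauge of the polygon is given by that edge alone. *)
Lemma open_sector z : (strip d `&` cone2 d `]t1, t2[) (coord2 u s z) ->
  section2 W z /\ forall c', is_facet W c' -> c' != c ->
    dot c' (pt2 z) < dot c (pt2 z).
Proof.
move=> [zd /cone2_coord[cz]]; rewrite /= in_itv/= => tz.
set e := (dot c (pt2 z))^-1 *: pt2 z in tz.
have ce : dot c e = 1 by rewrite dotZr mulVf// gt_eqF.
have zE : pt2 z = dot c (pt2 z) *: e by rewrite scalerA divff ?scale1r// gt_eqF.
have cz1 : dot c (pt2 z) <= 1.
  by move: zd; rewrite /strip/= /u dotZl ger_pMr.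
have lt c' : is_facet W c' -> c' != c -> dot c' (pt2 z) < dot c (pt2 z).
  move=> c'F c'c; rewrite {1}zE dotZr gtr_pMr//.
  exact: other_facet_lt tz c'F c'c.
split=> //; apply/(hull_facetsP _ pW) => c' c'F.
have [->//|c'c] := eqVneq c' c.
exact: le_trans (ltW (lt _ c'F c'c)) cz1.
Qed.

Lemma closed_sector z : 0 < dot c (pt2 z) ->
  hull W ((dot c (pt2 z))^-1 *: pt2 z) ->
  cone2 d `[t1, t2] (coord2 u s z).
Proof.
move=> cz eW; apply/cone2_coord; split => //; rewrite /= in_itv/=.
by apply/mem_edge => //; rewrite dotZr mulVf// gt_eqF.
Qed.

End ends.
End sector.

Lemma cover_integral_le (disp : measure_display) (T : measurableType disp)
    (m : {measure set T -> \bar R}) (I : Type) (r : seq I) (A : I -> set T)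
    (S : set T) (f : T -> \bar R) :
  measurable S -> (forall i, measurable (A i)) ->
  measurable_fun setT f -> (forall x, 0 <= f x)%E ->
  S `<=` \big[setU/set0]_(i <- r) A i ->
  (\int[m]_(x in S) f x <= \sum_(i <- r) \int[m]_(x in A i) f x)%E.
Proof.
move=> mS mA mf f0 SA.
have mU (l : seq I) : measurable (\big[setU/set0]_(i <- l) A i).
  by elim/big_ind: _ => // B C; exact: measurableU.
apply: (@le_trans _ _ (\int[m]_(x in \big[setU/set0]_(i <- r) A i) f x)%E).
  by apply: ge0_subset_integral => //; exact: measurable_funTS.
elim: r {SA} => [|i r IH]; first by rewrite !big_nil integral_set0.
rewrite !big_cons; set B := \big[_/_]_(j <- r) _ in IH *.
have mB : measurable B by exact: mU.
rewrite -(setDUK (@subsetUl _ (A i) B)) ge0_integral_setU//; last 3 first.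
- by apply: measurableD => //; exact: measurableU.
- exact: measurable_funTS.
- by apply/disj_setPS => x [Ax [_]].
rewrite leeD2l//; apply: le_trans (IH) => //.
apply: ge0_subset_integral => //; first by apply: measurableD => //; exact: measurableU.
- exact: measurable_funTS.
- by move=> x [[]].
Qed.

Lemma disjoint_measure_le (disp : measure_display) (T : measurableType disp)
    (m : {measure set T -> \bar R}) (I : eqType) (r : seq I) (A : I -> set T)
    (S : set T) : uniq r ->
  measurable S -> (forall i, measurable (A i)) ->
  {in r, forall i, A i `<=` S} ->
  {in r &, forall i j, i != j -> A i `&` A j = set0} ->
  (\sum_(i <- r) m (A i) <= m S)%E.
Proof.
move=> + + mA; elim: r S => [|i r IH] S /=; first by rewrite big_nil.
move=> /andP[ir ur] mS AS disj; rewrite big_cons.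
have AiS : A i `<=` S by apply: AS; exact: mem_head.
have mSA : measurable (S `\` A i) by exact: measurableD.
have -> : m S = (m (A i) + m (S `\` A i))%E.
  rewrite -{1}(setDUK AiS) measureU//.
  by apply/seteqP; split => x // [Ax []].
rewrite leeD2l// IH//.
- move=> j jr x Ajx; split; first by apply: (AS j) => //; rewrite inE jr orbT.
  move=> Aix; have : (A i `&` A j) x by [].
  rewrite (disj i j) ?mem_head ?inE ?jr ?orbT//.
  by apply: contraNneq ir => ->.
- by move=> j k jr kr; apply: disj; rewrite inE ?jr ?kr orbT.
Qed.

End polygons.

(** * Solid angle of a polygon against its area *)

Section polygon_bound.
Variable R : realType.

Lemma scales_integral_invariant (disp : measure_display)
    (X : measurableType disp) (m : {measure set X -> \bar R}) (T : X -> X)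
    (f : X -> \bar R) (K : set X) :
  scales m T 1 -> measurable_fun setT f -> (forall x, 0 <= f x)%E ->
  (forall x, f (T x) = f x) -> measurable K ->
  (\int[m]_(x in T @^-1` K) f x = \int[m]_(x in K) f x)%E.
Proof.
move=> [_ sT] mf f0 fT mK.
rewrite integral_mkcond [RHS]integral_mkcond -[RHS]mul1e -sT.
- apply: eq_integral => x _; rewrite !patchE.
  have -> : (x \in T @^-1` K) = (T x \in K).
    by apply/idP/idP => /set_mem H; exact/mem_set.
  by rewrite fT.
- by apply/(measurable_restrictT _ mK); exact: measurable_funTS.
- by move=> x; rewrite erestrict_ge0.
Qed.

Lemma measurable_coord2 (u s : 'rV[R]_2) :
  measurable_fun setT (coord2 u s).
Proof.
rewrite (_ : coord2 u s = fun z => (u 0 0 * z.1 + u 0 1 * z.2 + 0,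
    s 0 0 * z.1 + s 0 1 * z.2 + 0)).
  by apply/measurable_fun_pair; exact: measurable_affine_form2.
by apply/funext => z; rewrite /coord2 !dot_pt2 !addr0.
Qed.

Lemma exists_unit_orthogonal2 (c : 'rV[R]_2) : c != 0 ->
  exists s : 'rV[R]_2, dot s s = 1 /\ dot c s = 0.
Proof.
move=> c0; have [A [AA uA]] := orthonormal_completion (unit_normal c0).
exists (A : 'rV[R]_2); split; first by rewrite /dot AA mxE.
have : dot (height c *: c) A = 0 by rewrite /dot uA mxE.
rewrite dotZl => /eqP; rewrite mulf_eq0 gt_eqF ?height_gt0//=.
by move=> /eqP.
Qed.

(** A hull around the origin is cut out by finitely many half spaces. *)
Lemma measurable_hull_section (disp : measure_display)
    (X : measurableType disp) n (W : seq 'rV[R]_n.+1) (g : X -> 'rV[R]_n.+1) :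
  pos_span W ->
  (forall c, measurable_fun setT (fun x => dot c (g x) : measurableTypeR R)) ->
  measurable [set x | hull W (g x)].
Proof.
move=> pW mg; have [Cs _ CsP] := facets_seq W.
rewrite (_ : [set x | _] = [set x | {in Cs, forall c, dot c (g x) <= 1}]); last first.
  apply/seteqP; split => x /= H.
    by move=> c /CsP; exact: ((hull_facetsP _ pW).1 H).
  by apply/(hull_facetsP _ pW) => c /CsP; exact: H.
elim: Cs {CsP} => [|c Cs IH].
  by rewrite (_ : [set x | _] = setT)//; apply/seteqP; split.
rewrite (_ : [set x | _] = [set x | dot c (g x) <= 1] `&`
   [set x | {in Cs, forall c, dot c (g x) <= 1}]).
  apply: measurableI => //.
  exact: (@measurable_le_set _ _ _ _ (fun=> 1) (mg c) (measurable_cst _)).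
apply/seteqP; split=> x /= H.
  by split=> [|b bC]; apply: H; rewrite inE ?eqxx ?bC ?orbT.
by case: H => H1 H2 b; rewrite inE => /predU1P[->//|]; exact: H2.
Qed.

Lemma measurable_dot_pt2 (c : 'rV[R]_2) :
  measurable_fun setT (fun z : plane R => dot c (pt2 z) : measurableTypeR R).
Proof.
rewrite (_ : (fun z => _) = fun z => c 0 0 * z.1 + c 0 1 * z.2 + 0).
  exact: measurable_affine_form2.
by apply/funext => z; rewrite dot_pt2 addr0.
Qed.

Lemma measurable_section2 (W : seq 'rV[R]_2) : pos_span W ->
  measurable (section2 W).
Proof.
by move=> pW; apply: measurable_hull_section => // c; exact: measurable_dot_pt2.
Qed.

(** The apex of the cones, which belongs to none of them; it is removed before
    covering. *)
Definition origin2 : set (plane R) := [set 0] `*` [set 0].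

Lemma origin2P (z : plane R) : origin2 z <-> z = 0.
Proof. by case: z => x y; split=> [[/= -> ->]|[-> ->]]. Qed.

Lemma measurable_origin2 : measurable origin2.
Proof. by apply: measurableX; exact: measurable_set1. Qed.

Lemma lam2_origin : @lam2 R origin2 = 0%E.
Proof.
pose Z : set (measurableTypeR R) := [set 0].
have mZ : measurable Z by exact: measurable_set1.
have -> : @lam2 R origin2 = (lam1 R Z * lam1 R Z)%E.
  by apply: (@product_measure1E _ _ _ _ R (lam1 R) (lam1 R)).
by rewrite lebesgue_measure_set1 mule0.
Qed.

(** The triple [D] consists of a unit vector along the edge [c] and of the two
    ends of the edge, in the order of this vector. *)
Definition edge_data (W : seq 'rV[R]_2) c (D : 'rV[R]_2 * 'rV[R]_2 * 'rV[R]_2) : Prop :=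
  [/\ dot D.1.1 D.1.1 = 1, dot c D.1.1 = 0,
      edge_vertex W c D.1.2 /\ edge_vertex W c D.2,
      dot D.1.1 D.1.2 < dot D.1.1 D.2 &
      forall x, facet_set W c x -> dot D.1.1 D.1.2 <= dot D.1.1 x <= dot D.1.1 D.2].

Lemma edge_choice (W : seq 'rV[R]_2) :
  exists D, forall c, is_facet W c -> edge_data W c (D c).
Proof.
suff /choice[D HD] : forall c, exists D, is_facet W c -> edge_data W c D by exists D.
move=> c; have [cF|] := pselect (is_facet W c); last by exists (0, 0, 0).
have [s [ss cs]] := exists_unit_orthogonal2 (facet_vec_neq0 cF).
have [w1 [w2 [v1 v2 w12 wE]]] := edge_ends cF ss cs.
by exists (s, w1, w2).
Qed.

Lemma polygon_cover (W : seq 'rV[R]_2) (Cs : seq 'rV[R]_2) D : pos_span W ->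
  (forall c, c \in Cs <-> is_facet W c) ->
  (forall c, is_facet W c -> edge_data W c (D c)) ->
  forall z, z != 0 -> exists2 c, c \in Cs &
    cone2 (height c) `[dot (D c).1.1 (D c).1.2, dot (D c).1.1 (D c).2]
      (coord2 (height c *: c) (D c).1.1 z).
Proof.
move=> pW CsP DP z z0; have z0' : pt2 z != 0 by rewrite pt2_eq0.
have [c [cF cz cW]] := cone_cover pW z0'.
exists c; first exact/CsP.
have [ss cs [v1 v2] w12 wE] := DP c cF.
exact: (closed_sector cF ss cs v1 v2 w12 wE cz cW).
Qed.

Lemma mem_bigsetU (T : Type) (I : eqType) (r : seq I) (A : I -> set T) i x :
  i \in r -> A i x -> (\big[setU/set0]_(j <- r) A j) x.
Proof.
elim: r => // j r IH; rewrite inE big_cons => /predU1P[->|ir] Ax; first by left.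
by right; exact: IH.
Qed.

(** The segments from the origin to the vertices cut the polygon into
    triangles over the edges. The closed triangles cover it, which bounds its
    solid angle from above; the open ones are disjoint, which bounds its area
    from below. For each triangle, [edge_space] bounds the solid angle by [pi
    / 6] times the area [d * (t2 - t1) / 2]. *)
Lemma polygon_bound (W : seq 'rV[R]_2) h : 1 <= h -> pos_span W ->
  (forall c, is_facet W c -> 2 <= h ^+ 2 + height c ^+ 2) ->
  (forall c w, is_facet W c -> edge_vertex W c w -> 3 <= h ^+ 2 + dot w w) ->
  (\int[@lam2 R]_(z in section2 W) (angle_density h (z.1 ^+ 2 + z.2 ^+ 2))%:E
     <= (pi / 6)%:E * @lam2 R (section2 W))%E.
Proof.
move=> h1 pW hc hw; have h0 : 0 < h by lra.
have [Cs uCs CsP] := facets_seq W.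
have [D DP] := edge_choice W.
pose f (z : plane R) : \bar R := (angle_density h (z.1 ^+ 2 + z.2 ^+ 2))%:E.
have mf : measurable_fun setT f.
  apply/measurable_EFinP.
  exact: (measurableT_comp (measurable_angle_density h0) (@measurable_sqnorm2 R)).
have f0 z : (0 <= f z)%E by rewrite lee_fin angle_density_ge0.
pose d (c : 'rV[R]_2) := height c; pose s c := (D c).1.1.
pose t1 c := dot (s c) (D c).1.2; pose t2 c := dot (s c) (D c).2.
pose L c := coord2 (d c *: c) (s c).
pose Ko c := strip (d c) `&` cone2 (d c) `]t1 c, t2 c[.
pose K c := strip (d c) `&` cone2 (d c) `[t1 c, t2 c].
have mS : measurable (section2 W) by exact: measurable_section2.
have mstrip c : measurable (strip (d c)).
  exact: (@measurable_le_set _ _ _ _ (fun=> d c) measurable_fst (measurable_cst _)).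
have mKo c : measurable (Ko c) by apply: measurableI => //; exact: measurable_cone2.
have mK c : measurable (K c) by apply: measurableI => //; exact: measurable_cone2.
have mL c A : measurable A -> measurable (L c @^-1` A).
  by move=> mA; rewrite -[X in measurable X]setTI; exact: measurable_coord2.
have sL c : is_facet W c -> scales (@lam2 R) (L c) 1.
  move=> cF; have [ss cs _ _ _] := DP c cF.
  apply: scales_coord2 => //; first exact: unit_normal (facet_vec_neq0 cF).
  by rewrite dotZl cs mulr0.
have step c : c \in Cs -> (\int[@lam2 R]_(z in L c @^-1` K c) f z <=
    (pi / 6)%:E * @lam2 R (L c @^-1` Ko c))%E.
  move=> /CsP cF; have [ss cs [v1 v2] w12 wE] := DP c cF.
  have d0 : 0 < d c by apply: height_gt0; exact: facet_vec_neq0 cF.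
  have uu := unit_normal (facet_vec_neq0 cF).
  rewrite (scales_integral_invariant (sL c cF)) //; last first.
    by move=> z; rewrite /f coord2_norm// dotZl cs mulr0.
  rewrite triangle_angle ?(ltW w12)//.
  have -> : @lam2 R (L c @^-1` Ko c) = (d c * (t2 c - t1 c) / 2)%:E.
    rewrite (scales_measure (sL c cF)) ?mul1e//.
    exact: (triangle_area d0 (ltW w12)).
  rewrite -EFinM lee_fin.
  have nw w : edge_vertex W c w -> 3 <= h ^+ 2 + d c ^+ 2 + dot (s c) w ^+ 2.
    move=> vw; have [_ cw _] := vw; have := hw c w cF vw.
    by rewrite (edge_point_norm cF ss cs cw) addrA.
  have := edge_space h1 d0 (hc c cF) (ltW w12) (nw _ v1) (nw _ v2).
  by move/le_trans; apply; rewrite /t2 /t1; lra.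
rewrite (ge0_negligible_integral (N := origin2))//; last 4 first.
- exact: measurable_origin2.
- exact: measurable_funTS.
- by move=> z _; exact: f0.
- exact: lam2_origin.
apply: (@le_trans _ _ (\sum_(c <- Cs) \int[@lam2 R]_(z in L c @^-1` K c) f z)%E).
  apply: cover_integral_le => //.
  - by apply: measurableD => //; exact: measurable_origin2.
  - by move=> c; exact: mL.
  - move=> z [zS z0'].
    have z0 : z != 0 by apply/eqP => z0; apply: z0'; exact/origin2P.
    have [c cC Hc] := polygon_cover pW CsP DP z0.
    apply: (mem_bigsetU cC); split => //.
    have cF : is_facet W c by exact/CsP.
    have d0 : 0 < d c by apply: height_gt0; exact: facet_vec_neq0 cF.
    rewrite /strip /L /coord2/= dotZl ger_pMr//.
    exact: ((hull_facetsP _ pW).1 zS).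
apply: (@le_trans _ _ (\sum_(c <- Cs) ((pi / 6)%:E * @lam2 R (L c @^-1` Ko c)))%E).
  by rewrite big_seq_cond [leRHS]big_seq_cond; apply: lee_sum => c /andP[cC _]; exact: step.
rewrite -ge0_sume_distrr//.
apply: lee_wpmul2l; first by rewrite lee_fin divr_ge0// pi_ge0.
apply: disjoint_measure_le => //.
- by move=> c; exact: mL.
- move=> c /CsP cF z; have [ss cs [v1 v2] w12 wE] := DP c cF.
  by move=> /(open_sector pW cF ss cs v1 v2 w12)[].
- move=> b c /CsP bF /CsP cF bc; rewrite -subset0 => z [].
  have [ss cs [v1 v2] w12 wE] := DP c cF.
  have [ss' cs' [v1' v2'] w12' wE'] := DP b bF.
  move=> /(open_sector pW bF ss' cs' v1' v2' w12')[_ Hb].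
  move=> /(open_sector pW cF ss cs v1 v2 w12)[_ Hc].
  have := lt_trans (Hb c cF _) (Hc b bF bc).
  by rewrite ltxx eq_sym; move=> /(_ bc).
Qed.

End polygon_bound.

(** * Facets of a polytope around the origin *)

Section facets_of_polytope.
Variable R : realType.

(** A small positive multiple of [d] is in the hull, so [d] cannot be
    nonpositive on all the generators. *)
Lemma interior_pos_span n (W : seq 'rV[R]_n) : (hull W)° 0 -> pos_span W.
Proof.
move=> h0 d d0.
have : \forall t \near (0 : R), hull W (t *: d).
  have := @scalel_continuous R _ d 0; rewrite /= => /(_ (hull W)).
  by rewrite /= scale0r; apply.
move=> /nbhs_ballP[e /= e0 eW].
have : hull W ((e / 2) *: d).
  apply: eW; rewrite /ball/= sub0r normrN gtr0_norm ?divr_gt0//.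
  by rewrite ltr_pdivrMr// ltr_pMr// ltr1n.
move=> dW; apply: contrapT => H.
have dw : {in W, forall w, dot d w <= 0}.
  by move=> w wW; rewrite leNgt; apply/negP => dw; apply: H; exists w.
have := hull_le dw dW; rewrite dotZr leNgt => /negP; apply.
by rewrite mulr_gt0 ?divr_gt0 ?dot_gt0.
Qed.

Lemma codim1_facet n (W : seq 'rV[R]_n.+1) c : is_facet W c ->
  codimension 1 (facet_set W c).
Proof.
move=> cF; have [w wW cw] := facet_neq0 cF.
pose f : 'Hom('rV[R]_n.+1, 'rV[R]_1) := linfun (mulmxr c^T).
have fE x : f x = (dot c x)%:M.
  by rewrite lfunE/= dotC; apply/matrixP => i j; rewrite !ord1 [RHS]mxE eqxx.
exists w, (lker f); split; last first.
  rewrite facet_affine_span//; apply/seteqP; split=> x /=.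
    move=> cx; exists (x - w); last by rewrite addrC subrK.
    rewrite /= memv_ker fE dotBr cx cw subrr.
    by apply/eqP/matrixP => i j; rewrite !mxE mul0rn.
  move=> [u /=]; rewrite memv_ker fE => /eqP/matrixP/(_ 0 0); rewrite !mxE eqxx mulr1n.
  by move=> cu <-; rewrite dotDr cw cu addr0.
have := limg_ker_dim f fullv; rewrite capfv dim_rV => E.
apply: etrans E; congr (_ + _)%N.
have le1 : (\dim (limg f) <= 1)%N by rewrite -[X in (_ <= X)%N](dim_rV R 1) dimvS// subvf.
apply/eqP; rewrite eq_sym eqn_leq le1/= lt0n dimv_eq0; apply/eqP => f0.
have : f w \in limg f by rewrite memv_img// memvf.
rewrite f0 memv0 fE cw => /eqP/matrixP/(_ 0 0); rewrite !mxE => /eqP.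
by rewrite oner_eq0.
Qed.

Lemma facet_set_facet n (W : seq 'rV[R]_n.+1) c : is_facet W c ->
  facet (hull W) (facet_set W c).
Proof. by move=> cF; split; [exact: facet_face|exact: codim1_facet]. Qed.

Lemma facet_set_inj n (W : seq 'rV[R]_n.+1) c c' : is_facet W c ->
  is_facet W c' -> facet_set W c = facet_set W c' -> c = c'.
Proof.
move=> [_ cW] c'F E; apply/subr0_eq/cW => w wW cw.
have : facet_set W c w by split => //; exact: mem_hull.
by rewrite E dotBl cw => -[_ /= ->]; rewrite subrr.
Qed.

Lemma volume_ge0 n m (F : set 'rV[R]_n) : (0 <= volume m F)%E.
Proof.
rewrite /volume; move: [set _ | _]; elim: m => [|m IH] S; first by rewrite lee_fin.
by apply: integral_ge0 => x _; exact: IH.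
Qed.

Lemma boundary_volume_ge n (W : seq 'rV[R]_n.+1) (Cs : seq 'rV[R]_n.+1) :
  uniq Cs -> (forall c, c \in Cs -> is_facet W c) ->
  (\sum_(c <- Cs) volume n (facet_set W c) <= boundary_volume (hull W))%E.
Proof.
move=> uCs CsF; apply: esum_ge.
exists [set` [seq facet_set W c | c <- Cs]].
  split; first exact: finite_seq.
  by move=> F /= /mapP[c cC ->]; exact/facet_set_facet/CsF.
rewrite -fsbig_seq; last first.
  by rewrite map_inj_in_uniq// => c c' cC c'C; apply: facet_set_inj; exact: CsF.
by rewrite big_map.
Qed.

(** The volume is defined through an unspecified orthonormal frame of the
    affine span. Whichever it is, a translation [y0] moves its origin to the
    foot [height c *: (height c *: c)] of the perpendicular from the origin.
    *)
Lemma facet_frame n (W : seq 'rV[R]_n.+1) c : is_facet W c ->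
  exists (A : 'M[R]_(n, n.+1)) (y0 : 'rV[R]_n),
  [/\ A *m A^T = 1%:M, (height c *: c) *m A^T = 0 &
    volume n (facet_set W c) = lebesgue_rV
      [set y | hull W (height c *: (height c *: c) + (y + y0) *m A)]].
Proof.
move=> cF; have c0 := facet_vec_neq0 cF; have h0 := height_gt0 c0.
have uu := unit_normal c0; set h := height c in h0 uu *.
set u := h *: c in uu *.
have cu : dot c u = h^-1.
  apply: (mulfI (lt0r_neq0 h0)); rewrite mulfV ?gt_eqF// -uu /u dotZl; done.
have span := facet_affine_span cF.
rewrite /volume; set f := xget _ _.
have [A1 [A1A1 uA1]] := orthonormal_completion uu.
have : orthonormal_frame (facet_set W c) f.
  apply: (@xgetPex _ (0, 0) (orthonormal_frame (facet_set W c))).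
  exists (h *: u, A1); split => //=; rewrite span; apply/seteqP; split => x /=.
    move=> cx; exists (x *m A1^T) => //; rewrite {2}(orthonormal_decomp uu A1A1 uA1 x).
    by rewrite /u dotZl cx mulr1.
  move=> [y _ <-]; rewrite dotDr dotZr cu mulfV ?gt_eqF//.
  have := dot_frame_ortho uA1 y; rewrite /u dotZl => /eqP.
  by rewrite mulf_eq0 (gt_eqF h0)/= => /eqP ->; rewrite addr0.
case: f => p A [/= AA]; rewrite span => E.
have cp y : dot c (p + y *m A) = 1.
  by have : [set x | dot c x = 1] (p + y *m A) by rewrite E; exists y.
have cA : c *m A^T = 0.
  apply/eqP; rewrite -dot_eq0 -dot_mull dotC; apply/eqP.
  have := cp (c *m A^T); have := cp 0; rewrite mul0mx addr0 dotDr => ->.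
  by move=> H; lra.
have uA : u *m A^T = 0 by rewrite /u -scalemxAl cA scaler0.
exists A, (p *m A^T); split => //; congr lebesgue_rV.
have pE y : p + y *m A = h *: u + (y + p *m A^T) *m A.
  rewrite mulmxDl [y *m A + _]addrC addrA; congr (_ + _).
  rewrite {1}(orthonormal_decomp uu AA uA p); congr (_ *: _ + _).
  by have := cp 0; rewrite mul0mx addr0 /u dotZl => ->; rewrite mulr1.
apply/seteqP; split=> y /=; rewrite -pE; first by case.
by move=> yW; split.
Qed.

Section deep.
Variables (n : nat) (W : seq 'rV[R]_n.+1) (c : 'rV[R]_n.+1).
Hypotheses (dW : deep (hull W)) (cF : is_facet W c).
Variable (A : 'M[R]_(n, n.+1)).
Local Notation h := (height c).
Local Notation u := (height c *: c).
Hypotheses (AA : A *m A^T = 1%:M) (uA : u *m A^T = 0).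

Let c0 : c != 0. Proof. exact: facet_vec_neq0 cF. Qed.
Let h0 : 0 < h. Proof. exact: height_gt0. Qed.
Let uu : dot u u = 1. Proof. exact: unit_normal. Qed.

Lemma plane_point y : dot c (h *: u + y *m A) = 1.
Proof.
have : dot u (h *: u + y *m A) = h.
  by rewrite dotDr dotZr uu mulr1 (dot_frame_ortho uA) addr0.
rewrite dotZl => /eqP; rewrite -[X in _ == X]mulr1 (inj_eq (mulfI (lt0r_neq0 h0))).
by move=> /eqP.
Qed.

Lemma facet_point x : dot c x = 1 -> x = h *: u + (x *m A^T) *m A.
Proof.
by move=> cx; rewrite {1}(orthonormal_decomp uu AA uA x) dotZl cx mulr1.
Qed.

Lemma plane_point_norm y : dot (h *: u + y *m A) (h *: u + y *m A) = h ^+ 2 + dot y y.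
Proof.
rewrite (orthonormal_norm uu AA uA) (frame_coord AA uA).
by rewrite dotZl plane_point mulr1.
Qed.

(** The unit normal of the facet is one more form that is constant on [F],
    orthogonal to the rows of [M *m A]; hence [k.+1]. *)
Lemma deep_in_facet k (F : set 'rV[R]_n.+1) (M : 'M[R]_(k, n)) r y :
  face (hull W) F -> F `<=` facet_set W c -> M *m M^T = 1%:M ->
  (forall x, F x -> x *m A^T *m M^T = r) ->
  affine_span F (h *: u + y *m A) -> k.+1%:R <= h ^+ 2 + dot y y.
Proof.
move=> fF Fc MM Mr yF; rewrite -plane_point_norm.
pose Q : 'M[R]_(1 + k, n.+1) := col_mx u (M *m A).
have AuT : A *m u^T = 0 by apply: trmx_inj; rewrite trmx_mul trmxK uA trmx0.
apply: (deep_orthonormal (Q := Q) (r := row_mx (dot u (h *: u))%:M r) dW fF) => //.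
  rewrite tr_col_mx mul_col_row trmx_mul !mulmxA uA mul0mx.
  rewrite -[M *m A *m u^T]mulmxA AuT mulmx0 -[M *m A *m A^T]mulmxA AA mulmx1 MM.
  rewrite (_ : u *m u^T = 1%:M) ?scalar_mx_block//.
  by apply/matrixP => i j; rewrite !ord1 [LHS]uu !mxE eqxx.
move=> x Fx; rewrite tr_col_mx mul_mx_row trmx_mul mulmxA Mr//; congr row_mx.
have [_ cx] := Fc x Fx.
have -> : dot u (h *: u) = dot u x by rewrite dotZr uu [RHS]dotZl cx !mulr1.
by rewrite dotC; apply/matrixP => i j; rewrite !ord1 [RHS]mxE eqxx.
Qed.

Lemma facet_height : 1 <= h.
Proof.
have := deep_codim (q := h *: u) dW (facet_face cF) (codim1_facet cF).
rewrite facet_affine_span// => /(_ _).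
have := plane_point 0; rewrite mul0mx addr0 => cu /(_ cu).
have := plane_point_norm 0; rewrite mul0mx addr0 dot0r addr0 => -> H.
by rewrite -(@ler_pXn2r _ 2)// ?nnegrE ?ler01 ?(ltW h0)// expr1n.
Qed.

End deep.

End facets_of_polytope.

(** * Perimeter of a polygon *)

Section plane_case.
Variable R : realType.

Lemma lebesgue_rV1 (S : set 'rV[R]_1) : measurable [set x : R | S x%:M] ->
  lebesgue_rV S = lam1 R [set x : R | S x%:M].
Proof.
move=> mS.
transitivity (\int[lam1 R]_x (\1_[set x : R | S x%:M] x)%:E)%E; last first.
  by rewrite integral_indic// setIT.
rewrite /lebesgue_rV; apply: eq_integral => x _.
rewrite !indicE; congr (_%:R%:E); congr nat_of_bool.
have E : row_mx x%:M (0 : 'rV[R]_0) = x%:M :> 'rV_1.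
  apply/matrixP => i j; rewrite !mxE; case: splitP => k; last by case: k.
  by rewrite !ord1 mxE.
by apply/idP/idP => /set_mem/= H; apply/mem_set => /=; move: H; rewrite E.
Qed.

Lemma edge_vertex_face n (W : seq 'rV[R]_n.+1) c w (s : 'rV[R]_n.+1) :
  is_facet W c -> w \in W -> dot c w = 1 ->
  {in W, forall v, dot c v = 1 -> dot s v <= dot s w} ->
  face (hull W) (facet_set W c `&` [set x | dot s x = dot s w]).
Proof.
move=> cF wW cw ws; apply: face_of_face; first exact: facet_face.
  move=> x; rewrite facet_hull// => xT; apply: (hull_le _ xT) => v.
  by rewrite mem_filter => /andP[/eqP cv vW]; exact: ws.
by exists w; split => //; split => //; exact: mem_hull.
Qed.

Lemma unit_dotmx n (s : 'rV[R]_n) : dot s s = 1 -> s *m s^T = 1%:M :> 'M[R]_1.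
Proof. by move=> ss; apply/matrixP => i j; rewrite !ord1 [RHS]mxE eqxx. Qed.

Lemma orth_dotmx n (c s : 'rV[R]_n) : dot c s = 0 -> c *m s^T = 0 :> 'M[R]_1.
Proof. by move=> cs; apply/matrixP => i j; rewrite !ord1 [RHS]mxE. Qed.

(** At an end of an edge two orthonormal forms are fixed: the normal and the
    direction of the edge. *)
Lemma vertex_norm2 (W : seq 'rV[R]_2) c w : deep (hull W) -> is_facet W c ->
  edge_vertex W c w -> 2 <= dot w w.
Proof.
move=> dW cF [wW cw [s [ss cs ws]]].
have c0 := facet_vec_neq0 cF.
have us : dot (height c *: c) s = 0 by rewrite dotZl cs mulr0.
have uu := unit_normal c0.
have F := edge_vertex_face cF wW cw ws.
have := @deep_in_facet R 1 W c dW cF s (unit_dotmx ss) (orth_dotmx us) 1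
  _ 1%:M (w *m s^T) (w *m s^T) F.
have <- := facet_point cF (unit_dotmx ss) (orth_dotmx us) cw.
rewrite (edge_point_norm cF ss cs cw).
have -> : dot (w *m s^T) (w *m s^T) = dot s w ^+ 2.
  have -> : w *m s^T = (dot s w)%:M.
    by rewrite dotC; apply/matrixP => i j; rewrite !ord1 [RHS]mxE eqxx.
  by rewrite dotE big_ord1 !mxE eqxx expr2.
apply.
- by move=> x [].
- by rewrite trmx1 mulmx1.
- move=> x [_ /= sx]; rewrite trmx1 mulmx1; apply/matrixP => i j.
  rewrite !ord1; move: sx; rewrite (dotC s x) (dotC s w); exact.
- by apply: sub_affine_span; split => //; split => //; exact: mem_hull.
Qed.

Lemma edge_length (W : seq 'rV[R]_2) c : pos_span W -> is_facet W c ->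
  exists s, [/\ dot s s = 1, dot c s = 0 & exists w1 w2,
   [/\ edge_vertex W c w1 /\ edge_vertex W c w2, dot s w1 < dot s w2,
     forall x, facet_set W c x -> dot s w1 <= dot s x <= dot s w2 &
     volume 1 (facet_set W c) = (dot s w2 - dot s w1)%:E]].
Proof.
move=> pW cF; have [A [y0 [AA uA ->]]] := facet_frame cF.
have c0 := facet_vec_neq0 cF.
pose s : 'rV[R]_2 := A.
have ss : dot s s = 1 by rewrite /dot AA mxE eqxx.
have us : dot (height c *: c) s = 0 by rewrite /dot uA mxE.
have cs : dot c s = 0.
  move: us; rewrite dotZl => /eqP.
  by rewrite mulf_eq0 gt_eqF ?height_gt0//= => /eqP.
have [w1 [w2 [v1 v2 w12 wE]]] := edge_ends cF ss cs.
exists s; split => //; exists w1, w2; split => //.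
set S := [set y | _].
pose y := y0 0 0.
have SE : [set x : R | S x%:M] = `[dot s w1 - y, dot s w2 - y]%classic.
  have yE x : (x%:M + y0) *m A = (x + y) *: s.
    rewrite [y0](_ : _ = y%:M) -?raddfD/= ?mul_scalar_mx//.
    by apply/matrixP => i j; rewrite !ord1 mxE eqxx.
  have cE x : dot c (height c *: (height c *: c) + (x%:M + y0) *m A) = 1.
    exact: (plane_point cF uA (x%:M + y0)).
  have sE x : dot s (height c *: (height c *: c) + (x%:M + y0) *m A) = x + y.
    by rewrite dotDr dotZr (dotC s) us mulr0 add0r yE dotZr ss mulr1.
  apply/seteqP; split => x; rewrite /S /= in_itv/=.
    move/(mem_edge cF ss cs v1 v2 w12 wE (cE x)); rewrite sE.
    by rewrite lerBlDr lerBrDr.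
  move=> H; apply/(mem_edge cF ss cs v1 v2 w12 wE (cE x)); rewrite sE.
  by move: H; rewrite lerBlDr lerBrDr.
rewrite lebesgue_rV1 SE; last exact: measurable_itv.
rewrite lebesgue_measure_itv/= lte_fin ltrD2r w12 -EFinB; congr EFin; ring.
Qed.

(** The edges are seen from the origin under angles whose sum is at least [2 *
    pi], since their sectors cover the unit disc, and [edge_plane] makes each
    edge at least [4 / pi] times as long as its angle. *)
Lemma perimeter_ge (W : seq 'rV[R]_2) : pos_span W -> deep (hull W) ->
  (8%:R%:E <= boundary_volume (hull W))%E.
Proof.
move=> pW dW; have [Cs uCs CsP] := facets_seq W.
have CsF c : c \in Cs -> is_facet W c by move/CsP.
apply: le_trans (boundary_volume_ge uCs CsF).
have [D DP] : exists D, forall c, is_facet W c ->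
    edge_data W c (D c) /\ volume 1 (facet_set W c) =
      (dot (D c).1.1 (D c).2 - dot (D c).1.1 (D c).1.2)%:E.
  suff /choice[D HD] : forall c, exists D, is_facet W c ->
    edge_data W c D /\ volume 1 (facet_set W c) =
      (dot D.1.1 D.2 - dot D.1.1 D.1.2)%:E by exists D.
  move=> c; have [cF|] := pselect (is_facet W c); last by exists (0, 0, 0).
  have [s [ss cs [w1 [w2 [v w12 wE vol]]]]] := edge_length pW cF.
  by exists (s, w1, w2).
pose L c := coord2 (height c *: c) (D c).1.1.
pose t1 c := dot (D c).1.1 (D c).1.2; pose t2 c := dot (D c).1.1 (D c).2.
pose K c := disc (R := R) `&` cone2 (height c) `[t1 c, t2 c].
have mK c : measurable (K c).
  by apply: measurableI; [exact: measurable_disc|exact: measurable_cone2].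
have sum_ge : ((pi)%:E <= \sum_(c <- Cs) (pi / 4 * (t2 c - t1 c) / 2)%:E)%E.
  apply: (le_trans (disc_area_ge R)).
  rewrite -[X in (X <= _)%E]mul1e -(integral_cst (@lam2 R) (@measurable_disc R) 1%E).
  rewrite (ge0_negligible_integral (N := @origin2 R))//; last 3 first.
  - exact: measurable_origin2.
  - exact: measurable_disc.
  - exact: lam2_origin.
  apply: (@le_trans _ _ (\sum_(c <- Cs) \int[@lam2 R]_(z in L c @^-1` K c) (cst 1%E) z)%E).
    apply: cover_integral_le => //.
    - by apply: measurableD; [exact: measurable_disc|exact: measurable_origin2].
    - by move=> c; rewrite -[X in measurable X]setTI; exact: measurable_coord2.
    move=> z [zD z0']; have z0 : z != 0 by apply/eqP => z0; apply: z0'; exact/origin2P.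
    have [c cC Hc] := polygon_cover pW CsP (fun c cF => (DP c cF).1) z0.
    apply: (mem_bigsetU cC); split => //.
    have cF := CsF c cC; have [[ss cs _ _ _] _] := DP c cF.
    rewrite /disc /L/= (coord2_norm z (unit_normal (facet_vec_neq0 cF)) ss)//.
    by rewrite dotZl cs mulr0.
  rewrite big_seq_cond [leRHS]big_seq_cond; apply: lee_sum => c /andP[cC _].
  have cF := CsF c cC; have [[ss cs [v1 v2] w12 wE] _] := DP c cF.
  have uu := unit_normal (facet_vec_neq0 cF).
  have us : dot (height c *: c) (D c).1.1 = 0 by rewrite dotZl cs mulr0.
  have h0 : 0 < height c by apply: height_gt0; exact: facet_vec_neq0 cF.
  have h1 : 1 <= height c := facet_height dW cF (unit_dotmx ss) (orth_dotmx us).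
  rewrite (scales_integral_invariant (scales_coord2 uu ss us))//.
  rewrite integral_cst// mul1e.
  rewrite [X in (X <= _)%E](_ : _ =
    ((atan (t2 c / height c) - atan (t1 c / height c)) / 2)%:E); last first.
    exact: (sector_disc_itv h0 (ltW w12)).
  rewrite lee_fin ler_pM2r ?invr_gt0//.
  have vn w : edge_vertex W c w -> 2 <= height c ^+ 2 + dot (D c).1.1 w ^+ 2.
    move=> vw; have := vertex_norm2 dW cF vw; have [_ cw _] := vw.
    by rewrite (edge_point_norm cF ss cs cw).
  exact: edge_plane h1 (ltW w12) (vn _ v1) (vn _ v2).
have volE : (\sum_(c <- Cs) volume 1 (facet_set W c) = \sum_(c <- Cs) (t2 c - t1 c)%:E)%E.
  rewrite big_seq_cond [RHS]big_seq_cond; apply: eq_bigr => c /andP[cC _].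
  by have [_ ->] := DP c (CsF c cC).
rewrite volE; move: sum_ge; rewrite !sumEFin !lee_fin -mulr_suml -mulr_sumr.
have p0 := pi_gt0 R; set S := \sum_(_ <- _) _ => H.
nra.
Qed.

End plane_case.

(** * Surface area of a polyhedron *)

Section space_case.
Variable R : realType.

Lemma lebesgue_rV2 (S : set 'rV[R]_2) :
  measurable [set z : plane R | S (pt2 z)] ->
  lebesgue_rV S = @lam2 R [set z | S (pt2 z)].
Proof.
move=> mS.
have E x y : row_mx x%:M (row_mx y%:M (0 : 'rV[R]_0)) = pt2 (x, y) :> 'rV_2.
  apply/rowP => i; rewrite !mxE; case: splitP => k ik.
    by rewrite !ord1 mxE eqxx (_ : i = 0)//; apply: val_inj; rewrite /= ik ord1.
  rewrite (_ : i == 0 = false); last by apply/negP => /eqP i0; move: ik; rewrite i0.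
  rewrite mxE; case: splitP => l; last by case: l.
  by rewrite !ord1 mxE eqxx.
transitivity (\int[lam1 R]_x \int[lam1 R]_y (\1_[set z : plane R | S (pt2 z)] (x, y))%:E)%E.
  rewrite /lebesgue_rV; apply: eq_integral => x _; apply: eq_integral => y _.
  rewrite !indicE; congr (_%:R%:E); congr nat_of_bool.
  by apply/idP/idP => /set_mem/= H; apply/mem_set => /=; move: H; rewrite E.
rewrite -(@fubini_tonelli1 _ _ _ _ R (lam1 R) (lam1 R) (fun z => (\1_[set z : plane R | S (pt2 z)] z)%:E))//.
  by rewrite integral_indic// setIT.
by apply/measurable_EFinP; exact: measurable_indic.
Qed.

Lemma lam2_translate (A : set (plane R)) (p : plane R) : measurable A ->
  @lam2 R [set z | A (z.1 + p.1, z.2 + p.2)] = @lam2 R A.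
Proof.
move=> mA; have D0 : 1 * 1 - 0 * 0 != 0 :> R by rewrite mul0r subr0 mulr1 oner_neq0.
have sT := scales_affine2 p.1 p.2 D0.
have := scales_measure sT mA.
rewrite mul0r subr0 mulr1 normr1 invr1 mul1e => <-.
congr (lam2 _); apply/seteqP; split => z /=;
  by rewrite !mul1r !mul0r addr0 add0r.
Qed.

Definition coord3 (u : 'rV[R]_3) (A : 'M[R]_(2, 3)) (z : space3 R) : space3 R :=
  (dot u (pt3 z), (dot (row 0 A) (pt3 z), dot (row 1 A) (pt3 z))).

Lemma coord3E (u : 'rV[R]_3) (A : 'M[R]_(2, 3)) z :
  pt3 z *m A^T = pt2 (coord3 u A z).2.
Proof.
have H i : (pt3 z *m A^T) 0 i = dot (row i A) (pt3 z).
  by rewrite dotC /dot !mxE; apply: eq_bigr => k _; rewrite !mxE.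
apply/rowP => i; rewrite H [RHS]mxE /=; case: eqP => [->//|/eqP i0].
by rewrite (_ : i = 1)//; apply: val_inj; case: i i0 => -[|[|]].
Qed.

(** As in the plane, the square of the determinant is the Gram determinant. *)
Lemma scales_coord3 (u : 'rV[R]_3) (A : 'M[R]_(2, 3)) : dot u u = 1 ->
  A *m A^T = 1%:M -> u *m A^T = 0 -> scales (@lam3 R) (coord3 u A) 1.
Proof.
move=> uu AA uA; pose v := row 0 A; pose w := row 1 A.
have HA i j : dot (row i A) (row j A) = (i == j)%:R.
  have := congr1 (fun M : 'M[R]_2 => M i j) AA; rewrite !mxE => <-.
  by rewrite dotE; apply: eq_bigr => k _; rewrite !mxE.
have Hu i : dot u (row i A) = 0.
  have := congr1 (fun M : 'rV[R]_2 => M 0 i) uA; rewrite !mxE => <-.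
  by rewrite dotE; apply: eq_bigr => k _; rewrite !mxE.
have vv : dot v v = 1 by rewrite HA.
have ww : dot w w = 1 by rewrite HA.
have vw : dot v w = 0 by rewrite HA.
have uv : dot u v = 0 by rewrite Hu.
have uw : dot u w = 0 by rewrite Hu.
pose D := det3 (u 0 0) (u 0 1) (u 0 2%:R) (v 0 0) (v 0 1) (v 0 2%:R) (w 0 0) (w 0 1) (w 0 2%:R).
have DD : D ^+ 2 = 1.
  transitivity (det3 (dot u u) (dot u v) (dot u w) (dot u v) (dot v v) (dot v w)
     (dot u w) (dot v w) (dot w w)).
    by rewrite !dot3E /D /det3; ring.
  by rewrite uu uv uw vv vw ww /det3; ring.
have D0 : D != 0 by apply: contra_eq_neq DD => ->; rewrite expr0n eq_sym oner_neq0.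
have nD : `|D| = 1.
  by apply: (@pexpIrn _ 2); rewrite ?nnegrE// real_normK ?num_real// expr1n.
have := scales_linear3 D0; rewrite -/D nD invr1.
by congr scales; apply/funext => z; rewrite /coord3 !dot_pt3.
Qed.

(** A null set containing the apex of the cones. *)
Definition slab0 : set (space3 R) := [set 0] `*` setT.

Lemma measurable_slab0 : measurable slab0.
Proof. by apply: measurableX => //; exact: measurable_set1. Qed.

Lemma lam3_slab0 : @lam3 R slab0 = 0%E.
Proof.
pose Z : set (measurableTypeR R) := [set 0].
have mZ : measurable Z by exact: measurable_set1.
have -> : @lam3 R slab0 = (lam1 R Z * @lam2 R setT)%E.
  by apply: (@product_measure1E _ _ _ _ R (lam1 R) (@lam2 R)).
by rewrite lebesgue_measure_set1 mul0e.
Qed.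

Section facet.
Variables (W : seq 'rV[R]_3) (c : 'rV[R]_3) (A : 'M[R]_(2, 3)).
Hypotheses (pW : pos_span W) (dW : deep (hull W)) (cF : is_facet W c).
Local Notation h := (height c).
Local Notation u := (height c *: c).
Hypotheses (AA : A *m A^T = 1%:M) (uA : u *m A^T = 0).

(** The facet in the coordinates of its plane given by [A], the foot of the
    perpendicular from the origin being at [0]. *)
Definition plane_section : set (plane R) :=
  [set z | hull W (height c *: (height c *: c) + pt2 z *m A)].

Let W2 := [seq v *m A^T | v <- tight W c].

Let plane_hull y : hull W (h *: u + y *m A) <-> hull W2 y.
Proof.
have cy := plane_point cF uA y.
have -> : hull W (h *: u + y *m A) <-> hull (tight W c) (h *: u + y *m A).
  by rewrite -facet_hull// /facet_set /=; tauto.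
split=> H.
  have := hull_affine 0 A^T H; rewrite add0r (frame_coord AA uA).
  by rewrite (eq_map (g := fun v => v *m A^T))// => v; rewrite add0r.
have := hull_affine (h *: u) A H; rewrite -map_comp.
rewrite (_ : [seq _ | v <- tight W c] = tight W c)//.
rewrite -[RHS]map_id; apply/eq_in_map => v /[!mem_filter]/andP[/eqP cv vW] /=.
by rewrite -(facet_point cF AA uA cv).
Qed.

(** On the plane of the facet, [d *m A] is the form [d] of the coordinates. *)
Let cut (d : 'rV[R]_2) b : set 'rV[R]_3 :=
  facet_set W c `&` [set x | dot (d *m A) x = b].

Let dotA (d y : 'rV[R]_2) : dot (d *m A) (h *: u + y *m A) = dot d y.
Proof.
by rewrite dotDr dotZr (dotC _ u) (dot_frame_ortho uA) mulr0 add0r (dot_frame AA).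
Qed.

Let facet_coord x : facet_set W c x -> hull W2 (x *m A^T) /\ x = h *: u + x *m A^T *m A.
Proof.
move=> [xW cx]; have E := facet_point cF AA uA cx; split => //.
by apply/plane_hull; rewrite -E.
Qed.

Let mem_facet y : hull W2 y -> facet_set W c (h *: u + y *m A).
Proof. by move=> /plane_hull yW; split => //; exact: (plane_point cF uA y). Qed.

Let cut_face d b y : {in W2, forall w, dot d w <= b} -> hull W2 y ->
  dot d y = b -> face (hull W) (cut d b).
Proof.
move=> db yW dy; apply: face_of_face; first exact: facet_face.
  by move=> x /facet_coord[xW ->]; rewrite dotA; exact: hull_le xW.
by exists (h *: u + y *m A); split; [exact: mem_facet|rewrite /= dotA].
Qed.

Let cut_mx (d : 'rV[R]_2) b x : cut d b x -> x *m A^T *m d^T = b%:M.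
Proof.
move=> [/facet_coord[xW E]] /=; rewrite {1}E dotA => dx.
by rewrite -dx dotC; apply/matrixP => i j; rewrite !ord1 [RHS]mxE eqxx.
Qed.

(** Such a point [y] lies on a face of the facet on which the normalised form
    [d] is constant. *)
Let support_bound (d y : 'rV[R]_2) : d != 0 -> hull W2 y ->
  {in W2, forall w, dot d w <= dot d y} -> 2 <= h ^+ 2 + dot y y.
Proof.
move=> d0 yW dy; set e := height d *: d.
have ee : dot e e = 1 by exact: unit_normal.
have ey : {in W2, forall w, dot e w <= dot e y}.
  by move=> w wW; rewrite !dotZl ler_wpM2l ?dy// ltW// height_gt0.
apply: (@deep_in_facet R 2 W c dW cF A AA uA 1 _ e (dot e y)%:M y (cut_face ey yW erefl)).
- by move=> x [].
- exact: (unit_dotmx ee).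
- by move=> x; exact: cut_mx.
- by apply: sub_affine_span; split; [exact: mem_facet|rewrite /= dotA].
Qed.

(** The foot [q] of the perpendicular from [0] to the line of an edge can be
    outside the edge, but it belongs to the affine span of the edge. *)
Let edge_height c2 : is_facet W2 c2 -> 2 <= h ^+ 2 + height c2 ^+ 2.
Proof.
move=> c2F; have c20 := facet_vec_neq0 c2F; set e := height c2 *: c2.
have ee : dot e e = 1 by exact: unit_normal.
have [s [ss cs]] := exists_unit_orthogonal2 c20.
have [w1 [w2 [v1 v2 w12 wE]]] := edge_ends c2F ss cs.
have [w1W c1 _] := v1; have [w2W c2E _] := v2.
have eW : {in W2, forall w, dot e w <= height c2}.
  move=> w wW; rewrite dotZl ler_piMr ?(ltW (height_gt0 c20))//.
  by case: c2F => + _; apply.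
have ew w : dot c2 w = 1 -> dot e w = height c2 by rewrite dotZl => ->; rewrite mulr1.
set q := height c2 *: e.
have cq : dot c2 q = 1.
  rewrite /q /e !dotZr mulrA -expr2 height_sqr mulVf// gt_eqF// dot_gt0//.
have qE := edge_barycenter c2F ss cs v1 v2 w12 cq.
have := @deep_in_facet R 2 W c dW cF A AA uA 1 _ e (height c2)%:M q
  (cut_face eW (mem_hull w1W) (ew _ c1)).
have -> : dot q q = height c2 ^+ 2 by rewrite dotZl dotZr ee mulr1 expr2.
apply.
- by move=> x [].
- exact: (unit_dotmx ee).
- by move=> x; exact: cut_mx.
- rewrite qE mulmxDl -scalemxAl mulmxBl addrA.
  have -> : w2 *m A - w1 *m A = (h *: u + w2 *m A) - (h *: u + w1 *m A).
    by rewrite opprD addrACA subrr add0r.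
  by apply: affine_span_line; (split; [exact/mem_facet/mem_hull|rewrite /= dotA ew]).
Qed.

(** Three orthonormal forms are fixed at a vertex: the normal of the facet,
    the normal [e] of an edge in the plane of the facet, and the direction [s]
    of this edge. *)
Let vertex_norm c2 w : is_facet W2 c2 -> edge_vertex W2 c2 w ->
  3 <= h ^+ 2 + dot w w.
Proof.
move=> c2F [wW cw [s [ss cs sw]]].
have c20 := facet_vec_neq0 c2F; set e := height c2 *: c2.
have ee : dot e e = 1 by exact: unit_normal.
have es : dot e s = 0 by rewrite dotZl cs mulr0.
have eW : {in W2, forall w, dot e w <= height c2}.
  move=> v vW; rewrite dotZl ler_piMr ?(ltW (height_gt0 c20))//.
  by case: c2F => + _; apply.
have ew v : dot c2 v = 1 -> dot e v = height c2 by rewrite dotZl => ->; rewrite mulr1.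
have F1 := cut_face eW (mem_hull wW) (ew _ cw).
have F2 : face (hull W) (cut e (height c2) `&` [set x | dot (s *m A) x = dot s w]).
  apply: face_of_face => //; last first.
    exists (h *: u + w *m A); split; last by rewrite /= dotA.
    by split; [exact/mem_facet/mem_hull|rewrite /= dotA ew].
  move=> x [/facet_coord[xW E]] /=; rewrite E !dotA => ex.
  have : facet_set W2 c2 (x *m A^T).
    split => //=; apply: (mulfI (lt0r_neq0 (height_gt0 c20))).
    by rewrite mulr1 -[RHS]ex dotZl.
  rewrite facet_hull// => xT; apply: (hull_le _ xT) => v.
  by rewrite mem_filter => /andP[/eqP cv vW]; exact: sw.
(* The number [1 + 1] of rows makes the product of block matrices typecheck. *)
apply: (@deep_in_facet R 2 W c dW cF A AA uA (1 + 1) _ (col_mx e s)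
   (row_mx (height c2)%:M (dot s w)%:M) w F2).
- by move=> x [[]].
- rewrite tr_col_mx mul_col_row (unit_dotmx ee) (unit_dotmx ss) (orth_dotmx es).
  by rewrite (orth_dotmx (s := e)) ?(dotC s)// scalar_mx_block.
- move=> x [xc /= sx]; rewrite tr_col_mx mul_mx_row (cut_mx xc).
  by congr row_mx; apply: (@cut_mx s); case: xc.
- apply: sub_affine_span; split; last by rewrite /= dotA.
  by split; [exact/mem_facet/mem_hull|rewrite /= dotA ew].
Qed.

Let h1 : 1 <= h. Proof. exact: (facet_height dW cF AA uA). Qed.

Lemma measurable_plane_section : measurable plane_section.
Proof.
apply: measurable_hull_section => // d.
rewrite (_ : (fun _ => _) = fun z => dot d (h *: u) + dot (d *m A^T) (pt2 z)).
  by apply: measurable_funD => //; exact: measurable_dot_pt2.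
by apply/funext => z; rewrite dotDr; congr (_ + _); rewrite dotC dot_mull dotC.
Qed.

(** If the foot of the perpendicular from the origin is interior to the facet,
    this is [polygon_bound]. Otherwise the point of the facet nearest to the
    origin is on a proper face, so the whole facet is at distance at least
    [Num.sqrt 2], where the density is at most [1 / 2], hence at most [pi /
    6]. *)
Lemma facet_area_ge :
  (\int[@lam2 R]_(z in plane_section) (angle_density h (z.1 ^+ 2 + z.2 ^+ 2))%:E
     <= (pi / 6)%:E * @lam2 R plane_section)%E.
Proof.
have h0 : 0 < h by apply: lt_le_trans ltr01 h1.
have [pW2|npW2] := pselect (pos_span W2).
  have -> : plane_section = section2 W2.
    by apply/seteqP; split=> z /plane_hull.
  exact: (polygon_bound h1 pW2 edge_height vertex_norm).
have far y : hull W2 y -> 2 <= h ^+ 2 + dot y y.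
  have [w0 w0W] : exists w, w \in W2.
    have [v vW cv] := facet_neq0 cF; exists (v *m A^T).
    by apply: map_f; rewrite mem_filter cv eqxx.
  move=> yW.
  have [p pH pmin] := nearest_point (0 : 'rV[R]_2) (ex_intro _ w0 w0W).
  have min : {in W2, forall w, dot p p <= dot p w}.
    by move=> w /pmin; rewrite sub0r dotNl dotBr oppr_le0 subr_ge0.
  (* [p] is the point nearest to the foot [0] of the perpendicular. *)
  suff p2 : 2 <= h ^+ 2 + dot p p.
    have py : dot p p <= dot p y.
      rewrite -lerN2 -!dotNl; apply: (hull_le _ yW) => w wW.
      by rewrite !dotNl lerN2 min.
    have := dot_ge0 (y - 1 *: p); rewrite dot_subZ (dotC y p); lra.
  have [p0|p0] := eqVneq p 0; last first.
    apply: (support_bound (d := - p)) => //; first by rewrite oppr_eq0.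
    by move=> w wW; rewrite !dotNl lerN2 min.
  move: npW2 => /existsNP[e /not_implyP[e0 H]].
  apply: (support_bound e0) => //.
  move=> w wW; rewrite p0 dot0r leNgt; apply/negP => ew.
  by apply: H; exists w.
have mP := measurable_plane_section.
rewrite -integral_cst//; apply: ge0_le_integral => //.
- by move=> z _; rewrite lee_fin angle_density_ge0.
- apply/measurable_EFinP; apply: measurable_funTS.
  exact: (measurableT_comp (measurable_angle_density h0) (@measurable_sqnorm2 R)).
move=> z /plane_hull/far; rewrite dot2E !mxE/= -!expr2 lee_fin => Q.
rewrite /angle_density; set q := z.1 ^+ 2 + z.2 ^+ 2 in Q *.
set r := Num.sqrt _; have r2 : r ^+ 2 = h ^+ 2 + q by rewrite sqr_sqrtr//; lra.
have r0 : 0 < r by rewrite sqrtr_gt0; lra.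
have q0 : 0 <= q by rewrite addr_ge0// sqr_ge0.
have hr : h <= r.
  by rewrite -(@ler_pXn2r _ 2)// ?nnegrE ?(ltW h0) ?(ltW r0)// r2 lerDl.
have p3 := pi_ge3 R.
rewrite ler_pdivrMr ?exprn_gt0//.
have : r * 2 <= r ^+ 3 by rewrite exprSr mulrC ler_wpM2r ?(ltW r0)// r2.
nra.
Qed.

End facet.

(** The facets are seen from the origin under solid angles whose sum is at
    least [4 * pi], since the cones over them cover the unit ball, and
    [facet_area_ge] bounds each solid angle by [pi / 6] times the area of the
    facet. The constant [pi / 18] is a third of this, as volumes in the ball
    are a third of solid angles. *)
Lemma surface_ge (W : seq 'rV[R]_3) : pos_span W -> deep (hull W) ->
  (24%:R%:E <= boundary_volume (hull W))%E.
Proof.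
move=> pW dW; have [Cs uCs CsP] := facets_seq W.
have CsF c : c \in Cs -> is_facet W c by move/CsP.
apply: le_trans (boundary_volume_ge uCs CsF).
have [A AP] : exists A : 'rV[R]_3 -> 'M[R]_(2, 3), forall c, is_facet W c ->
    [/\ A c *m (A c)^T = 1%:M, (height c *: c) *m (A c)^T = 0 &
        volume 2 (facet_set W c) = @lam2 R (plane_section W c (A c))].
  suff /choice[A HA] : forall c, exists A : 'M[R]_(2, 3), is_facet W c ->
    [/\ A *m A^T = 1%:M, (height c *: c) *m A^T = 0 &
        volume 2 (facet_set W c) = @lam2 R (plane_section W c A)] by exists A.
  move=> c; have [cF|] := pselect (is_facet W c); last by exists 0.
  have [A [y0 [AA uA vol]]] := facet_frame cF.
  exists A => _; split => //; rewrite vol.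
  have mP := measurable_plane_section c A pW.
  have E z : pt2 z + y0 = pt2 (z.1 + y0 0 0, z.2 + y0 0 1).
    apply/rowP => i; rewrite !mxE/=; case: eqP => [->//|/eqP i0].
    by rewrite (_ : i = 1)//; apply: val_inj; case: i i0 => -[|[|]].
  rewrite -(lam2_translate (y0 0 0, y0 0 1) mP).
  have SE : [set z : plane R | [set y | hull W (height c *: (height c *: c) + (y + y0) *m A)] (pt2 z)] =
      [set z | plane_section W c A (z.1 + y0 0 0, z.2 + y0 0 1)].
    by apply/seteqP; split => z /=; rewrite /plane_section /= E.
  rewrite lebesgue_rV2 SE//.
  have D0 : 1 * 1 - 0 * 0 != 0 :> R by rewrite mul0r subr0 mulr1 oner_neq0.
  have [mT _] := scales_affine2 (y0 0 0) (y0 0 1) D0.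
  have := mT measurableT _ mP; rewrite setTI.
  congr (measurable _); apply/seteqP; split => z /=;
    by rewrite !mul1r !mul0r addr0 add0r.
pose h (c : 'rV[R]_3) := height c; pose L c := coord3 (h c *: c) (A c).
pose S c := plane_section W c (A c).
pose K c := ball3 (R := R) `&` cone3 (h c) (S c).
have mS c : measurable (S c) by exact: measurable_plane_section.
have mK c : measurable (K c).
  by apply: measurableI; [exact: measurable_ball3|exact: measurable_cone3].
have mL c : measurable_fun setT (L c).
  rewrite (_ : L c = fun z =>
    ((h c *: c) 0 0 * z.1 + (h c *: c) 0 1 * z.2.1 + (h c *: c) 0 2%:R * z.2.2 + 0,
     (row 0 (A c) 0 0 * z.1 + row 0 (A c) 0 1 * z.2.1 + row 0 (A c) 0 2%:R * z.2.2 + 0,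
      row 1 (A c) 0 0 * z.1 + row 1 (A c) 0 1 * z.2.1 + row 1 (A c) 0 2%:R * z.2.2 + 0))).
    by apply/measurable_fun_pair; [|apply/measurable_fun_pair]; exact: measurable_affine_form3.
  by apply/funext => z; rewrite /L /coord3 !dot_pt3 !addr0.
have sum_ge : ((4 * pi / 3)%:E <=
    \sum_(c <- Cs) ((pi / 18)%:E * volume 2 (facet_set W c)))%E.
  apply: (le_trans (ball_volume_ge R)).
  rewrite -[X in (X <= _)%E]mul1e -(integral_cst (@lam3 R) (@measurable_ball3 R) 1%E).
  rewrite (ge0_negligible_integral (N := slab0))//; last 3 first.
  - exact: measurable_slab0.
  - exact: measurable_ball3.
  - exact: lam3_slab0.
  apply: (@le_trans _ _ (\sum_(c <- Cs) \int[@lam3 R]_(z in L c @^-1` K c) (cst 1%E) z)%E).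
    apply: cover_integral_le => //.
    - by apply: measurableD; [exact: measurable_ball3|exact: measurable_slab0].
    - by move=> c; rewrite -[X in measurable X]setTI; exact: mL.
    move=> z [zB z0'].
    have z0 : z != 0 by apply/eqP => z0; apply: z0'; rewrite z0.
    have z0'' : pt3 z != 0 by rewrite pt3_eq0.
    have [c [cF cz cW]] := cone_cover pW z0''.
    have cC : c \in Cs by exact/CsP.
    have [AA uA _] := AP c cF.
    have c0 := facet_vec_neq0 cF; have h0 := height_gt0 c0.
    have uu := unit_normal c0.
    apply: (mem_bigsetU cC); split.
      have := orthonormal_norm uu AA uA (pt3 z).
      rewrite (coord3E (height c *: c)) dot3E dot2E !mxE/= -!expr2 => E.
      by rewrite /ball3/= -E -addrA.
    rewrite /cone3 /=; split; first by rewrite dotZl mulr_gt0.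
    rewrite /S /plane_section /=.
    set p := pt2 _; have -> : p = (dot c (pt3 z))^-1 *: (pt3 z *m (A c)^T).
      rewrite (coord3E (height c *: c)); apply/rowP => i; rewrite !mxE/=.
      have nz : h c * dot c (pt3 z) != 0 by rewrite mulf_neq0// gt_eqF.
      have E : h c / dot (h c *: c) (pt3 z) = (dot c (pt3 z))^-1.
        by rewrite dotZl; field; rewrite !gt_eqF.
      by rewrite E; case: ifP.
    rewrite -scalemxAl.
    suff -> : height c *: (height c *: c) + (dot c (pt3 z))^-1 *: (pt3 z *m (A c)^T *m A c) =
      (dot c (pt3 z))^-1 *: pt3 z by [].
    rewrite {4}(orthonormal_decomp uu AA uA (pt3 z)) scalerDr; congr (_ + _).
    rewrite dotZl !scalerA; congr (_ *: _); field; exact: lt0r_neq0 cz.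
  rewrite big_seq_cond [leRHS]big_seq_cond; apply: lee_sum => c /andP[cC _].
  have cF := CsF c cC; have [AA uA ->] := AP c cF.
  have c0 := facet_vec_neq0 cF; have h0 := height_gt0 c0.
  have uu := unit_normal c0.
  rewrite (scales_integral_invariant (scales_coord3 uu AA uA))//.
  rewrite integral_cst// mul1e.
  rewrite [X in (X <= _)%E](_ : _ = \int[@lam2 R]_(y in S c) (angle_density (h c) (y.1 ^+ 2 + y.2 ^+ 2) / 3)%:E)%E; last first.
    exact: (cone_ball h0 (mS c)).
  under eq_integral do rewrite EFinM muleC.
  rewrite ge0_integralZl//=; last 2 first.
  - apply/measurable_EFinP; apply: measurable_funTS.
    exact: (measurableT_comp (measurable_angle_density h0) (@measurable_sqnorm2 R)).
  - by move=> z _; rewrite lee_fin angle_density_ge0.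
  rewrite (_ : pi / 18 = 3^-1 * (pi / 6)); last by field.
  rewrite EFinM -muleA; apply: lee_wpmul2l; first by rewrite lee_fin.
  exact: facet_area_ge.
have p0 := pi_gt0 R.
have p18 : 0 < pi / 18 :> R by rewrite divr_gt0.
move: sum_ge; rewrite -ge0_sume_distrr => [|c _]; last exact: volume_ge0.
rewrite (_ : 4 * pi / 3 = pi / 18 * 24); last by lra.
rewrite EFinM lee_pmul2l//.
Qed.

End space_case.

(** * Conclusion *)

Unset Implicit Arguments.
Set Strict Implicit.

Theorem theorem1p2 (R : realType) (n : nat) (P : set 'rV[R]_n)
    (hn : n = 2%N \/ n = 3%N)
    (hP : polyhedron P)
    (h0 : P° 0)
    (hdist : forall (k : nat) (F : set 'rV[R]_n), face P F -> codimension k F ->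
       Num.sqrt (k%:R : R) <= euclid_dist 0 (affine_span F)) :
  ((n * 2 ^ n)%N%:R%:E <= boundary_volume P)%E.
Proof.
have [V /finite_seqP[W VW] PV] := hP.
have PW : P = hull W by rewrite PV VW.
move: h0 hdist; rewrite {}PW {P V hP VW PV} => h0 hdist.
case: hn => n_eq; subst n.
  by apply: perimeter_ge => //; exact: interior_pos_span.
by apply: surface_ge => //; exact: interior_pos_span.
Qed.
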